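(* Let $k$ be an algebraic number field, $G$ a connected $k$-algebraic group and $B$ a Borel subgroup of $G$. Then every subgroup of $B_{\mathcal O_k}$ is separable in $G_{\mathcal O_k}$.
   Context: A linear algebraic group is a Zariski closed subgroup of $\mathrm{GL}(n;\mathbb C)$; it is $k$-algebraic if its vanishing ideal is generated by polynomials with coefficients in $k$. For a subring $R\subset\mathbb C$, the $R$-points are $G_R=G\cap\mathrm{GL}(n;R)$. $\mathcal O_k$ is the ring of integers of $k$. A Borel subgroup is a maximal connected solvable algebraic subgroup (it need not be defined over $k$). A subgroup $H<\Gamma$ is separable in $\Gamma$ if for every $g\in\Gamma\setminus H$ there is a finite index subgroup $K<\Gamma$ with $H<K$, $g\notin K$. *)

(* Defs.v *)
From HB Require Import structures.
From mathcomp Require Import all_boot all_order all_algebra.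
From mathcomp Require Import Rstruct complex.
From mathcomp Require Import mpoly.
Set Implicit Arguments. Unset Strict Implicit. Unset Printing Implicit Defensive.
Import Order.TTheory GRing.Theory Num.Theory.
Local Open Scope ring_scope.

Notation C := (Rdefinitions.R)[i].

Notation mxpolyC n := {mpoly C[(n * n)%N]}.

Definition mxev (n : nat) (p : mxpolyC n) (A : 'M[C]_n) : C :=
  p.@[fun i => mxvec A 0 i].

Definition GLC (n : nat) (A : 'M[C]_n) : Prop := A \in unitmx.

Definition zariski_closed (n : nat) (S : 'M[C]_n -> Prop) : Prop :=
  exists P : mxpolyC n -> Prop,
    forall A, S A <-> (GLC A /\ forall p, P p -> mxev p A = 0).

Definition is_subgroup (n : nat) (S : 'M[C]_n -> Prop) : Prop :=
  (forall A, S A -> GLC A) /\ S 1%:M /\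
  (forall A B, S A -> S B -> S (A *m B)) /\
  (forall A, S A -> S (invmx A)).

Definition subsetM (n : nat) (S T : 'M[C]_n -> Prop) : Prop :=
  forall A, S A -> T A.

Definition linear_algebraic_group (n : nat) (G : 'M[C]_n -> Prop) : Prop :=
  is_subgroup G /\ zariski_closed G.

Definition zariski_connected (n : nat) (X : 'M[C]_n -> Prop) : Prop :=
  ~ exists Z1 Z2 : 'M[C]_n -> Prop,
      [/\ zariski_closed Z1, zariski_closed Z2,
          (forall A, X A -> Z1 A \/ Z2 A),
          (exists A, X A /\ Z1 A) /\ (exists A, X A /\ Z2 A) &
          (forall A, X A -> Z1 A -> Z2 A -> False)].

(* Solvability of an abstract subgroup S of GL(n;C): there is a finite
   chain S = H_0 >= H_1 >= ... >= H_m = {1} of subgroups such that every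
   commutator of elements of H_i lies in H_(i+1) (equivalently the derived
   series of S reaches {1}). *)
Definition solvable_grp (n : nat) (S : 'M[C]_n -> Prop) : Prop :=
  exists (m : nat) (H : nat -> 'M[C]_n -> Prop),
    [/\ (forall A, H 0%N A <-> S A),
        (forall A, H m A -> A = 1%:M),
        (forall i, is_subgroup (H i)),
        (forall i, subsetM (H i.+1) (H i)) &
        (forall i A B, H i A -> H i B ->
            H i.+1 (invmx A *m invmx B *m A *m B))].

Definition connected_solvable_algebraic_subgroup (n : nat)
    (G B : 'M[C]_n -> Prop) : Prop :=
  [/\ linear_algebraic_group B, subsetM B G, zariski_connected B &
      solvable_grp B].

Definition borel_subgroup (n : nat) (G B : 'M[C]_n -> Prop) : Prop :=
  connected_solvable_algebraic_subgroup G B /\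
  forall B', connected_solvable_algebraic_subgroup G B' ->
    subsetM B B' -> subsetM B' B.

Definition number_field (k : C -> Prop) : Prop :=
  [/\ k 0 /\ k 1,
      (forall x y, k x -> k y -> k (x + y)) /\ (forall x, k x -> k (- x)),
      (forall x y, k x -> k y -> k (x * y)),
      (forall x, k x -> x != 0 -> k x^-1) &
      exists (d : nat) (b : 'I_d -> C), (forall i, k (b i)) /\
        forall x, k x -> exists c : 'I_d -> rat,
          x = \sum_(i < d) ratr (c i) * b i].

Definition ring_of_integers (k : C -> Prop) (x : C) : Prop :=
  k x /\ exists p : {poly int}, p \is monic /\
    root (map_poly (fun z : int => z%:~R : C) p) x.

Definition vanishes_on (n : nat) (G : 'M[C]_n -> Prop) (p : mxpolyC n) : Prop :=
  forall A, G A -> mxev p A = 0.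

Definition poly_over (n : nat) (k : C -> Prop) (p : mxpolyC n) : Prop :=
  forall m, k (p@_m).

(* G is k-algebraic: its vanishing ideal in C[x_ij] is generated by
   polynomials with coefficients in k (i.e. every vanishing polynomial is a
   C[x_ij]-combination of vanishing polynomials with coefficients in k). *)
Definition k_algebraic (n : nat) (k : C -> Prop) (G : 'M[C]_n -> Prop) : Prop :=
  forall p, vanishes_on G p ->
    exists s : seq (mxpolyC n * mxpolyC n),
      (forall qr, qr \in s -> vanishes_on G qr.2 /\ poly_over k qr.2) /\
      p = \sum_(qr <- s) qr.1 * qr.2.

Definition GLR (n : nat) (R : C -> Prop) (A : 'M[C]_n) : Prop :=
  A \in unitmx /\ (forall i j, R (A i j)) /\ (forall i j, R (invmx A i j)).

Definition points (n : nat) (R : C -> Prop) (G : 'M[C]_n -> Prop)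
    : 'M[C]_n -> Prop :=
  fun A => G A /\ GLR R A.

Definition finite_index (n : nat) (Gamma K : 'M[C]_n -> Prop) : Prop :=
  exists (d : nat) (t : 'I_d -> 'M[C]_n), (forall i, Gamma (t i)) /\
    forall g, Gamma g -> exists i, K (invmx (t i) *m g).

Definition separable_in (n : nat) (Gamma H : 'M[C]_n -> Prop) : Prop :=
  forall g, Gamma g -> ~ H g ->
    exists K : 'M[C]_n -> Prop,
      [/\ is_subgroup K, subsetM K Gamma, finite_index Gamma K,
          subsetM H K & ~ K g].

(* Main.v *)
(* By the Lie-Kolchin theorem, B_{O_k} is triangular in a basis over a number field
   K. Its elements are then described by integral coordinates: the exponents of the
   diagonal entries with respect to generators of the unit group of O_K, which is
   finitely generated by Dirichlet, and the coordinates of the entries below the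
   diagonal in an integral basis of O_K, diagonal by diagonal. If g is congruent to
   an element of H modulo every Q, then the coordinates of g are successively
   matched by elements of H: the coordinate is additive on the subgroup where the
   previous ones vanish, so its values form a cyclic group, and a high power of a
   generating element is congruent to 1. Hence g lies in H, and a g outside H is
   separated from H by a congruence subgroup. For the diagonal exponents to be
   continuous one needs Chevalley's theorem: units congruent to 1 modulo a suitable
   Q are M-th powers. It rests on a local-global principle: a unit that is an M-th
   power modulo every Q is an M-th power if K contains the M-th roots of unity. *)

Require Import Defs.
From mathcomp Require Import all_boot all_order all_fingroup all_algebra all_solvable all_field.
From mathcomp Require Import boolp.
From mathcomp Require Import Rstruct complex.
From mathcomp Require Import mpoly.
From mathcomp Require Import zify ring lra.
From Stdlib Require Rpower.
Set Implicit Arguments. Unset Strict Implicit. Unset Printing Implicit Defensive.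
Import Order.TTheory GRing.Theory Num.Theory.
Local Open Scope ring_scope.

(** * Lattices with a multiplication *)

(** The local-global principle is usually drawn from Chebotarev's theorem or from the pole of a zeta
    function; here it comes from counting. If b had no l-th root y in k but were an l-th power
    modulo every Q, the order O_k[y] would have two independent homomorphisms to O_k / Q, up to a
    fixed factor beta. Through them any pair (z1, z2) of elements of O_k would divide a small
    element of O_k[y]. Such pairs outnumber the small elements by a factor that grows like the
    logarithm of their size, the factor that would give the zeta function a double pole. Moduli Q
    are integers, not primes, and O_k / Q is not a domain: an l-th root of unity in it need not be a
    power of zeta, and idempotents exist only up to a constant. Such constants are carried along, as
    beta in the counting and as N in [kummer_power]. A second obstacle is that the exponents of a
    unit in a generating family are not unique, so they are not functions of a matrix; the
    closedness argument therefore runs in a group of matrices with chosen exponents. *)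

Lemma absz_leD (a b : int) (B B' : nat) :
  (`|a| <= B)%N -> (`|b| <= B')%N -> (`|(a + b)%R| <= B + B')%N.
Proof. lia. Qed.

Lemma fin_choice (T : finType) (U : Type) (P : T -> U -> Prop) :
  (forall x, exists u, P x u) -> exists f : T -> U, forall x, P x (f x).
Proof. exact: fin_all_exists. Qed.

Section Order.
Variables (F : numFieldType) (d : nat) (e : 'I_d -> F).

Definition zspan (z : 'rV[int]_d) : F := \sum_i (z 0 i)%:~R * e i.
Definition in_span (x : F) : Prop := exists z, x = zspan z.
(** Sizes are measured by integral coordinates; embeddings and absolute values do not enter the
    counting. *)
Definition bounded (B : nat) (x : F) : Prop :=
  exists2 z, x = zspan z & forall i, (`|z 0%R i| <= B)%N.
Definition box B (f : {ffun 'I_d -> 'I_B}) : F := zspan (\row_i (f i : nat)%:Z).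

Lemma zspanD u v : zspan (u + v) = zspan u + zspan v.
Proof. by rewrite -big_split; apply: eq_bigr => i _; rewrite mxE rmorphD mulrDl. Qed.

Lemma zspanN u : zspan (- u) = - zspan u.
Proof. by rewrite -sumrN; apply: eq_bigr => i _; rewrite mxE rmorphN mulNr. Qed.

Lemma zspanZ (a : int) u : zspan (a *: u) = a%:~R * zspan u.
Proof. by rewrite mulr_sumr; apply: eq_bigr => i _; rewrite mxE rmorphM mulrA. Qed.

Lemma zspan0 : zspan 0 = 0.
Proof. by apply: big1 => i _; rewrite mxE mul0r. Qed.

Lemma bounded_in_span B x : bounded B x -> in_span x.
Proof. by case=> z -> _; exists z. Qed.

Lemma in_span_bounded x : in_span x -> exists B, bounded B x.
Proof.
case=> z ->; exists (\max_i `|z 0%R i|)%N; exists z => // i.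
exact: (leq_bigmax i).
Qed.

Lemma bounded_le B B' x : (B <= B')%N -> bounded B x -> bounded B' x.
Proof. by move=> le [z -> zB]; exists z => // i; apply: leq_trans (zB i) le. Qed.

Lemma boundedD B B' x y : bounded B x -> bounded B' y -> bounded (B + B')%N (x + y).
Proof.
move=> [u -> uB] [v -> vB]; exists (u + v); first by rewrite zspanD.
by move=> i; rewrite mxE; apply: absz_leD.
Qed.

Lemma boundedN B x : bounded B x -> bounded B (- x).
Proof.
move=> [u -> uB]; exists (- u); first by rewrite zspanN.
by move=> i; rewrite mxE abszN.
Qed.

Lemma boundedB B B' x y : bounded B x -> bounded B' y -> bounded (B + B')%N (x - y).
Proof. by move=> hx /boundedN; apply: boundedD. Qed.

Lemma boundedZ B (k : nat) x : bounded B x -> bounded (k * B)%N (k%:R * x).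
Proof.
move=> [u -> uB]; exists (k%:Z *: u); first by rewrite zspanZ.
by move=> i; rewrite mxE abszM leq_mul.
Qed.

Lemma bounded0 B : bounded B 0.
Proof. by exists 0; rewrite ?zspan0 // => i; rewrite mxE. Qed.

Lemma bounded_0 x : bounded 0 x -> x = 0.
Proof.
case=> z -> z0; rewrite (_ : z = 0) ?zspan0 //.
by apply/rowP => i; rewrite mxE; apply/eqP; rewrite -absz_eq0 -leqn0.
Qed.

Lemma in_spanD x y : in_span x -> in_span y -> in_span (x + y).
Proof. by move=> [u ->] [v ->]; exists (u + v); rewrite zspanD. Qed.

Lemma in_spanN x : in_span x -> in_span (- x).
Proof. by move=> [u ->]; exists (- u); rewrite zspanN. Qed.

Lemma in_spanB x y : in_span x -> in_span y -> in_span (x - y).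
Proof. by move=> hx /in_spanN; apply: in_spanD. Qed.

Lemma in_span0 : in_span 0. Proof. by exists 0; rewrite zspan0. Qed.

Lemma in_spanZ (a : int) x : in_span x -> in_span (a%:~R * x).
Proof. by move=> [u ->]; exists (a *: u); rewrite zspanZ. Qed.

Lemma in_span_sum (I : Type) (r : seq I) (P : pred I) (h : I -> F) :
  (forall i, P i -> in_span (h i)) -> in_span (\sum_(i <- r | P i) h i).
Proof. by move=> hh; apply: big_ind => //; [exact: in_span0 | exact: in_spanD]. Qed.

Lemma in_span_e i : in_span (e i).
Proof.
exists (delta_mx 0 i); rewrite /zspan (bigD1 i) //= mxE !eqxx mul1r big1 ?addr0 //.
by move=> j /negPf ji; rewrite mxE ji andbF mul0r.
Qed.

Hypothesis free : forall z, zspan z = 0 -> z = 0.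

Lemma zspan_inj : injective zspan.
Proof.
move=> u v uv; apply/eqP; rewrite -subr_eq0; apply/eqP/free.
by rewrite zspanD zspanN uv subrr.
Qed.

Lemma bounded_scale B (N : nat) x :
  (0 < N)%N -> in_span x -> bounded (B * N) (N%:R * x) -> bounded B x.
Proof.
move=> N0 [z ->] [u eu uB]; exists z => // i.
have {eu} zu : N%:Z *: z = u by apply: zspan_inj; rewrite zspanZ -eu.
by move: (uB i); rewrite -zu mxE abszM absz_nat mulnC leq_pmul2r.
Qed.

Lemma box_in B (f : {ffun 'I_d -> 'I_B}) : in_span (box f).
Proof. by eexists. Qed.

Lemma box_bounded B (f : {ffun 'I_d -> 'I_B}) : bounded B (box f).
Proof. by eexists => // i; rewrite mxE absz_nat ltnW. Qed.

Lemma boxB_bounded B (f g : {ffun 'I_d -> 'I_B}) : bounded B (box f - box g).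
Proof.
eexists; first by rewrite -zspanN -zspanD.
move=> i; rewrite !mxE; case: (f i) (g i) => a /= aB [b /= bB].
suff: (`|(a%:Z - b%:Z)%R| <= B)%N by []. lia.
Qed.

Lemma box_inj B : injective (@box B).
Proof.
move=> f g /zspan_inj /rowP fg; apply/ffunP => i; apply: val_inj => /=.
by have := fg i; rewrite !mxE; case.
Qed.

Lemma bounded_code (T : finType) (A : pred T) (h : T -> F) B :
  (forall t, A t -> bounded B (h t)) ->
  exists r : T -> {ffun 'I_d -> 'I_(2 * B).+1},
    forall t1 t2, A t1 -> A t2 -> r t1 = r t2 -> h t1 = h t2.
Proof.
move=> hB.
have hB' t : exists f : {ffun 'I_d -> 'I_(2 * B).+1},
    A t -> h t = box f - zspan (const_mx B%:Z).
  case At: (A t); last by exists [ffun=> ord0].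
  have [z hz zB] := hB t At.
  (* The shift by B turns the coordinates into natural numbers at most 2 * B. *)
  exists [ffun i => inord `|(z 0 i + B%:Z)%R|%N] => _.
  rewrite hz -zspanN -zspanD; congr zspan; apply/rowP => i.
  rewrite !mxE ffunE; move: (zB i); set a : int := z 0 i => aB.
by rewrite inordK; [suff: a = `|(a + B%:Z)%R|%N%:Z - B%:Z by [] |]; lia.
have [r rP] := fin_choice hB'.
by exists r => t1 t2 A1 A2 r12; rewrite !rP // r12.
Qed.

Lemma card_box B : #|{ffun 'I_d -> 'I_B}| = (B ^ d)%N.
Proof. by rewrite card_ffun !card_ord. Qed.

Hypothesis one_in : in_span 1.
Hypothesis e_mul : forall i j, in_span (e i * e j).

Lemma in_spanM x y : in_span x -> in_span y -> in_span (x * y).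
Proof.
move=> [u ->] [v ->]; rewrite /zspan mulr_suml.
apply: in_span_sum => i _; rewrite mulr_sumr; apply: in_span_sum => j _.
by rewrite mulrACA -rmorphM; apply: in_spanZ.
Qed.

Lemma in_span_int (a : int) : in_span a%:~R.
Proof. by rewrite -[_%:~R]mulr1; apply: in_spanZ. Qed.

Lemma in_span_nat (n : nat) : in_span n%:R.
Proof. exact: (in_span_int n). Qed.

Lemma boundedM : exists2 c, (0 < c)%N & forall B B' x y,
  bounded B x -> bounded B' y -> bounded (c * B * B') (x * y).
Proof.
have [m mP] : exists m : 'I_d -> 'I_d -> nat, forall i j, bounded (m i j) (e i * e j).
  have h i : exists f : 'I_d -> nat, forall j, bounded (f j) (e i * e j).
    by apply: (fin_choice (fun j => in_span_bounded (e_mul i j))).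
  exact: (fin_choice h).
exists (\sum_i \sum_j m i j).+1%N => // B B' x y [u -> uB] [v -> vB].
apply: (@bounded_le (\sum_i \sum_j m i j * (B * B'))).
  by under eq_bigr do rewrite -big_distrl /=; rewrite -big_distrl /= -mulnA leq_mul.
have bs (I : finType) (h : I -> F) (b : I -> nat) :
    (forall i, bounded (b i) (h i)) -> bounded (\sum_i b i) (\sum_i h i).
  move=> hb; elim/big_ind2: _ => //; first exact: bounded0.
  by move=> *; apply: boundedD.
rewrite /zspan mulr_suml; apply: (bs) => i; rewrite mulr_sumr; apply: (bs) => j.
rewrite mulrACA -rmorphM; have [w -> wB] := mP i j.
exists ((u 0 i * v 0 j) *: w); first by rewrite zspanZ.
by move=> k; rewrite mxE !abszM mulnC leq_mul // leq_mul.
Qed.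

(** The multiple is the norm up to sign: the coordinates of 1 times the adjugate of the matrix of
    multiplication by x represent the determinant divided by x. *)
Lemma dvd_nat x : in_span x -> x != 0 ->
  exists2 N : nat, (0 < N)%N & exists2 x', in_span x' & x * x' = N%:R.
Proof.
move=> hx x0.
have [M MP] : exists M : 'I_d -> 'rV[int]_d, forall i, e i * x = zspan (M i).
  exact: (fin_choice (fun i => in_spanM (in_span_e i) hx)).
pose A : 'M[int]_d := \matrix_i M i.
have AP (w : 'rV_d) : zspan (w *m A) = zspan w * x.
  rewrite /zspan mulr_suml; under eq_bigr do rewrite mxE rmorph_sum mulr_suml.
  rewrite exchange_big; apply: eq_bigr => i _ /=.
  rewrite -mulrA MP mulr_sumr; apply: eq_bigr => j _.
  by rewrite !mxE rmorphM mulrA.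
have detA0 : \det A != 0.
  apply/det0P => -[w w0 wA].
  have /eqP := AP w; rewrite wA zspan0 eq_sym mulf_eq0 (negPf x0) orbF => /eqP/free w00.
  by rewrite w00 eqxx in w0.
have [w1 w1P] := one_in.
have key : x * zspan (w1 *m \adj A) = (\det A)%:~R.
  by rewrite mulrC -AP -mulmxA mul_adj_mx mul_mx_scalar zspanZ -w1P mulr1.
exists `|\det A|%N; first by rewrite absz_gt0.
exists ((sgz (\det A))%:~R * zspan (w1 *m \adj A)); first by apply: in_spanZ; eexists.
by rewrite mulrCA key -rmorphM /= -abszEsg.
Qed.

Lemma common_multiple (T : finType) (h : T -> F) :
  (forall t, in_span (h t)) -> (forall t, h t != 0) ->
  exists2 N : nat, (0 < N)%N & forall t, exists2 u, in_span u & N%:R = h t * u.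
Proof.
move=> hT h0.
have NH t : exists N : nat, (0 < N)%N /\ exists2 u, in_span u & N%:R = h t * u.
  by have [N N0 [u hu hN]] := dvd_nat (hT t) (h0 t); exists N; split => //; exists u.
have {NH} [N NP] := fin_choice NH.
exists (\prod_t N t)%N; first by rewrite prodn_gt0 // => t; case: (NP t).
move=> t; have [_ [u hu Nu]] := NP t.
exists ((\prod_(s | s != t) N s)%N%:R * u); first exact: in_spanM (in_span_nat _) _.
by rewrite (bigD1 t) //= natrM Nu -!mulrA; congr (_ * _); rewrite mulrC.
Qed.

(* Round the quotient a / x coordinatewise. *)
Lemma residue : exists2 c, (0 < c)%N & forall B x a, bounded B x -> x != 0 ->
  in_span a -> exists2 u, in_span u & bounded (c * B) (a - x * u).
Proof.
have [c c0 cP] := boundedM; exists c => // B x a Bx x0 ha.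
have hx := bounded_in_span Bx.
have [N N0 [x' hx' xx']] := dvd_nat hx x0.
have [v vP] := in_spanM ha hx'.
(* Since x' = N / x, the coordinates v of a * x' are N times those of a / x. With q their integral
   part, N * (a - x * q) equals x * r, where r has coordinates below N. *)
pose q : 'rV[int]_d := \row_i (v 0%R i %/ N%:Z)%Z.
pose r : 'rV[int]_d := \row_i (v 0%R i %% N%:Z)%Z.
have vE : v = N%:Z *: q + r.
  by apply/rowP => i; rewrite !mxE {1}(divz_eq (v 0 i) N%:Z) mulrC.
have hq : in_span (zspan q) by exists q.
exists (zspan q) => //; apply: (@bounded_scale _ N) => //.
  by apply: in_spanB => //; apply: in_spanM.
have -> : N%:R * (a - x * zspan q) = x * zspan r.
  have : a * x' = N%:R * zspan q + zspan r by rewrite vP vE zspanD zspanZ.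
  move/(congr1 (fun s => x * s)); rewrite mulrCA xx' mulrDr mulrBr (mulrC a) => ->.
  by rewrite addrC mulrCA addKr.
apply: cP => //; exists r => // i; rewrite mxE.
have N0' : N%:Z != 0 by lia.
by have := modz_ge0 (v 0 i) N0'; have := ltz_mod (v 0 i) N0'; set a1 := modz _ _; lia.
Qed.

Definition cong (x a b : F) : Prop := exists2 u, in_span u & a - b = x * u.

Lemma residue_code : exists2 c, (0 < c)%N &
  forall (T : finType) (h : T -> F) B x, bounded B x -> x != 0 ->
    (forall t, in_span (h t)) ->
  exists r : T -> {ffun 'I_d -> 'I_(2 * (c * B)).+1},
    forall t1 t2, r t1 = r t2 -> cong x (h t1) (h t2).
Proof.
have [c c0 cP] := residue; exists c => // T h B x Bx x0 hh.
have uH t : exists u, in_span u /\ bounded (c * B) (h t - x * u).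
  by have [u] := cP _ _ _ Bx x0 (hh t); exists u.
have {uH} [u uP] := fin_choice uH.
have [r rP] := @bounded_code _ xpredT (fun t => h t - x * u t) (c * B)%N
  (fun t _ => (uP t).2).
exists r => t1 t2 /(rP t1 t2 isT isT) r12.
exists (u t1 - u t2); first exact: in_spanB (uP t1).1 (uP t2).1.
have {r12} -> : h t1 = h t2 - x * u t2 + x * u t1 by rewrite -r12 subrK.
by rewrite mulrBr; ring.
Qed.

(** Multiplication by w enlarges sizes at most by the factor c * B, which is at most Y / 2. Hence
    multiplication by Y + w still enlarges them at least by Y / 2. *)
Lemma bounded_quotient : exists2 c, (0 < c)%N & forall Y B A w u,
  (2 * c * B <= Y)%N -> (0 < Y)%N -> bounded B w -> in_span u ->
  bounded A ((Y%:R + w) * u) -> bounded ((2 * A) %/ Y) u.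
Proof.
have [c c0 cP] := boundedM; exists c => // Y B A w u le Y0 Bw [v uv] Azu.
pose U := (\max_i `|v 0%R i|)%N.
have Uv i : (`|v 0%R i| <= U)%N by exact: (leq_bigmax i).
have Bu : bounded U u by exists v.
have [t tP tB] := boundedB Azu (cP _ _ _ _ Bw Bu).
have tv : Y%:Z *: v = t.
  by apply: zspan_inj; rewrite zspanZ -tP -uv mulrDl addrK.
have YU : (Y * U <= A + c * B * U)%N.
  have [[i iU] | U0] : (exists i, U = `|v 0%R i|%N) \/ U = 0%N.
    case: (d =P 0%N) v @U {Uv Bu uv tv t tP tB} => [->|/eqP d0] v U.
      by right; rewrite /U big_ord0.
    have := @bigop.eq_bigmax _ (fun i => `|v 0%R i|%N).
    rewrite card_ord lt0n => /(_ d0) [i iP]; left; exists i; exact: iP.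
  rewrite iU; have := tB i; rewrite -tv mxE abszM absz_nat -iU; lia.
  by rewrite U0 muln0 leq0n.
exists v => // i; rewrite leq_divRL //; apply: leq_trans (_ : Y * U <= _)%N.
  by rewrite mulnC leq_mul2l Uv orbT.
by move: YU (leq_mul le (leqnn U)); lia.
Qed.

End Order.

Lemma pigeonhole (T T' : finType) (f : T -> T') :
  (#|T'| < #|T|)%N -> exists t1 t2, t1 != t2 /\ f t1 = f t2.
Proof.
move=> lt; have /injectivePn[t1 [t2 ne ft]] : ~~ injectiveb f.
  by apply/negP => /injectiveP /leq_card; rewrite leqNgt lt.
by exists t1, t2.
Qed.

Section Congruence.
Variables (F : numFieldType) (d : nat) (e : 'I_d -> F).
Hypothesis one_in : in_span e 1.
Hypothesis e_mul : forall i j, in_span e (e i * e j).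
Notation R := (in_span e).
Notation cong := (cong e).

Lemma cong_refl x a : cong x a a.
Proof. by exists 0; rewrite ?subrr ?mulr0 //; apply: in_span0. Qed.

Lemma cong_sym x a b : cong x a b -> cong x b a.
Proof. by case=> u hu h; exists (- u); [apply: in_spanN | rewrite mulrN -h opprB]. Qed.

Lemma cong_trans x b a c : cong x a b -> cong x b c -> cong x a c.
Proof.
move=> [u hu ab] [v hv bc]; exists (u + v); first exact: in_spanD.
by rewrite mulrDr -ab -bc addrA subrK.
Qed.

Lemma congD x a b a' b' : cong x a b -> cong x a' b' -> cong x (a + a') (b + b').
Proof.
move=> [u hu ab] [v hv bc]; exists (u + v); first exact: in_spanD.
by rewrite mulrDr -ab -bc; ring.
Qed.

Lemma congMl x r a b : R r -> cong x a b -> cong x (r * a) (r * b).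
Proof.
move=> hr [u hu ab]; exists (r * u); first exact: in_spanM.
by rewrite mulrCA -ab mulrBr.
Qed.

Lemma cong_mul2I z x a b : z != 0 -> cong (z * x) (z * a) (z * b) -> cong x a b.
Proof.
move=> z0 [u hu ab]; exists u => //; apply: (mulfI z0).
by rewrite mulrBr ab mulrA.
Qed.

Lemma cong_dvd x y a b : (exists2 u, R u & y = x * u) -> cong y a b -> cong x a b.
Proof.
move=> [u hu ->] [v hv ab]; exists (u * v); first exact: in_spanM.
by rewrite ab mulrA.
Qed.

Lemma cong0_dvd x a : cong x a 0 -> exists2 u, R u & a = x * u.
Proof. by case=> u hu; rewrite subr0; exists u. Qed.

Lemma cong0M x r a : R r -> cong x a 0 -> cong x (r * a) 0.
Proof. by move=> hr /(congMl hr); rewrite mulr0. Qed.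

End Congruence.

(** * Homomorphisms from L to R modulo Q, and small elements of L *)

Section Evaluations.
Variables (F : numFieldType) (d D : nat) (e : 'I_d -> F) (E : 'I_D -> F).
Hypothesis freeR : forall z, zspan e z = 0 -> z = 0.
Hypothesis oneR : in_span e 1.
Hypothesis mulR : forall i j, in_span e (e i * e j).
Hypothesis freeL : forall z, zspan E z = 0 -> z = 0.
Hypothesis oneL : in_span E 1.
Hypothesis mulL : forall i j, in_span E (E i * E j).
Notation R := (in_span e).
Notation L := (in_span E).
Notation cong := (cong e).
Hypothesis RL : forall x, R x -> L x.

(** [f] lifts a homomorphism of R-algebras from L to R / Q; a function with laws modulo Q replaces
    the quotient ring. *)
Definition evaluation (Q : F) (f : F -> F) : Prop :=
  [/\ forall a, L a -> R (f a),
      forall a a', L a -> L a' -> cong Q (f (a + a')) (f a + f a'),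
      forall a a', L a -> L a' -> cong Q (f (a * a')) (f a * f a') &
      forall r, R r -> cong Q (f r) r].

Lemma evaluation_dvd z Q f :
  (exists2 u, R u & Q = z * u) -> evaluation Q f -> evaluation z f.
Proof.
move=> zQ [hR hD hM hr]; split => // *.
- by apply: (cong_dvd mulR zQ); apply: hD.
- by apply: (cong_dvd mulR zQ); apply: hM.
- by apply: (cong_dvd mulR zQ); apply: hr.
Qed.

Lemma evaluation_combination z f r a r' g : evaluation z f ->
  R r -> R r' -> L a -> L g ->
  cong z (f (r * a + r' * g)) (r * f a + r' * f g).
Proof.
move=> [hR hD hM hr] rR r'R aL gL.
have h s b : R s -> L b -> cong z (f (s * b)) (s * f b).
  move=> sR bL; apply: cong_trans (hM _ _ (RL sR) bL) _.
  by rewrite ![_ * f b]mulrC; apply: (congMl mulR) (hR _ bL) (hr _ sR).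
apply: cong_trans (congD (h _ _ rR aL) (h _ _ r'R gL)).
by apply: hD; apply: in_spanM => //; apply: RL.
Qed.

Lemma evaluation_eq z f x u a b : evaluation z f -> cong z (f x) 0 ->
  L x -> L u -> L b -> a = b + x * u -> cong z (f a) (f b).
Proof.
move=> [hR hD hM hr] fx xL uL bL ->.
apply: cong_trans (hD _ _ _ _) _ => //; first exact: in_spanM.
rewrite -[X in cong z _ X]addr0; apply: congD; first exact: cong_refl.
apply: cong_trans (hM _ _ _ _) _ => //; rewrite mulrC.
by apply: (cong0M mulR) => //; apply: hR.
Qed.

(** Pigeonhole: the residues of f1 modulo z1 and of f2 modulo z2 take fewer values than the box has
    elements, so two elements agree in both, and x is their difference. *)
Lemma siegel : exists2 c, (0 < c)%N & forall f1 f2 z1 z2 B1 B2 B,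
  evaluation z1 f1 -> evaluation z2 f2 ->
  bounded e B1 z1 -> bounded e B2 z2 -> z1 != 0 -> z2 != 0 ->
  ((2 * (c * B1)).+1 ^ d * (2 * (c * B2)).+1 ^ d < B ^ D)%N ->
  exists x, [/\ bounded E B x, x != 0, cong z1 (f1 x) 0 & cong z2 (f2 x) 0].
Proof.
have [c c0 cP] := residue_code freeR oneR mulR.
exists c => // f1 f2 z1 z2 B1 B2 B ev1 ev2 Bz1 Bz2 z10 z20 lt.
have bL (t : {ffun 'I_D -> 'I_B}) : L (box E t) by exact: box_in.
have [r1 r1P] := cP _ (fun t : {ffun 'I_D -> 'I_B} => f1 (box E t)) _ _ Bz1 z10
  (fun t => let: And4 h _ _ _ := ev1 in h _ (bL t)).
have [r2 r2P] := cP _ (fun t : {ffun 'I_D -> 'I_B} => f2 (box E t)) _ _ Bz2 z20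
  (fun t => let: And4 h _ _ _ := ev2 in h _ (bL t)).
have [|t1 [t2 [ne [e1 e2]]]] := @pigeonhole _ _ (fun t => (r1 t, r2 t)).
  by rewrite card_prod !card_box.
have dif f z : evaluation z f -> cong z (f (box E t1)) (f (box E t2)) ->
    cong z (f (box E t1 - box E t2)) 0.
  move=> [hR hD _ _] h; have := hD (box E t1 - box E t2) (box E t2).
  rewrite subrK => /(_ (in_spanB (bL _) (bL _)) (bL _)) h'.
  have := congD (cong_trans (cong_sym h') h) (cong_refl e z (- f (box E t2))).
  by rewrite addrK subrr.
exists (box E t1 - box E t2); split; first exact: boxB_bounded.
- by rewrite subr_eq0; apply: contra ne => /eqP /(box_inj freeL) ->.
- exact: dif (r1P _ _ e1).
- exact: dif (r2P _ _ e2).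
Qed.

(* Pigeonhole on the classes modulo x of the elements alpha + gamma * g + j * a,
   with alpha and gamma in boxes. *)
Lemma torsion : exists2 c, (0 < c)%N &
  forall f1 f2 z1 z2 beta g b1 b2 B x a m,
  evaluation z1 f1 -> evaluation (beta * z2) f2 -> beta != 0 ->
  L g -> cong z1 (f1 g) 0 -> cong (beta * z2) (f2 g) beta ->
  (forall u v : {ffun 'I_d -> 'I_b1}, cong z1 (box e u) (box e v) -> u = v) ->
  (forall u v : {ffun 'I_d -> 'I_b2}, cong z2 (box e u) (box e v) -> u = v) ->
  bounded E B x -> x != 0 -> cong z1 (f1 x) 0 -> cong (beta * z2) (f2 x) 0 ->
  L a -> cong z1 (f1 a) 0 -> cong (beta * z2) (f2 a) 0 ->
  ((2 * (c * B)).+1 ^ D < m.+1 * (b1 ^ d * b2 ^ d))%N ->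
  exists2 j, (0 < j <= m)%N & exists2 u, L u & j%:R * a = x * u.
Proof.
have [c c0 cP] := residue_code freeL oneL mulL.
exists c => // f1 f2 z1 z2 beta g b1 b2 B x a m ev1 ev2 be0 gL g1 g2 inj1 inj2
  Bx x0 x1 x2 aL a1 a2 lt.
have xL := bounded_in_span Bx.
pose T := ('I_m.+1 * ({ffun 'I_d -> 'I_b1} * {ffun 'I_d -> 'I_b2}))%type.
pose k (t : T) := box e t.2.1 * 1 + box e t.2.2 * g.
pose h (t : T) := (t.1 : nat)%:R * a + k t.
have kL t : L (k t).
  by apply: in_spanD; apply: in_spanM => //; apply: RL; apply: box_in.
have hL t : L (h t).
  by apply: in_spanD => //; apply: in_spanM => //; apply: in_span_nat.
have [r rP] := cP _ h _ _ Bx x0 hL.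
have [|t1 [t2 [ne e12]]] := @pigeonhole _ _ r.
  by rewrite card_box !card_prod !card_ord !card_box.
have {e12} [u uL hu] := rP _ _ e12.
(* f1 reads off alpha modulo z1, because a and g map to 0; then f2 reads off gamma, because g maps
   to beta. So a congruence modulo x determines alpha and gamma, and colliding elements differ only
   in j. *)
have k1 t : cong z1 (f1 (h t)) (box e t.2.1).
  have [_ hD hM hr] := ev1.
  rewrite /h -[k t]mul1r.
  apply: cong_trans (evaluation_combination ev1 (in_span_nat oneR _) oneR aL (kL t)) _.
  rewrite mul1r -[X in cong _ _ X]add0r; apply: congD.
    exact: (cong0M mulR) (in_span_nat oneR _) a1.
  apply: cong_trans (evaluation_combination ev1 (box_in _ _) (box_in _ _) oneL gL) _.
  rewrite -[X in cong _ _ X]addr0; apply: congD.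
    by rewrite -[X in cong _ _ X]mulr1; apply: (congMl mulR) (box_in _ _) (hr _ oneR).
  exact: (cong0M mulR) (box_in _ _) g1.
have k2 t : cong (beta * z2) (f2 (h t)) (box e t.2.1 + box e t.2.2 * beta).
  have [_ hD hM hr] := ev2.
  rewrite /h -[k t]mul1r.
  apply: cong_trans (evaluation_combination ev2 (in_span_nat oneR _) oneR aL (kL t)) _.
  rewrite mul1r -[X in cong _ _ X]add0r; apply: congD.
    exact: (cong0M mulR) (in_span_nat oneR _) a2.
  apply: cong_trans (evaluation_combination ev2 (box_in _ _) (box_in _ _) oneL gL) _.
  apply: congD.
    by rewrite -[X in cong _ _ X]mulr1; apply: (congMl mulR) (box_in _ _) (hr _ oneR).
  exact: (congMl mulR) (box_in _ _) g2.
have hu' : h t1 = h t2 + x * u by rewrite -hu addrC subrK.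
have e1 : t1.2.1 = t2.2.1.
  apply: inj1; apply: cong_trans (cong_sym (k1 t1)) (cong_trans _ (k1 t2)).
  exact: evaluation_eq ev1 x1 xL uL (hL _) hu'.
have e2 : t1.2.2 = t2.2.2.
  apply: inj2; apply: (cong_mul2I be0); rewrite ![beta * _]mulrC [z2 * _]mulrC.
  have := cong_trans (cong_sym (k2 t1))
    (cong_trans (evaluation_eq ev2 x2 xL uL (hL _) hu') (k2 t2)).
  move/congD => /(_ _ _ (cong_refl _ _ (- box e t1.2.1))).
  by rewrite -e1 ![box e t1.2.1 + _]addrC !addrK.
have ne1 : t1.1 != t2.1.
  apply: contra ne => /eqP e0; apply/eqP.
  by move: e0 e1 e2; clear; case: t1 t2 => [? [? ?]] [? [? ?]] /= -> -> ->.
have hj : ((t1.1 : nat)%:R - (t2.1 : nat)%:R) * a = x * u.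
  by rewrite -hu /h /k e1 e2; ring.
case: (ltngtP t1.1 t2.1) => [lt12|lt21|/val_inj/eqP]; last by rewrite (negPf ne1).
- exists (t2.1 - t1.1)%N.
    by rewrite subn_gt0 lt12 (leq_trans (leq_subr _ _)) // -ltnS.
  exists (- u); first exact: in_spanN.
  by rewrite natrB ?(ltnW lt12) // mulrN -hj -mulNr opprB.
- exists (t1.1 - t2.1)%N.
    by rewrite subn_gt0 lt21 (leq_trans (leq_subr _ _)) // -ltnS.
  by exists u => //; rewrite natrB ?(ltnW lt21).
Qed.

End Evaluations.

Lemma leq_affine_pow (k i D : nat) : ((2 * (k * 2 ^ i)).+1 ^ D <= (2 * k).+1 ^ D * 2 ^ (i * D))%N.
Proof.
rewrite expnM -expnMn; case: D => // D; rewrite leq_exp2r //.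
by have := expn_gt0 2 i; rewrite mulSn mulnA; lia.
Qed.

Section Core.
Variables (F : numFieldType) (d D l : nat) (e : 'I_d -> F) (E : 'I_D -> F).
Hypothesis freeR : forall z, zspan e z = 0 -> z = 0.
Hypothesis oneR : in_span e 1.
Hypothesis mulR : forall i j, in_span e (e i * e j).
Hypothesis freeL : forall z, zspan E z = 0 -> z = 0.
Hypothesis oneL : in_span E 1.
Hypothesis mulL : forall i j, in_span E (E i * E j).
Notation R := (in_span e).
Notation L := (in_span E).
Notation cong := (cong e).
Hypothesis RL : forall x, R x -> L x.
Hypothesis Dl : D = (d * l)%N.
Hypothesis l2 : (0 < l)%N.
Variable beta : F.
Hypothesis betaR : R beta.
Hypothesis beta0 : beta != 0.

(** Up to the factor beta, g1 and g2 are the idempotents of a splitting of L modulo Q. Exact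
    idempotents cannot be expected, since f1 and f2 may agree modulo a divisor of beta. *)
Definition orthogonal_evaluations (Q : F) (f1 f2 : F -> F) (g1 g2 : F) : Prop :=
  [/\ evaluation e E Q f1, evaluation e E Q f2, L g1 & L g2] /\
  [/\ cong Q (f1 g1) beta, cong Q (f2 g1) 0, cong Q (f1 g2) 0 & cong Q (f2 g2) beta].

Lemma dim_gt0 : (0 < d)%N.
Proof.
case: (posnP d) => // d0; case: oneR => z; rewrite /zspan big1 => [/eqP|i _].
  by rewrite oner_eq0.
by exfalso; have := ltn_ord i; rewrite ltnNge [X in (X <= _)%N]d0.
Qed.

(** These are the 2 ^ (i * d) elements of a box at the integer P * 2 ^ i. For large P,
    multiplication by any of them behaves like multiplication by that integer. *)
Definition near (P i : nat) (w : {ffun 'I_d -> 'I_(2 ^ i)}) : F :=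
  (P * 2 ^ i)%N%:R + box e w.

Lemma near_in P i w : R (@near P i w).
Proof. by apply: in_spanD; [apply: in_span_nat | apply: box_in]. Qed.

Lemma near_facts : exists2 P, (0 < P)%N & [/\
  exists c, forall i w, bounded e (c * 2 ^ i) (@near P i w),
  forall i w A u, R u -> bounded e A (@near P i w * u) ->
    bounded e ((2 * A) %/ (P * 2 ^ i)) u,
  forall i w, @near P i w != 0,
  forall i w (u v : {ffun 'I_d -> 'I_(2 ^ i)}),
    cong (@near P i w) (box e u) (box e v) -> u = v &
  forall i w i' w', @near P i w = @near P i' w' -> (i <= i')%N].
Proof.
have [c c0 cP] := bounded_quotient freeR mulR.
have [o oP] := in_span_bounded oneR.
(* The term 2 * c is what [bounded_quotient] asks for a box of side 2 ^ i. The surplus 9 separates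
   boxes of different i: their base points differ by more than 4 times the larger side. *)
pose P := (2 * c + 9)%N.
have p2 i : (0 < 2 ^ i)%N by rewrite expn_gt0.
have PY i : (0 < P * 2 ^ i)%N by rewrite muln_gt0 p2 andbT /P; lia.
have quo i w A u : R u -> bounded e A (@near P i w * u) ->
    bounded e ((2 * A) %/ (P * 2 ^ i)) u.
  move=> uR; apply: (cP _ _ _ _ _ _ (PY i) (box_bounded _ _) uR).
  by rewrite leq_mul2r /P; apply/orP; right; lia.
exists P; first by rewrite /P; lia.
split => //.
- exists (P * o + 1)%N => i w.
  rewrite mulnDl mul1n; apply: boundedD; last exact: box_bounded.
  by rewrite mulnAC -[_%:R]mulr1; apply: boundedZ.
- move=> i w; apply/negP => /eqP w0; have := quo i w 0%N 1 oneR.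
  rewrite w0 mul0r muln0 div0n => /(_ (bounded0 _ _)) /bounded_0/eqP.
  by rewrite oner_eq0.
- move=> i w u v [t tR] uv; apply/(box_inj freeR)/eqP; rewrite -subr_eq0 uv.
  have := boxB_bounded e u v; rewrite uv => /(quo _ _ _ _ tR).
  rewrite divn_small ?ltn_pmul2r // => [/bounded_0 -> |]; first by rewrite mulr0.
  by rewrite /P; lia.
- move=> i w i' w' ww; rewrite leqNgt; apply/negP => lt.
  pose N := (P * 2 ^ i - P * 2 ^ i')%N.
  have le2 : (2 * 2 ^ i' <= 2 ^ i)%N by rewrite -expnS leq_exp2l.
  have N8 : (4 * 2 ^ i < N)%N.
    rewrite /N -mulnBr; apply: (@leq_trans (9 * (2 ^ i - 2 ^ i')))%N.
      by have := p2 i; lia.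
    by rewrite leq_mul2r /P; apply/orP; right; lia.
  have N0 : (0 < N)%N by lia.
  have NE : (N%:R + 0) * 1 = box e w' - box e w :> F.
    rewrite addr0 mulr1 /N natrB ?leq_mul2l; last by apply/orP; right; lia.
    by move: ww; rewrite /near => ww; rewrite -[box e w'](addKr (P * 2 ^ i')%N%:R) -ww; ring.
  have Bd : bounded e (2 ^ i' + 2 ^ i) (box e w' - box e w).
    by apply: boundedB; apply: box_bounded.
  rewrite -NE in Bd; have := cP N 0%N _ 0 1 _ N0 (bounded0 e 0) oneR Bd.
  rewrite muln0 leq0n => /(_ isT); rewrite divn_small; last by lia.
  by move=> /bounded_0/eqP; rewrite oner_eq0.
Qed.

(* There are (S + 1) 2 ^ (S d) pairs (z1, z2) of elements close to 2 ^ i and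
   2 ^ (S - i). By Siegel's lemma each of them yields a nonzero x in L of size
   about 2 ^ (S / l) with z1 | f1 x and beta z2 | f2 x. There are about 2 ^ (S d)
   such x, and torsion bounds the number of pairs sharing the same x. *)
Theorem no_orthogonal_evaluations :
  ~ (forall Q : nat, (0 < Q)%N ->
      exists f1 f2 g1 g2, orthogonal_evaluations Q%:R f1 f2 g1 g2).
Proof.
move=> evQ.
have [c1 c10 bM] := boundedM mulR.
have [c2 c20 siegelP] := siegel freeR oneR mulR freeL.
have [c3 c30 torsionP] := torsion oneR mulR freeL oneL mulL RL.
have [P P0 [[c5 c5P] quo near0 inc nearI]] := near_facts.
have [bb bbP] := in_span_bounded betaR.
have p2 i : (0 < 2 ^ i)%N by rewrite expn_gt0.
(* c6 * 2 ^ i bounds an element near P * 2 ^ i and also its product with beta; c7 makes the box for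
   x large enough for Siegel's lemma; m is the resulting bound in [torsion]. *)
pose c6 := (c1 * bb * c5 + c5)%N.
pose c8 := ((2 * (c2 * c6)).+1 ^ 2)%N.
pose c7 := c8.+1.
pose m := ((2 * (c3 * c7)).+1 ^ D)%N.
(* The factorial clears every multiplier j from [torsion], and beta comes from the approximate
   idempotents. *)
pose gamma : F := m`!%:R * beta.
have gammaR : R gamma by apply: in_spanM => //; apply: in_span_nat.
have gamma0 : gamma != 0 by rewrite mulf_neq0 // pnatr_eq0 -lt0n fact_gt0.
have [G GP] := in_span_bounded gammaR.
pose c9 := (2 * (c1 * G * c5))%N.
pose N := ((2 * c7).+1 ^ D * ((2 * (c9 * c9)).+1 ^ d * (2 * (c9 * c9)).+1 ^ d))%N.
(* The pairs will be coded by fewer than (S + 1) * 2 ^ (S * d) values as soon as S reaches N, since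
   N collects all factors other than 2 ^ (S * d). *)
pose S' := N; pose S := (l * S')%N; pose B := (c7 * 2 ^ S')%N.
pose T_ (i : 'I_S.+1) : finType :=
  ({ffun 'I_d -> 'I_(2 ^ i)} * {ffun 'I_d -> 'I_(2 ^ (S - i))})%type.
pose T : finType := {i : 'I_S.+1 & T_ i}.
have cardT : #|T| = (S.+1 * 2 ^ (S * d))%N.
  rewrite card_tagged (eq_map (g := fun _ => (2 ^ (S * d))%N)); last first.
    move=> i; rewrite card_prod !card_box -!expnM -expnD -mulnDl subnKC //.
    by rewrite -ltnS.
  by rewrite sumnE big_map big_const_seq count_predT iter_addn_0 -cardE card_ord mulnC.
pose z1 (t : T) := @near P (tag t) (tagged t).1.
pose z2 (t : T) := @near P (S - tag t) (tagged t).2.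
have z1R t : R (z1 t) by apply: near_in.
have z2R t : R (z2 t) by apply: near_in.
have z10 t : z1 t != 0 by apply: near0.
have z20 t : z2 t != 0 by apply: near0.
have bz2R t : R (beta * z2 t) by apply: in_spanM.
have bz20 t : beta * z2 t != 0 by rewrite mulf_neq0.
have [Q Q0 QP] : exists2 Q : nat, (0 < Q)%N &
    forall t, exists2 u, R u & Q%:R = z1 t * (beta * z2 t) * u.
  apply: (common_multiple freeR oneR mulR) => t; first exact: in_spanM.
  by rewrite mulf_neq0.
have Q1 t : exists2 u, R u & Q%:R = z1 t * u.
  by have [u uR ->] := QP t; exists (beta * z2 t * u); [exact: in_spanM | rewrite !mulrA].
have Q2 t : exists2 u, R u & Q%:R = beta * z2 t * u.
  have [u uR ->] := QP t; exists (z1 t * u); first exact: (in_spanM mulR).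
  by ring.
have [f1 [f2 [g1 [g2 [[ev1 ev2 g1L g2L] [f11 f21 f12 f22]]]]]] := evQ Q Q0.
have ev1z t : evaluation e E (z1 t) f1 by apply: evaluation_dvd ev1.
have ev2z t : evaluation e E (beta * z2 t) f2 by apply: evaluation_dvd ev2.
have xH t : exists x, [/\ bounded E B x, x != 0,
    cong (z1 t) (f1 x) 0 & cong (beta * z2 t) (f2 x) 0].
  apply: (siegelP f1 f2 _ _ (c6 * 2 ^ tag t)%N (c6 * 2 ^ (S - tag t))%N) => //.
  - by apply: bounded_le (c5P _ _); rewrite leq_mul2r /c6 leq_addl orbT.
  - apply: bounded_le (bM _ _ _ _ bbP (c5P _ _)).
    by rewrite mulnA leq_mul2r /c6 leq_addr orbT.
  rewrite !(mulnA c2).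
  apply: leq_ltn_trans (leq_mul (leq_affine_pow _ _ _) (leq_affine_pow _ _ _)) _.
  rewrite mulnACA -(expnD 2) -mulnDl subnKC; last by rewrite -ltnS.
  rewrite -expnMn mulnn -/c8 /B expnMn -expnM Dl /S [in X in (_ < X)%N](mulnC d) mulnA.
  rewrite (mulnC S') ltn_pmul2r ?expn_gt0 // (@leq_trans (c7 ^ d)) //.
    by rewrite ltn_exp2r ?dim_gt0.
  by rewrite leq_pexp2l // leq_pmull.
have {xH} [x xP] := fin_choice xH.
have tors t a : L a -> cong (z1 t) (f1 a) 0 -> cong (beta * z2 t) (f2 a) 0 ->
    exists2 j, (0 < j <= m)%N & exists2 u, L u & j%:R * a = x t * u.
  have [Bx x0 x1 x2] := xP t => aL a1 a2.
  apply: (torsionP f1 f2 (z1 t) (z2 t) beta g2 _ _ B _ _ _ _ _ _ _ _ _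
    (inc _ (tagged t).1) (inc _ (tagged t).2)) => //.
  - exact: (cong_dvd mulR (Q1 t) f12).
  - exact: (cong_dvd mulR (Q2 t) f22).
  rewrite -!expnM -expnD -mulnDl subnKC; last by rewrite -ltnS.
  rewrite /B (mulnA c3); apply: leq_ltn_trans (leq_affine_pow _ _ _) _.
  rewrite -/m mulSn Dl /S (mulnC d) mulnA (mulnC S').
  by rewrite -[X in (X < _)%N]add0n ltn_add2r expn_gt0.
have fact_dvd j z a : (0 < j <= m)%N -> R a -> cong z (j%:R * a) 0 -> cong z (m`!%:R * a) 0.
  move=> /dvdn_fact /dvdnP[k ->] aR h; rewrite natrM -mulrA.
  exact: (cong0M mulR) (in_span_nat oneR _) h.
have multiple z (f : F -> F) s a j v : evaluation e E z f -> L a -> L v ->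
    cong z (f (x s)) 0 -> (0 < j <= m)%N -> j%:R * a = x s * v -> R (f a) ->
    cong z (m`!%:R * f a) 0.
  move=> ev aL vL fx jm ja faR; apply: (fact_dvd _ _ _ jm faR).
  have [hR hD hM hr] := ev; have jL : R j%:R by apply: in_span_nat.
  have xL : L (x s) by case: (xP s) => /bounded_in_span.
  apply: cong_trans (cong_trans _ (cong_sym (hM _ _ (RL jL) aL))) _.
    by rewrite ![_ * f a]mulrC; apply: (congMl mulR faR (cong_sym (hr _ jL))).
  rewrite ja; apply: cong_trans (hM _ _ xL vL) _; rewrite mulrC.
  by apply: (cong0M mulR) => //; apply: hR.
(* The test element a = z1 t * g1 maps to z1 t * beta under f1 and to 0 under f2, so some j * a is a
   multiple of x t. When x t = x s, applying f1 modulo z1 s turns this into divisibility by z1 s. *)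
have div1 t s : x t = x s -> exists2 u, R u & gamma * z1 t = z1 s * u.
  move=> xts; pose a := z1 t * g1.
  have aL : L a by apply: in_spanM => //; apply: RL.
  have fa : cong Q%:R (f1 a) (z1 t * beta).
    have [hR _ hM hr] := ev1.
    apply: cong_trans (hM _ _ (RL (z1R t)) g1L) _.
    apply: cong_trans (_ : cong Q%:R _ (z1 t * f1 g1)) (congMl mulR (z1R t) f11).
    by rewrite ![_ * f1 g1]mulrC; apply: (congMl mulR) (hr _ (z1R t)); apply: hR.
  have [||j jm [v vL ja]] := tors t a aL.
  - apply: cong_trans (cong_dvd mulR (Q1 t) fa) _; rewrite mulrC.
    by apply: (cong0M mulR) => //; exists 1; rewrite ?subr0 ?mulr1.
  - have [_ _ hM _] := ev2z t; apply: cong_trans (hM _ _ (RL (z1R t)) g1L) _.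
    apply: (cong0M mulR); first by case: (ev2) => hR _ _ _; apply: hR; apply: RL.
    exact: (cong_dvd mulR (Q2 t) f21).
  have [_ _ xs _] := xP s.
  have faR : R (f1 a) by case: (ev1) => hR _ _ _; apply: hR.
  have h := multiple _ _ _ _ _ _ (ev1z s) aL vL xs jm (etrans ja (congr1 (fun y => y * v) xts)) faR.
  have h' := congMl mulR (in_span_nat oneR m`!) (cong_dvd mulR (Q1 s) fa).
  have [w wR wE] := cong0_dvd (cong_trans (cong_sym h') h).
  by exists w; rewrite // -wE /gamma; ring.
have div2 t s : x t = x s -> exists2 u, R u & gamma * z2 t = z2 s * u.
  move=> xts; pose a := (beta * z2 t) * g2.
  have aL : L a by apply: in_spanM => //; apply: RL.
  have fa : cong Q%:R (f2 a) (beta * z2 t * beta).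
    have [hR _ hM hr] := ev2.
    apply: cong_trans (hM _ _ (RL (bz2R t)) g2L) _.
    apply: cong_trans (_ : cong Q%:R _ (beta * z2 t * f2 g2)) (congMl mulR (bz2R t) f22).
    by rewrite ![_ * f2 g2]mulrC; apply: (congMl mulR) (hr _ (bz2R t)); apply: hR.
  have [||j jm [v vL ja]] := tors t a aL.
  - have [_ _ hM _] := ev1z t; apply: cong_trans (hM _ _ (RL (bz2R t)) g2L) _.
    apply: (cong0M mulR); first by case: (ev1) => hR _ _ _; apply: hR; apply: RL.
    exact: (cong_dvd mulR (Q1 t) f12).
  - apply: cong_trans (cong_dvd mulR (Q2 t) fa) _; rewrite (mulrC _ beta).
    by apply: (cong0M mulR) => //; exists 1; rewrite ?subr0 ?mulr1.
  have [_ _ _ xs] := xP s.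
  have faR : R (f2 a) by case: (ev2) => hR _ _ _; apply: hR.
  have h := multiple _ _ _ _ _ _ (ev2z s) aL vL xs jm (etrans ja (congr1 (fun y => y * v) xts)) faR.
  have h' := congMl mulR (in_span_nat oneR m`!) (cong_dvd mulR (Q2 s) fa).
  have [w wR wE] := cong0_dvd (cong_trans (cong_sym h') h).
  exists w => //; apply: (mulfI beta0); rewrite [RHS]mulrA -wE /gamma; ring.
(* The reverse divisibility bounds 2 ^ i by c9 * 2 ^ i', which bounds the quotient u independently
   of S. *)
have ratio i w i' w' :
    (exists2 u, R u & gamma * @near P i w = @near P i' w' * u) ->
    (exists2 u, R u & gamma * @near P i' w' = @near P i w * u) ->
    exists2 u, bounded e (c9 * c9) u & gamma * @near P i w = @near P i' w' * u.
  have bnd j v j' v' u : R u -> gamma * @near P j v = @near P j' v' * u ->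
      bounded e ((c9 * 2 ^ j) %/ (P * 2 ^ j')) u.
    move=> uR uE; have := quo j' v' (c1 * G * (c5 * 2 ^ j))%N u uR.
    rewrite -uE => /(_ (bM _ _ _ _ GP (c5P _ _))).
    by rewrite /c9 !mulnA.
  move=> [u uR uE] [v vR vE]; exists u => //.
  apply: bounded_le (bnd _ _ _ _ _ uR uE).
  have v0 : v != 0.
    apply: contraNneq (mulf_neq0 gamma0 (near0 i' w')) => v0.
    by rewrite vE v0 mulr0.
  have le : (2 ^ i <= c9 * 2 ^ i')%N.
    rewrite leqNgt; apply/negP => lt; case/eqP: v0; apply: (@bounded_0 _ _ e).
    have := bnd _ _ _ _ _ vR vE; rewrite divn_small //.
    by apply: leq_trans lt _; rewrite leq_pmull.
  apply: leq_trans (leq_div2r _ (_ : _ <= c9 * c9 * (P * 2 ^ i'))%N) _.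
    rewrite -mulnA leq_mul2l (leq_trans le) ?orbT // leq_mul2l.
    by rewrite leq_pmull ?orbT.
  by rewrite mulnK // muln_gt0 P0 p2.
have [r rP] := @bounded_code _ _ E T xpredT x B (fun t _ => let: And4 h _ _ _ := xP t in h).
(* A fixed pair with the same x. Every t with that x is recovered from it and from the two bounded
   quotients, so the fibres have bounded size. *)
pose base t := odflt t [pick s | r s == r t].
have rbase t : r (base t) = r t.
  by rewrite /base; case: pickP => [s /eqP //| /(_ t)]; rewrite eqxx.
have baseE t s : r t = r s -> base t = base s.
  move=> rts; rewrite /base rts; case: pickP => // /(_ s).
  by rewrite eqxx.
have xbase t : x t = x (base t) by apply: rP.
have uH t : exists u : F * F, [/\ bounded e (c9 * c9) u.1, bounded e (c9 * c9) u.2,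
    gamma * z1 t = z1 (base t) * u.1 & gamma * z2 t = z2 (base t) * u.2].
  have xb := xbase t.
  have [u1 u1B u1E] := ratio _ _ _ _ (div1 _ _ xb) (div1 _ _ (esym xb)).
  have [u2 u2B u2E] := ratio _ _ _ _ (div2 _ _ xb) (div2 _ _ (esym xb)).
  by exists (u1, u2).
have {uH} [u uP] := fin_choice uH.
have [q1 q1P] := @bounded_code _ _ e T xpredT (fun t => (u t).1) _
  (fun t _ => let: And4 h _ _ _ := uP t in h).
have [q2 q2P] := @bounded_code _ _ e T xpredT (fun t => (u t).2) _
  (fun t _ => let: And4 _ h _ _ := uP t in h).
have inj : injective (fun t => (r t, (q1 t, q2 t))).
  move=> t s [/baseE bts /(q1P _ _ isT isT) u1 /(q2P _ _ isT isT) u2].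
  have [_ _ t1 t2] := uP t; have [_ _ s1 s2] := uP s.
  have e1 : z1 t = z1 s by apply: (mulfI gamma0); rewrite t1 s1 bts u1.
  have e2 : z2 t = z2 s by apply: (mulfI gamma0); rewrite t2 s2 bts u2.
  have tts : tag t = tag s.
    apply: val_inj; apply/eqP; rewrite eqn_leq.
    by rewrite (nearI _ _ _ _ e1) (nearI _ _ _ _ (esym e1)).
  clear -e1 e2 tts freeR; case: t s tts e1 e2 => i [w1 w2] [i' [v1 v2]] /= ii'.
  case: i' / ii' v1 v2 => v1 v2; rewrite /z1 /z2 /=.
  by move=> /addrI/(box_inj freeR) -> /addrI/(box_inj freeR) ->.
have := leq_card _ inj; rewrite !card_prod !card_box cardT.
apply/negP; rewrite -ltnNge /B.
apply: leq_ltn_trans (leq_mul (leq_affine_pow _ _ _) (leqnn _)) _.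
rewrite mulnAC -/N Dl /S (mulnC d) mulnA (mulnC S') ltn_pmul2r ?expn_gt0 //.
by rewrite ltnS leq_pmull.
Qed.
End Core.

(** * Algebraic integers and number fields *)

Lemma minimal_witness (T : Type) (P : T -> Prop) (mu : T -> nat) :
  (exists x, P x) -> exists2 x, P x & forall y, P y -> (mu x <= mu y)%N.
Proof.
move=> [x0 Px0]; have ex : exists n, `[< exists2 x, P x & mu x = n >].
  by exists (mu x0); apply/asboolP; exists x0.
case: (ex_minnP ex) => n /asboolP[x Px <-] min.
by exists x => // y Py; apply: min; apply/asboolP; exists y.
Qed.

Definition aint (x : C) : Prop := integralOver (intr : int -> C) x.

Lemma aintD x y : aint x -> aint y -> aint (x + y). Proof. exact: integral_add. Qed.
Lemma aintN x : aint x -> aint (- x). Proof. exact: integral_opp. Qed.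
Lemma aintB x y : aint x -> aint y -> aint (x - y). Proof. exact: integral_sub. Qed.
Lemma aintM x y : aint x -> aint y -> aint (x * y). Proof. exact: integral_mul. Qed.
Lemma aint0 : aint 0. Proof. exact: integral0. Qed.
Lemma aint1 : aint 1. Proof. exact: integral1. Qed.
Lemma aint_int (a : int) : aint a%:~R. Proof. exact: (integral_id intr). Qed.
Lemma aint_nat (a : nat) : aint a%:R. Proof. exact: (aint_int a). Qed.
Lemma aintX x n : aint x -> aint (x ^+ n).
Proof. by move=> hx; elim: n => [|n IH]; rewrite ?exprS; [exact: aint1 | exact: aintM]. Qed.
Lemma aint_sum (I : Type) (r : seq I) (P : pred I) (h : I -> C) :
  (forall i, P i -> aint (h i)) -> aint (\sum_(i <- r | P i) h i).
Proof. by move=> hh; apply: big_ind => //; [exact: aint0 | exact: aintD]. Qed.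
Lemma aint_root_monic (p : {poly C}) x :
  p \is monic -> (forall i, aint p`_i) -> root p x -> aint x.
Proof.
move=> pm pint px; apply: (integral_root_monic pm px) => _ /(nthP 0)[i _ <-].
exact: pint.
Qed.

Lemma aint_rat (q : rat) : aint (ratr q) -> q \is a Num.int.
Proof.
case=> p pm; rewrite -[map_poly _ p]/(map_poly intr p) => /eqP pq.
have pq' : (map_poly intr p : {poly rat}).[q] = 0.
  apply: (fmorph_inj (ratr : {rmorphism rat -> C})).
  by rewrite rmorph0 -horner_map -map_poly_comp (eq_map_poly (g := intr)) // => z; rewrite /= ratr_int.
suff /intrP[m] : ratr q \is a @Num.int algC.
  rewrite -(ratr_int algC m) => /(fmorph_inj (ratr : {rmorphism rat -> algC})) ->.
  exact: intr_int.
apply: Cint_rat_Aint; first by apply/CratP; exists q.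
apply: (@root_monic_Aint (map_poly intr p)).
- apply/eqP; rewrite (_ : map_poly intr p = map_poly (ratr : rat -> algC) (map_poly intr p)).
    by rewrite horner_map pq' rmorph0.
  by rewrite -map_poly_comp; apply: eq_map_poly => z; rewrite /= ratr_int.
- exact: monic_map.
- by apply/polyOverP => i; rewrite coef_map intr_int.
Qed.

Lemma aint_eigenvalue n (A : 'M[int]_n) (v : 'rV[C]_n) (x : C) :
  v != 0 -> v *m map_mx intr A = x *: v -> aint x.
Proof.
move=> v0 vA; exists (char_poly A); first exact: char_poly_monic.
rewrite (_ : map_poly _ _ = char_poly (map_mx intr A : 'M[C]_n)).
  by rewrite -eigenvalue_root_char; apply/eigenvalueP; exists v.
exact: map_char_poly.
Qed.

Section QSpan.
Variables (d : nat) (b : 'I_d -> C).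
Definition qspan (c : 'rV[rat]_d) : C := \sum_i ratr (c 0 i) * b i.

Lemma qspanD u v : qspan (u + v) = qspan u + qspan v.
Proof. by rewrite -big_split; apply: eq_bigr => i _; rewrite mxE rmorphD mulrDl. Qed.

Lemma qspanZ a u : qspan (a *: u) = ratr a * qspan u.
Proof. by rewrite mulr_sumr; apply: eq_bigr => i _; rewrite mxE rmorphM mulrA. Qed.

Lemma qspan0 : qspan 0 = 0.
Proof. by apply: big1 => i _; rewrite mxE rmorph0 mul0r. Qed.

Lemma qspanB u v : qspan (u - v) = qspan u - qspan v.
Proof. by rewrite -scaleN1r qspanD qspanZ rmorphN1 mulN1r. Qed.

Lemma qspan_delta i : qspan (delta_mx 0 i) = b i.
Proof.
rewrite /qspan (bigD1 i) //= mxE !eqxx rmorph1 mul1r big1 ?addr0 //.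
by move=> j /negPf ji; rewrite mxE ji andbF rmorph0 mul0r.
Qed.

Lemma qspan_mul (c : 'rV_d) (M : 'M[rat]_d) :
  qspan (c *m M) = \sum_i ratr (c 0 i) * qspan (row i M).
Proof.
rewrite /qspan; under eq_bigr do rewrite mxE rmorph_sum mulr_suml.
rewrite exchange_big; apply: eq_bigr => i _ /=; rewrite mulr_sumr.
by apply: eq_bigr => j _; rewrite !mxE rmorphM mulrA.
Qed.

Definition qfree : Prop := forall c, qspan c = 0 -> c = 0.
End QSpan.

Lemma qfree_zfree d (b : 'I_d -> C) : qfree b -> forall z, zspan b z = 0 -> z = 0.
Proof.
move=> fb z z0; have /rowP h : map_mx intr z = 0 :> 'rV[rat]_d.
  by apply: fb; rewrite -[RHS]z0; apply: eq_bigr => i _; rewrite mxE ratr_int.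
by apply/rowP => i; apply/eqP; have := h i; rewrite !mxE => /eqP; rewrite intr_eq0.
Qed.

Lemma common_denominator (T : finType) (q : T -> rat) :
  exists2 N : nat, (0 < N)%N & forall t, (N%:R * q t) \is a Num.int.
Proof.
exists (\prod_t `|denq (q t)|)%N; first by rewrite prodn_gt0 // => t; rewrite absz_gt0 denq_neq0.
move=> t; rewrite (bigD1 t) //= natrM mulrAC rpredM ?natr_int //.
rewrite -[_%:R]/((`|denq (q t)|%N%:Z)%:~R) gtz0_abs ?denq_gt0 //.
by rewrite mulrC -numqE intr_int.
Qed.

Section NumberField.
Variable k : C -> Prop.
Hypothesis kP : number_field k.

Lemma nf0 : k 0. Proof. by case: kP => [[]]. Qed.
Lemma nf1 : k 1. Proof. by case: kP => [[]]. Qed.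
Lemma nfD x y : k x -> k y -> k (x + y). Proof. by case: kP => _ [h _] _ _ _; apply: h. Qed.
Lemma nfN x : k x -> k (- x). Proof. by case: kP => _ [_ h] _ _ _; apply: h. Qed.
Lemma nfB x y : k x -> k y -> k (x - y). Proof. by move=> hx /nfN; apply: nfD. Qed.
Lemma nfM x y : k x -> k y -> k (x * y). Proof. by case: kP => _ _ h _ _; apply: h. Qed.
Lemma nfV x : k x -> k x^-1.
Proof. by have [->|x0] := eqVneq x 0; rewrite ?invr0 //; case: kP => _ _ _ h _ /h; apply. Qed.
Lemma nfX x n : k x -> k (x ^+ n).
Proof. by move=> hx; elim: n => [|n IH]; rewrite ?exprS; [exact: nf1 | exact: nfM]. Qed.
Lemma nf_nat n : k n%:R.
Proof. by elim: n => [|n IH]; rewrite ?mulrS; [exact: nf0 | apply: nfD => //; exact: nf1]. Qed.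
Lemma nf_int (a : int) : k a%:~R.
Proof. by case: a => n; rewrite ?NegzE ?rmorphN; [|apply: nfN]; exact: nf_nat. Qed.
Lemma nf_rat (q : rat) : k (ratr q).
Proof. by rewrite /ratr; apply: nfM; [|apply: nfV]; exact: nf_int. Qed.
Lemma nf_sum (I : Type) (r : seq I) (P : pred I) (h : I -> C) :
  (forall i, P i -> k (h i)) -> k (\sum_(i <- r | P i) h i).
Proof. by move=> hh; apply: big_ind => //; [exact: nf0 | exact: nfD]. Qed.
Lemma nf_prod (I : Type) (r : seq I) (P : pred I) (h : I -> C) :
  (forall i, P i -> k (h i)) -> k (\prod_(i <- r | P i) h i).
Proof. by move=> hh; apply: big_ind => //; [exact: nf1 | exact: nfM]. Qed.

Lemma ring_of_integersE x : ring_of_integers k x <-> k x /\ aint x.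
Proof.
by split=> -[kx]; [case=> p [pm pr] | case=> p pm pr]; split => //; exists p.
Qed.

(** A spanning family of least size is free: a relation with nonzero j-th coefficient would express
    b j through the others. *)
Lemma nf_basis : exists d, exists2 b : 'I_d -> C, (forall i, k (b i)) /\ qfree b &
  forall x, k x -> exists c, x = qspan b c.
Proof.
pose P (db : {d : nat & 'I_d -> C}) :=
  (forall i, k (projT2 db i)) /\ forall x, k x -> exists c, x = qspan (projT2 db) c.
have [|[d b] /= [bk bs] min] := @minimal_witness _ P (fun db => projT1 db).
  case: kP => _ _ _ _ [d [b [bk bs]]]; exists (existT _ d b); split => // x /bs[c ->].
  by exists (\row_i c i); apply: eq_bigr => i _; rewrite mxE.
exists d, b => //; split => // c c0; apply/eqP/negPn/negP => /rV0Pn[j cj].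
case: d b bk bs min c c0 j cj => [|d] b bk bs min c c0 j cj; first by case: j cj.
have bj : b j = \sum_(i < d) ratr (- c 0 (lift j i) / c 0 j) * b (lift j i).
  move/eqP: c0; rewrite /qspan (bigD1_ord j) //= addr_eq0 => /eqP h.
  apply: (mulfI (_ : ratr (c 0 j) != 0)); first by rewrite fmorph_eq0.
  rewrite h -sumrN mulr_sumr; apply: eq_bigr => i _.
  by rewrite mulrA -rmorphM mulrCA divff // mulr1 rmorphN mulNr.
suff /min /= : P (existT (fun d => 'I_d -> C) d (fun i => b (lift j i))) by rewrite ltnn.
split=> [i|x /bs[a ->]]; first exact: bk.
exists (\row_i (a 0 (lift j i) - a 0 j * c 0 (lift j i) / c 0 j)).
rewrite /qspan (bigD1_ord j) //= bj mulr_sumr -big_split /=; apply: eq_bigr => i _.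
rewrite mxE mulrA -mulrDl -rmorphM -rmorphD; congr (ratr _ * _); ring.
Qed.

Section Trace.
Variables (d : nat) (b : 'I_d -> C).
Hypotheses (bk : forall i, k (b i)) (fb : qfree b).
Hypothesis bs : forall x, k x -> exists c, x = qspan b c.

Lemma qspan_inj : injective (qspan b).
Proof. by move=> u v uv; apply/eqP; rewrite -subr_eq0; apply/eqP/fb; rewrite qspanB uv subrr. Qed.

Lemma nf_qspan c : k (qspan b c).
Proof. by apply: nf_sum => i _; apply: nfM => //; exact: nf_rat. Qed.

Lemma mult_matrix : exists M : C -> 'M[rat]_d, forall x, k x ->
  forall c, qspan b (c *m M x) = qspan b c * x.
Proof.
have H x : exists A : 'M[rat]_d, k x -> forall c, qspan b (c *m A) = qspan b c * x.
  case: (pselect (k x)) => [kx|nk]; last by exists 0.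
  have h i : exists c, b i * x = qspan b c by apply: bs; apply: nfM.
  have [M MP] := fin_choice h; exists (\matrix_i M i) => _ c.
  rewrite qspan_mul /qspan mulr_suml; apply: eq_bigr => i _.
  by rewrite rowK -[RHS]mulrA MP.
by have [M MP] := choice H; exists M.
Qed.

Variable M : C -> 'M[rat]_d.
Hypothesis MP : forall x, k x -> forall c, qspan b (c *m M x) = qspan b c * x.

Lemma mult_matrix_eq x A :
  k x -> (forall c, qspan b (c *m A) = qspan b c * x) -> A = M x.
Proof.
by move=> kx h; apply/row_matrixP => i; apply: qspan_inj; rewrite !rowE h MP.
Qed.

Lemma mult_matrixD x y : k x -> k y -> M (x + y) = M x + M y.
Proof.
move=> kx ky; apply/esym/mult_matrix_eq => [|c]; first exact: nfD.
by rewrite mulmxDr qspanD !MP // mulrDr.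
Qed.

Lemma mult_matrixM x y : k x -> k y -> M (x * y) = M x *m M y.
Proof.
move=> kx ky; apply/esym/mult_matrix_eq => [|c]; first exact: nfM.
by rewrite mulmxA !MP // mulrA.
Qed.

Lemma mult_matrixZ q x : k x -> M (ratr q * x) = q *: M x.
Proof.
move=> kx; apply/esym/mult_matrix_eq => [|c]; first by apply: nfM => //; exact: nf_rat.
by rewrite -scalemxAr qspanZ MP // mulrCA.
Qed.

Lemma mult_matrix1 : M 1 = 1%:M.
Proof. by apply/esym/mult_matrix_eq => [|c]; [exact: nf1 | rewrite mulmx1 mulr1]. Qed.

Lemma nf_dim_gt0 : (0 < d)%N.
Proof.
case: (posnP d) => // d0; have [c] := bs nf1; rewrite /qspan big1 => [/eqP|i _].
  by rewrite oner_eq0.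
by exfalso; have := ltn_ord i; rewrite ltnNge [X in (X <= _)%N]d0.
Qed.

(** The integral polynomial of x kills its multiplication matrix, so all eigenvalues are algebraic
    integers. The trace is their sum, and a rational algebraic integer is an integer. *)
Lemma trace_int x : k x -> aint x -> \tr (M x) \is a Num.int.
Proof.
move=> kx [p pm px].
have d0 := nf_dim_gt0; case: d b bk fb bs M MP d0 => // n b' bk' fb' bs' M' MP' _.
have ev (P : {poly rat}) c :
    qspan b' (c *m horner_mx (M' x) P) = qspan b' c * (map_poly ratr P).[x].
  elim/poly_ind: P c => [|P a IH] c.
    by rewrite rmorph0 mulmx0 qspan0 rmorph0 horner0 mulr0.
  rewrite rmorphD rmorphM /= horner_mx_X horner_mx_C mulmxDr qspanD mulmxA MP' // IH.
  rewrite mul_mx_scalar qspanZ rmorphD rmorphM /= map_polyX map_polyC hornerD hornerM.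
  by rewrite hornerX hornerC mulrDr mulrA [ratr a * _]mulrC.
pose pq : {poly rat} := map_poly intr p.
have pqx : (map_poly ratr pq).[x] = 0 :> C.
  rewrite -map_poly_comp (eq_map_poly (g := intr)); last by move=> z; rewrite /= ratr_int.
  exact/eqP.
have pM : horner_mx (M' x) pq = 0.
  by apply/row_matrixP => i; rewrite row0; apply: fb'; rewrite rowE ev pqx mulr0.
pose A : 'M[C]_n.+1 := map_mx ratr (M' x).
have roots (z : C) : root (char_poly A) z -> aint z.
  rewrite -root_mxminpoly => rz; exists p => //.
  rewrite (_ : map_poly _ p = map_poly ratr pq); last first.
    by rewrite -map_poly_comp; apply: eq_map_poly => y; rewrite /= ratr_int.
  have /dvdpP[u ->] : mxminpoly A %| map_poly ratr pq.
    by apply: mxminpoly_min; rewrite -map_horner_mx pM map_mx0.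
  by rewrite rootM rz orbT.
apply: aint_rat; rewrite -[ratr _]opprK -trace_map_mx -/A; apply: aintN.
rewrite -char_poly_trace //.
have [r rE] := closed_field_poly_normal (char_poly A).
move: rE; rewrite (monicP (char_poly_monic _)) scale1r => rE.
have sr : size r = n.+1.
  by apply: succn_inj; rewrite -(size_prod_XsubC r id) -rE size_char_poly.
have -> : n.+1.-1 = (size r).-1 by rewrite sr.
rewrite {1}rE coefPn_prod_XsubC ?sr //; apply: aintN; rewrite big_seq; apply: aint_sum => z zr.
by apply: roots; rewrite rE root_prod_XsubC.
Qed.
End Trace.
End NumberField.

Lemma det_row_replaced (F : comPzRingType) d (j : 'I_d) (r : 'rV[F]_d) :
  \det (\matrix_(i < d, l < d) if i == j then r 0 l else (i == l)%:R) = r 0 j.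
Proof.
rewrite (expand_det_col _ j) (bigD1 j) //= mxE eqxx big1 ?addr0 => [|i /negPf ij].
  rewrite /cofactor -signr_odd oddD addbb expr0 mul1r.
  rewrite (_ : row' _ _ = 1%:M) ?det1 ?mulr1 //; apply/matrixP => i l.
  by rewrite !mxE eq_sym (negPf (neq_lift _ _)) (inj_eq lift_inj).
by rewrite !mxE ij mul0r.
Qed.

Section IntegralBasis.
Variable k : C -> Prop.
Hypothesis kP : number_field k.

(** Once N clears the denominators of the multiplication matrix of x, N * x is an eigenvalue of an
    integral matrix, with the basis of k as eigenvector. *)
Lemma nf_denominator x : k x -> exists2 N : nat, (0 < N)%N & aint (N%:R * x).
Proof.
move=> kx; have [d [b [bk fb] bs]] := nf_basis kP.
have [M MP] := mult_matrix kP bk bs.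
have [N N0 NM] := common_denominator (fun ij => M x ij.1 ij.2).
exists N => //; pose A : 'M[int]_d := \matrix_(i, j) numq (N%:R * M x j i).
pose v : 'rV[C]_d := \row_i b i.
apply: (@aint_eigenvalue _ A v).
  apply/rV0Pn; have d0 := nf_dim_gt0 kP bs.
  exists (Ordinal d0); rewrite mxE; apply/negP => /eqP b0.
  have /fb/rowP/(_ (Ordinal d0))/eqP : qspan b (delta_mx 0 (Ordinal d0)) = 0.
    by rewrite qspan_delta.
  by rewrite !mxE !eqxx oner_eq0.
apply/rowP => i; rewrite !mxE.
have := MP x kx (delta_mx 0 i); rewrite -rowE qspan_delta => h.
rewrite -mulrA [x * _]mulrC -h /qspan mulr_sumr; apply: eq_bigr => j _.
rewrite !mxE [RHS]mulrA [RHS]mulrC; congr (_ * _).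
rewrite -[LHS]ratr_int (numqK (NM (i, j))).
by rewrite (rmorphM (ratr : {rmorphism rat -> C})) /= ratr_nat.
Qed.

(* An integral basis of k over Q whose trace form has minimal discriminant. *)
Theorem integral_basis : exists d, exists2 e : 'I_d -> C, qfree e &
  forall x, ring_of_integers k x <-> in_span e x.
Proof.
have [d [b [bk fb] bs]] := nf_basis kP.
have [M MP] := mult_matrix kP bk bs.
pose T x : rat := \tr (M x).
have TZ q x : k x -> T (ratr q * x) = q * T x.
  by move=> kx; rewrite /T (mult_matrixZ kP fb MP) // mxtraceZ.
have TD x y : k x -> k y -> T (x + y) = T x + T y.
  by move=> kx ky; rewrite /T (mult_matrixD kP fb MP) // mxtraceD.
have T0 : T 0 = 0 by rewrite -[X in T X](mul0r 1) -(rmorph0 (ratr : rat -> C)) TZ ?mul0r //; exact: nf1.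
have Tq u y : k y -> T (qspan b u * y) = \sum_i u 0 i * T (b i * y).
  move=> ky; rewrite /qspan mulr_suml.
  suff [] : k (\sum_i ratr (u 0 i) * b i * y) /\
    T (\sum_i ratr (u 0 i) * b i * y) = \sum_i u 0 i * T (b i * y) by [].
  elim/big_rec2: _ => [|i s t _ [kt ts]]; first by split => //; exact: nf0.
  have kby : k (b i * y) by apply: (nfM kP).
  rewrite -mulrA; split; first by apply: (nfD kP) => //; apply: (nfM kP) => //; apply: nf_rat.
  by rewrite TD // ?TZ // ?ts //; apply: (nfM kP) => //; apply: nf_rat.
have kq := nf_qspan kP bk.
pose Gb : 'M_d := \matrix_(i, j) T (b i * b j).
have Tqq u v : T (qspan b u * qspan b v) = (u *m Gb *m v^T) 0 0.
  rewrite Tq // -mulmxA mxE; apply: eq_bigr => i _; congr (_ * _).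
  rewrite mulrC Tq // mxE; apply: eq_bigr => j _.
  by rewrite !mxE mulrC [b i * _]mulrC.
(* The trace form is nondegenerate because T (x * x^-1) = T 1 is the degree of k. *)
have Gb0 : \det Gb != 0.
  apply/det0P => -[c c0 cG].
  have x0 : qspan b c != 0 by apply: contraNneq c0 => /fb ->.
  have [u uE] := bs _ (nfV kP (kq c)).
  have := Tqq c u; rewrite cG mul0mx mxE -uE divff // /T (mult_matrix1 kP fb MP).
  rewrite mxtrace1 => /eqP; rewrite pnatr_eq0 -leqn0 leqNgt.
  by rewrite (nf_dim_gt0 kP bs).
pose disc (A : 'M_d) : rat := \det (A *m Gb *m A^T).
have discE A : disc A = \det A ^+ 2 * \det Gb.
  by rewrite /disc !det_mulmx det_tr mulrAC expr2.
pose P A := (A \in unitmx) /\ forall i, aint (qspan b (row i A)).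
have discZ A : P A -> disc A \is a Num.int.
  case=> _ Aint; have ent i j : (A *m Gb *m A^T) i j \is a Num.int.
    suff -> : (A *m Gb *m A^T) i j = T (qspan b (row i A) * qspan b (row j A)).
      by apply: (trace_int kP bk fb bs MP); [apply: (nfM kP) | apply: aintM].
    by rewrite Tqq tr_row -!row_mul !mxE; apply: eq_bigr => l _; rewrite !mxE.
  apply: rpred_sum => s _; apply: rpredM; first by rewrite rpredX ?rpredN1.
  by apply: rpred_prod => i _; apply: ent.
have [|A [Au Aint] Amin] := @minimal_witness _ P (fun A => `|numq (disc A)|%N).
  have h i : exists N : nat, (0 < N)%N /\ aint (N%:R * b i).
    by have [N] := nf_denominator (bk i); exists N.
  have [N NP] := fin_choice h; exists (diag_mx (\row_i (N i)%:R)); split.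
    rewrite unitmxE det_diag unitfE; apply/prodf_neq0 => i _.
    by rewrite mxE pnatr_eq0 -lt0n; case: (NP i).
  by move=> i; rewrite row_diag_mx qspanZ qspan_delta mxE ratr_nat; case: (NP i).
pose e i := qspan b (row i A).
have eE c : qspan b (c *m A) = qspan e c by rewrite qspan_mul.
exists d, e.
  move=> c; rewrite -eE => /fb/(congr1 (mulmx^~ (invmx A))).
  by rewrite /= mulmxK // mul0mx.
move=> x; split; last first.
  case=> z ->; apply/ring_of_integersE; split.
    by apply: (nf_sum kP) => i _; apply: (nfM kP); [exact: nf_int | exact: kq].
  by apply: aint_sum => i _; apply: aintM; [exact: aint_int | exact: Aint].
case/ring_of_integersE=> kx xint; have [c' xE] := bs _ kx.
pose c := c' *m invmx A.
have {}xE : x = qspan e c by rewrite -eE mulmxKV.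
pose q : 'rV[int]_d := \row_i Num.floor (c 0 i).
pose r : 'rV[rat]_d := c - map_mx intr q.
have rlt i : 0 <= r 0 i < 1.
  rewrite !mxE subr_ge0 ge_floor /= ltrBlDl.
  by rewrite -[1]/(1%:~R) -rmorphD floorD1_gt.
have qE : qspan e (map_mx intr q) = zspan e q.
  by apply: eq_bigr => i _; rewrite mxE ratr_int.
exists q; apply/eqP; rewrite -subr_eq0 -qE xE -qspanB -/r; apply/eqP.
suff -> : r = 0 by rewrite qspan0.
apply/rowP => j; rewrite [RHS]mxE; apply/eqP/negPn/negP => rj.
(* Replacing the j-th basis element by the integer with the fractional coordinates r multiplies the
   discriminant by the square of r j, which is less than 1. *)
pose U : 'M[rat]_d := \matrix_(i, l) if i == j then r 0 l else (i == l)%:R.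
have detU : \det U = r 0 j by apply: det_row_replaced.
have PA' : P (U *m A).
  split; first by rewrite unitmx_mul Au andbT unitmxE detU unitfE.
  move=> i; rewrite row_mul eE; case: (eqVneq i j) => [->|ij].
    have -> : row j U = r by apply/rowP => l; rewrite !mxE eqxx.
    rewrite /r qspanB -xE qE; apply: aintB => //; apply: aint_sum => l _.
    by apply: aintM; [exact: aint_int | exact: Aint].
  have -> : row i U = delta_mx 0 i.
    by apply/rowP => l; rewrite !mxE (negPf ij) eqxx /= eq_sym.
  by rewrite qspan_delta; apply: Aint.
have := Amin _ PA'; apply/negP; rewrite -ltnNge.
have d1 := discZ _ (conj Au Aint); have d2 := discZ _ PA'.
have dA0 : disc A != 0 by rewrite discE mulf_neq0 // expf_neq0 // -unitfE -unitmxE.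
have lt : `|disc (U *m A)| < `|disc A|.
  rewrite !discE det_mulmx exprMn -mulrA normrM -discE gtr_pMl ?normr_gt0 // detU.
  have /andP[r0 r1] := rlt j.
  by rewrite ger0_norm ?sqr_ge0 // expr_lt1.
by rewrite -ltz_nat !abszE -(ltr_int rat) !intr_norm !numqK.
Qed.

End IntegralBasis.

(** * A local-global principle for powers of units *)

Section Over.
Variable S : C -> Prop.
Definition subring_pred : Prop :=
  [/\ S 1, forall x y, S x -> S y -> S (x - y) & forall x y, S x -> S y -> S (x * y)].
Definition poly_in (A : {poly C}) : Prop := forall i, S A`_i.
Hypothesis ringS : subring_pred.

Lemma srB x y : S x -> S y -> S (x - y). Proof. by case: ringS => _ h _; apply: h. Qed.
Lemma srM x y : S x -> S y -> S (x * y). Proof. by case: ringS => _ _ h; apply: h. Qed.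
Lemma sr1 : S 1. Proof. by case: ringS. Qed.
Lemma sr0 : S 0. Proof. by rewrite -(subrr 1); apply: srB; exact: sr1. Qed.
Lemma srN x : S x -> S (- x). Proof. by rewrite -sub0r; apply: srB; exact: sr0. Qed.
Lemma srD x y : S x -> S y -> S (x + y).
Proof. by move=> hx hy; rewrite -[y]opprK; apply: srB => //; apply: srN. Qed.
Lemma srX x n : S x -> S (x ^+ n).
Proof. by move=> hx; elim: n => [|n IH]; rewrite ?exprS; [exact: sr1 | exact: srM]. Qed.
Lemma sr_sum (I : Type) (r : seq I) (P : pred I) (h : I -> C) :
  (forall i, P i -> S (h i)) -> S (\sum_(i <- r | P i) h i).
Proof. by move=> hh; apply: big_ind => //; [exact: sr0 | exact: srD]. Qed.

Lemma over0 : poly_in 0. Proof. by move=> i; rewrite coef0; exact: sr0. Qed.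
Lemma overC c : S c -> poly_in c%:P.
Proof. by move=> Sc i; rewrite coefC; case: ifP => // _; exact: sr0. Qed.
Lemma overX : poly_in 'X.
Proof. by move=> i; rewrite coefX; case: eqP => _; [exact: sr1 | exact: sr0]. Qed.
Lemma overD A B : poly_in A -> poly_in B -> poly_in (A + B).
Proof. by move=> hA hB i; rewrite coefD; apply: srD. Qed.
Lemma overB A B : poly_in A -> poly_in B -> poly_in (A - B).
Proof. by move=> hA hB i; rewrite coefB; apply: srB. Qed.
Lemma overM A B : poly_in A -> poly_in B -> poly_in (A * B).
Proof. by move=> hA hB i; rewrite coefM; apply: sr_sum => j _; apply: srM. Qed.
Lemma overZ c A : S c -> poly_in A -> poly_in (c *: A).
Proof. by move=> hc hA i; rewrite coefZ; apply: srM. Qed.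
Lemma overXn n : poly_in ('X^n).
Proof. by move=> i; rewrite coefXn; case: eqP => _; [exact: sr1 | exact: sr0]. Qed.
Lemma over_XnsubC n c : S c -> poly_in ('X^n - c%:P).
Proof. by move=> Sc; apply: overB; [exact: overXn | exact: overC]. Qed.
Lemma over_horner A x : poly_in A -> S x -> S A.[x].
Proof.
by move=> hA hx; rewrite horner_coef; apply: sr_sum => i _; apply: srM => //; apply: srX.
Qed.

Lemma over_divmod (g A : {poly C}) : g \is monic -> poly_in g -> poly_in A ->
  exists q r, [/\ poly_in q, poly_in r, (size r < size g)%N & A = q * g + r].
Proof.
move=> gm hg; have g0 := monic_neq0 gm.
elim/poly_ind: A => [|A c IH] hA.
  by exists 0, 0; rewrite mul0r addr0 size_poly0 size_poly_gt0; split => //; exact: over0.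
have [q [r [hq hr sr E]]] : exists q r,
    [/\ poly_in q, poly_in r, (size r < size g)%N & A = q * g + r].
  apply: IH => i; have := hA i.+1.
  by rewrite coefD coefMX coefC /= addr0.
have hc : S c by have := hA 0%N; rewrite coefD coefMX coefC /= add0r.
pose s := r * 'X + c%:P; pose a := s`_(size g).-1.
have hs : poly_in s by apply: overD; [apply: overM => //; exact: overX | exact: overC].
have ss : (size s <= size g)%N.
  by rewrite size_MXaddC; case: ifP => _ //; rewrite size_poly_gt0.
exists (q * 'X + a%:P), (s - a *: g); split.
- by apply: overD; [apply: overM => //; exact: overX | apply: overC; exact: hs].
- by apply: overB => //; apply: overZ => //; exact: hs.
- rewrite -(prednK (_ : 0 < size g)%N) ?size_poly_gt0 // ltnS.
  apply/leq_sizeP => j; rewrite leq_eqVlt => /predU1P[<-|lt].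
    by rewrite coefB coefZ -/a -/(lead_coef g) (monicP gm) mulr1 subrr.
  have lt' : (size g <= j)%N by rewrite -(prednK (_ : 0 < size g)%N) ?size_poly_gt0.
  rewrite coefB coefZ !nth_default ?mulr0 ?subrr //.
  by apply: leq_trans ss _.
- by rewrite E /s -mul_polyC; ring.
Qed.

End Over.

Lemma nf_subring k : number_field k -> subring_pred k.
Proof. by move=> kP; split; [exact: nf1 | exact: nfB | exact: nfM]. Qed.

Lemma nf_minpoly k x : number_field k ->
  (exists A, [/\ poly_in k A, A != 0 & root A x]) ->
  exists g, [/\ g \is monic, poly_in k g, root g x &
    forall A, poly_in k A -> root A x -> exists2 q, poly_in k q & A = q * g].
Proof.
move=> kP ex; have kR := nf_subring kP.
have [A [hA A0 Ax] min] := @minimal_witness _ _ (fun A : {poly C} => size A) ex.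
pose g := (lead_coef A)^-1 *: A.
have l0 : lead_coef A != 0 by rewrite lead_coef_eq0.
have gm : g \is monic by rewrite monicE lead_coefZ mulVf.
have hg : poly_in k g by apply: overZ => //; apply: (nfV kP); exact: hA.
have gx : root g x by rewrite rootZ ?invr_eq0.
exists g; split => // B hB Bx.
have [q [r [hq hr sr E]]] := over_divmod kR gm hg hB.
exists q => //; rewrite E; suff -> : r = 0 by rewrite addr0.
apply/eqP/negPn/negP => r0; have := min r.
rewrite leqNgt -(size_scale A (_ : (lead_coef A)^-1 != 0)) ?invr_eq0 // sr.
suff h : [/\ poly_in k r, r != 0 & root r x] by move/(_ h).
split => //; rewrite (_ : r = B - q * g); last by rewrite E addrAC subrr add0r.
by rewrite rootE hornerD hornerN hornerM (eqP gx) mulr0 subr0 (eqP Bx).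
Qed.

Lemma prime_primitive_root (l : nat) (z : C) :
  prime l -> z ^+ l = 1 -> z != 1 -> l.-primitive_root z.
Proof.
move=> lp zl z1; have [m mp ml] := prim_order_exists (prime_gt0 lp) zl.
case/primeP: (lp) => _ /(_ _ ml)/orP[] /eqP ml'; last by rewrite -ml'.
by have := prim_expr_order mp; rewrite ml' expr1 => /eqP; rewrite (negPf z1).
Qed.

Section KummerPrime.
Variables (k : C -> Prop) (l : nat) (zeta b : C).
Hypotheses (kP : number_field k) (lp : prime l).
Hypotheses (kz : k zeta) (zl : zeta ^+ l = 1) (z1 : zeta != 1).
Hypotheses (bO : ring_of_integers k b) (b0 : b != 0).
Variable y : C.
Hypotheses (yl : y ^+ l = b) (ky : ~ k y).

(** The roots of the minimal polynomial g of y are y times powers of zeta, so its constant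
    coefficient puts y ^+ n in k, where n is its degree. If n < l, then n is coprime to l and y
    itself lies in k. *)
Lemma kummer_indep A : poly_in k A -> (size A <= l)%N -> root A y -> A = 0.
Proof.
have l0 := prime_gt0 lp.
have kb : k b by case/ring_of_integersE: bO.
have [|g [gm hg gy gdvd]] := @nf_minpoly k y kP.
  exists ('X^l - b%:P); split; last by rewrite rootE hornerD hornerN hornerC hornerXn yl subrr.
    exact: (over_XnsubC (nf_subring kP)).
  by rewrite -size_poly_eq0 size_XnsubC.
move=> hA sA Ay; have [q hq E] := gdvd _ hA Ay.
case: (ltnP l (size g)) => [lg|gl].
  apply/eqP/negPn/negP => A0; have := sA; rewrite leqNgt => /negP; apply.
  apply: leq_trans lg _; rewrite E dvdp_leq ?dvdp_mull //.
  by rewrite -E.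
exfalso; apply: ky.
have zp := prime_primitive_root lp zl z1.
have y0 : y != 0 by apply: contraNneq b0 => y0; rewrite -yl y0 expr0n eqn0Ngt l0.
have [s gE] := closed_field_poly_normal g.
move: gE; rewrite (monicP gm) scale1r => gE.
have [B hB BE] : exists2 q, poly_in k q & 'X^l - b%:P = q * g.
  apply: gdvd; last by rewrite rootE hornerD hornerN hornerC hornerXn yl subrr.
  exact: (over_XnsubC (nf_subring kP)).
have sroot z : z \in s -> z ^+ l = b.
  move=> zs; have gz : root g z by rewrite gE root_prod_XsubC.
  have /eqP : ('X^l - b%:P).[z] == 0 by rewrite BE hornerM (eqP gz) mulr0.
  by rewrite hornerD hornerN hornerC hornerXn => /eqP; rewrite subr_eq0 => /eqP.
have skroot z : z \in s -> k (z / y).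
  move/sroot=> zb; have /(prim_rootP zp)[i ->] : (z / y) ^+ l = 1 by rewrite exprMn zb exprVn yl divff.
  exact: (nfX kP).
pose n := size s.
have sg : size g = n.+1 by rewrite gE size_prod_XsubC.
have kyn : k (y ^+ n).
  have : k (g`_0) by apply: hg.
  rewrite gE coef0_prod_XsubC => h1.
  have h2 : k (\prod_(z <- s) z).
    rewrite -(signrMK (size s) (\prod_(z <- s) z)); apply: (nfM kP) => //.
    by apply: (nfX kP); apply: (nfN kP); exact: nf1.
  have E' : \prod_(z <- s) z = (\prod_(z <- s) (z / y)) * y ^+ n.
    rewrite /n; elim: (s) => [|z s' IH]; first by rewrite !big_nil mulr1.
    by rewrite !big_cons IH /= exprS; field.
  have kr : k (\prod_(z <- s) (z / y)).
    by rewrite big_seq; apply: (nf_prod kP) => z /skroot.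
  have r0 : \prod_(z <- s) (z / y) != 0.
    rewrite big_seq; apply: (big_ind (fun x => x != 0)); first exact: oner_neq0.
      exact: mulf_neq0.
    move=> z /sroot zb; rewrite mulf_neq0 ?invr_eq0 //.
    by apply: contraNneq b0 => z0; rewrite -zb z0 expr0n eqn0Ngt l0.
  rewrite (_ : y ^+ n = (\prod_(z <- s) (z / y))^-1 * \prod_(z <- s) z).
    by apply: (nfM kP) => //; apply: (nfV kP).
  by rewrite E' mulKf.
have n0 : (0 < n)%N.
  rewrite lt0n; apply/negP => /eqP n0; move: gy; rewrite gE (size0nil n0) big_nil.
  by rewrite rootC oner_eq0.
have nl : (n < l)%N by rewrite -sg.
have cop : coprime n l by rewrite coprime_sym prime_coprime // gtnNdvd.
case: (egcdnP l n0) => u v uv _; rewrite (eqP cop) in uv.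
have -> : y = (y ^+ n) ^+ u / b ^+ v.
  rewrite -exprM mulnC uv exprD expr1 mulnC exprM yl mulrAC divff ?mul1r //.
  by rewrite expf_neq0.
by apply: (nfM kP); [apply: (nfX kP) | apply: (nfV kP); apply: (nfX kP)].
Qed.
End KummerPrime.

Lemma OK_subring k : number_field k -> subring_pred (ring_of_integers k).
Proof.
move=> kP; split.
- by apply/(ring_of_integersE k); split; [exact: nf1 | exact: aint1].
- move=> x y /(ring_of_integersE k)[kx ax] /(ring_of_integersE k)[ky ay].
  by apply/(ring_of_integersE k); split; [exact: nfB | exact: aintB].
- move=> x y /(ring_of_integersE k)[kx ax] /(ring_of_integersE k)[ky ay].
  by apply/(ring_of_integersE k); split; [exact: nfM | exact: aintM].
Qed.

Lemma OK_root k x n : number_field k -> (0 < n)%N -> k x -> ring_of_integers k (x ^+ n) ->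
  ring_of_integers k x.
Proof.
move=> kP n0 kx /(ring_of_integersE k)[_ axn]; apply/(ring_of_integersE k); split => //.
apply: (@aint_root_monic ('X^n - (x ^+ n)%:P)).
- exact: monicXnsubC.
- move=> i; rewrite coefB coefXn coefC; apply: aintB.
    by case: eqP => _; [exact: aint1 | exact: aint0].
  by case: eqP => _ //; exact: aint0.
- by rewrite rootE hornerD hornerN hornerXn hornerC subrr.
Qed.

(* If b = y ^ l has no l-th root in k and t ^ l = b modulo Q, then y |-> t and
   y |-> zeta t are two orthogonal evaluations of the order O_k[y] modulo Q. *)
Theorem kummer_prime (k : C -> Prop) (l : nat) (zeta b : C) :
  number_field k -> prime l -> k zeta -> zeta ^+ l = 1 -> zeta != 1 ->
  ring_of_integers k b -> b != 0 ->
  (forall Q : nat, (0 < Q)%N -> exists2 t, ring_of_integers k t &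
     exists2 w, ring_of_integers k w & t ^+ l - b = Q%:R * w) ->
  exists2 y, k y & y ^+ l = b.
Proof.
move=> kP lp kz zl z1 bO b0 hyp; apply: contrapT => none.
have l0 := prime_gt0 lp; pose y := l.-root b.
have yl : y ^+ l = b by exact: rootCK.
have ky : ~ k y by move=> ky; apply: none; exists y.
have [d [e fe eO]] := integral_basis kP.
pose R := in_span e.
have OR : subring_pred R.
  by have [h1 h2 h3] := OK_subring kP; split=> [|x z /eO hx /eO hz|x z /eO hx /eO hz]; apply/eO; auto.
have kR x : R x -> k x by move/eO/(ring_of_integersE k) => [].
have overk A : poly_in R A -> poly_in k A by move=> hA i; apply: kR.
have indep A B : poly_in R A -> poly_in R B -> (size A <= l)%N -> (size B <= l)%N ->
    A.[y] = B.[y] -> A = B.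
  move=> hA hB sA sB AB; apply/eqP; rewrite -subr_eq0; apply/eqP.
  apply: (kummer_indep kP lp kz zl z1 bO b0 yl ky).
  - by apply: (overB (nf_subring kP)); apply: overk.
  - by apply: leq_trans (size_polyD _ _) _; rewrite size_polyN geq_max sA sB.
  - by rewrite rootE hornerD hornerN AB subrr.
have freeR := qfree_zfree fe.
have oneR : R 1 by case: OR.
have mulR i j : R (e i * e j) by apply: (srM OR); exact: in_span_e.
have bR : R b by apply/eO.
pose D := (d * l)%N.
pose E : 'I_D -> C := fun i => mxvec (\matrix_(i < d, j < l) (e i * y ^+ j)) 0 i.
pose poly_of (z : 'rV[int]_D) : {poly C} :=
  \poly_(j < l) (if insub j is Some j' then zspan e (\row_i vec_mx z i j') else 0).
have poly_ofE z : zspan E z = (poly_of z).[y].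
  rewrite horner_poly /zspan (reindex _ (curry_mxvec_bij d l)) /=.
  rewrite (eq_bigr (fun p => (vec_mx z p.1 p.2)%:~R * (e p.1 * y ^+ p.2))); last first.
    by case=> i j _; rewrite /E /= mxvecE !mxE.
  rewrite -(pair_bigA _ (fun i j => (vec_mx z i j)%:~R * (e i * y ^+ j))) /=.
  rewrite exchange_big; apply: eq_bigr => j _ /=.
  rewrite valK /zspan mulr_suml; apply: eq_bigr => i _.
  by rewrite !mxE mulrA.
have poly_ofR z : poly_in R (poly_of z).
  move=> j; rewrite coef_poly; case: ifP => _; last exact: sr0.
  by case: insub => [j'|]; [exists (\row_i vec_mx z i j') | exact: sr0].
have poly_ofs z : (size (poly_of z) <= l)%N by exact: size_poly.
have freeL z : zspan E z = 0 -> z = 0.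
  rewrite poly_ofE => h; have /polyP p0 : poly_of z = 0.
    by apply: indep; rewrite ?size_poly0 ?horner0 //; exact: over0.
  rewrite -[z]vec_mxK; apply/eqP; rewrite mxvec_eq0; apply/eqP/matrixP => i j.
  have := p0 j; rewrite coef_poly ltn_ord valK coef0 => /freeR/rowP/(_ i).
  by rewrite !mxE.
have LE x : in_span E x <-> exists A, [/\ poly_in R A, (size A <= l)%N & x = A.[y]].
  split=> [[z ->]|[A [hA sA ->]]]; first by exists (poly_of z).
  have h (j : 'I_l) : exists z, A`_j = zspan e z by case: (hA j) => z; exists z.
  have [z zP] := fin_choice h; exists (mxvec (\matrix_(i, j) z j 0 i)).
  rewrite poly_ofE; congr horner; apply/polyP => j; rewrite coef_poly.
  case: ltnP => [jl|lj]; last by rewrite nth_default // (leq_trans sA).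
  have /= -> := zP (Ordinal jl); rewrite insubT /=; congr zspan; apply/rowP => i.
  by rewrite [RHS]mxE mxvecK mxE.
have monicX : 'X^l - b%:P \is monic by exact: monicXnsubC.
have red A : poly_in R A -> exists q r, [/\ poly_in R q, poly_in R r, (size r <= l)%N &
    A = q * ('X^l - b%:P) + r].
  move=> hA; have [q [r [hq hr sr E']]] := over_divmod OR monicX (over_XnsubC OR l bR) hA.
  by exists q, r; split => //; rewrite -ltnS -(size_XnsubC b l0).
have yroot : ('X^l - b%:P).[y] = 0 by rewrite hornerD hornerN hornerXn hornerC yl subrr.
have LP A : poly_in R A -> in_span E A.[y].
  move=> /red[q [r [hq hr sr ->]]]; apply/LE; exists r; split => //.
  by rewrite hornerD hornerM yroot mulr0 add0r.
have RL x : R x -> in_span E x.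
  by move=> hx; rewrite -[x](hornerC x y); apply: LP; apply: overC.
have oneL : in_span E 1 by apply: RL.
have LM x z : in_span E x -> in_span E z -> in_span E (x * z).
  move=> /LE[A [hA _ ->]] /LE[B [hB _ ->]]; rewrite -hornerM; apply: LP.
  exact: overM.
have mulL i j : in_span E (E i * E j) by apply: LM; exact: in_span_e.
pose beta := (1 - zeta) * b.
have zR : R zeta.
  apply/eO/(OK_root kP l0 kz); rewrite zl; by case: (OK_subring kP).
have betaR : R beta by apply: (srM OR) => //; apply: (srB OR).
have beta0 : beta != 0 by rewrite mulf_neq0 // subr_eq0 eq_sym.
apply: (no_orthogonal_evaluations freeR oneR mulR freeL oneL mulL RL erefl l0 betaR beta0).
move=> Q Q0; have [t /eO tR [w /eO wR tE]] := hyp Q Q0.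
(* The unique polynomial of degree below l over O_k that represents x; an evaluation substitutes a
   root modulo Q for y in it. *)
have cfH x : exists A, in_span E x -> [/\ poly_in R A, (size A <= l)%N & x = A.[y]].
  case: (pselect (in_span E x)) => [/LE[A hA]|nx]; last by exists 0.
  by exists A.
have [cf cfP] := choice cfH.
have cfE A : poly_in R A -> (size A <= l)%N -> cf A.[y] = A.
  move=> hA sA; have [|h1 h2 h3] := cfP A.[y]; first by apply/LE; exists A.
  exact: indep.
have evP s w' : R s -> R w' -> s ^+ l - b = Q%:R * w' ->
    evaluation e E Q%:R (fun x => (cf x).[s]).
  move=> sR w'R sE; split.
  - by move=> a /cfP[h _ _]; apply: over_horner.
  - move=> a a' /cfP[h1 h2 h3] /cfP[h1' h2' h3'].
    rewrite {1}h3 {1}h3' -hornerD cfE ?hornerD; first exact: cong_refl.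
      exact: overD.
    by apply: leq_trans (size_polyD _ _) _; rewrite geq_max h2 h2'.
  - move=> a a' /cfP[h1 h2 h3] /cfP[h1' h2' h3'].
    have [q [r [hq hr sr E']]] := red _ (overM OR h1 h1').
    have -> : cf (a * a') = r.
      rewrite {1}h3 {1}h3' -hornerM E' hornerD hornerM yroot mulr0 add0r; exact: cfE.
    exists (- (q.[s] * w')).
      by apply: (srN OR); apply: (srM OR) => //; apply: over_horner.
    rewrite -hornerM E' hornerD hornerM hornerD hornerN hornerXn hornerC sE; ring.
  - move=> r rR; rewrite -{1}[r](hornerC r y) cfE; first by rewrite hornerC; exact: cong_refl.
      exact: overC.
    by rewrite size_polyC (leq_trans (leq_b1 _)).
have l2 := prime_gt1 lp.
have zt : (zeta * t) ^+ l - b = Q%:R * w by rewrite exprMn zl mul1r.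
have ztR : R (zeta * t) by apply: (srM OR).
exists (fun x => (cf x).[t]), (fun x => (cf x).[zeta * t]).
(* A1 vanishes at zeta * t and equals (1 - zeta) * t ^+ l at t, which is beta modulo Q; for A2 the
   two points are exchanged. This is the origin of beta. *)
pose A1 : {poly C} := t ^+ l.-1 *: ('X - (zeta * t)%:P).
pose A2 : {poly C} := t ^+ l.-1 *: (t%:P - 'X).
have hA1 : poly_in R A1.
  by apply: overZ => //; [exact: srX | apply: overB => //; [exact: overX | exact: overC]].
have hA2 : poly_in R A2.
  by apply: overZ => //; [exact: srX | apply: overB => //; [exact: overC | exact: overX]].
have sA1 : (size A1 <= l)%N.
  by apply: leq_trans (size_scale_leq _ _) _; rewrite size_XsubC.
have sA2 : (size A2 <= l)%N.
  apply: leq_trans (size_scale_leq _ _) _.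
  by rewrite -opprB size_polyN size_XsubC.
exists A1.[y], A2.[y]; split; first by split; [exact: evP tE | exact: evP zt | exact: LP | exact: LP].
have tl : t ^+ l = b + Q%:R * w by rewrite -tE addrC subrK.
have tll : t ^+ l.-1 * t = t ^+ l by rewrite -exprSr prednK.
rewrite !cfE //; split; rewrite /A1 /A2 !hornerE.
- exists ((1 - zeta) * w); first by apply: (srM OR) => //; apply: (srB OR).
  have -> : t ^+ l.-1 * (t - zeta * t) = (1 - zeta) * (t ^+ l.-1 * t) by ring.
  by rewrite tll tl /beta; ring.
- by rewrite subrr mulr0; exact: cong_refl.
- by rewrite subrr mulr0; exact: cong_refl.
- exists ((1 - zeta) * w); first by apply: (srM OR) => //; apply: (srB OR).
  have -> : t ^+ l.-1 * (t - zeta * t) = (1 - zeta) * (t ^+ l.-1 * t) by ring.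
  by rewrite tll tl /beta; ring.
Qed.

Lemma root_of_unity_sum (F : fieldType) l (x : F) :
  x ^+ l = 1 -> \sum_(r < l) x ^+ r = if x == 1 then l%:R else 0.
Proof.
move=> xl; case: eqP => [->|/eqP x1].
  by under eq_bigr do rewrite expr1n; rewrite sumr_const card_ord.
apply/eqP; have := subrX1 x l; rewrite xl subrr => /esym/eqP.
by rewrite mulf_eq0 subr_eq0 (negPf x1).
Qed.

Lemma cong_sum (F : numFieldType) d (e : 'I_d -> F) (I : Type) (r : seq I) x (f g : I -> F) :
  (forall i, cong e x (f i) (g i)) -> cong e x (\sum_(i <- r) f i) (\sum_(i <- r) g i).
Proof.
move=> fg; elim/big_ind2: _ => //; first exact: cong_refl.
by move=> *; apply: congD.
Qed.

(** * Approximate roots of unity modulo Q *)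

Section SplitRoots.
Variables (d : nat) (e : 'I_d -> C).
Hypothesis RR : subring_pred (in_span e).
Notation R := (in_span e).
Variables (l : nat) (eta : C) (m : nat) (Q s nu : C).
Hypothesis etaP : (l.+1 * m).-primitive_root eta.
Hypotheses (etaR : R eta) (sR : R s) (nuR : R nu) (etaR' : R eta^-1).
Hypothesis snu : cong e Q (s ^+ l.+1) (nu ^+ l.+1).

Let mulR i j : R (e i * e j). Proof. by apply: (srM RR); exact: in_span_e. Qed.
Let z := eta ^+ m.
Let zl : z ^+ l.+1 = 1.
Proof. by rewrite /z -exprM mulnC (prim_expr_order etaP). Qed.
Let z0 : z != 0.
Proof. by rewrite expf_neq0 // (prim_root_eq0 etaP) -lt0n (prim_order_gt0 etaP). Qed.
Let zprim : l.+1.-primitive_root z.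
Proof.
have := exp_prim_root etaP m; rewrite (gcdn_idPl (dvdn_mull _ (dvdnn m))) mulnK //.
by have := prim_order_gt0 etaP; rewrite muln_gt0.
Qed.
Let zR : R z. Proof. exact: (srX RR). Qed.
Let zR' : R z^-1. Proof. by rewrite /z -exprVn; exact: (srX RR). Qed.

(** A discrete Fourier transform: up to the factor lam, the projector to the part where s = z ^- i *
    nu. As R / Q is not a domain, s ^+ l.+1 = nu ^+ l.+1 in it does not make s one of these
    products; it only splits the ring, after inverting lam, into parts on which it is. *)
Definition eigenprojector (i : nat) : C := \sum_(j < l.+1) z ^+ (i * j) * s ^+ j * nu ^+ (l - j).
Notation eps := eigenprojector.
Notation lam := (l.+1%:R * nu ^+ l).

Lemma eigenprojector_in i : R (eps i).
Proof.
by apply: (sr_sum RR) => j _; apply: (srM RR); [apply: (srM RR)|]; apply: (srX RR).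
Qed.
Let epsR := eigenprojector_in.

Let eps_eigen i : cong e Q (z ^+ i * s * eps i) (nu * eps i).
Proof.
have -> : z ^+ i * s * eps i =
    s ^+ l.+1 + \sum_(j < l) z ^+ (i * j.+1) * s ^+ j.+1 * nu ^+ (l - j).
  rewrite /eps mulr_sumr big_ord_recr /= addrC subnn expr0 mulr1; congr (_ + _).
    rewrite mulrACA -exprD -exprS -mulnS mulnC exprM zl expr1n mul1r //.
  apply: eq_bigr => j _; rewrite mulnS exprD (exprS s); ring.
have -> : nu * eps i =
    nu ^+ l.+1 + \sum_(j < l) z ^+ (i * j.+1) * s ^+ j.+1 * nu ^+ (l - j).
  rewrite /eps mulr_sumr big_ord_recl /= muln0 subn0 expr0 !mul1r -exprS; congr (_ + _).
  apply: eq_bigr => j _; rewrite mulrCA -exprS /bump /= add1n subnSK //.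
by apply: congD => //; exact: cong_refl.
Qed.

Let eps_power i r : cong e Q (s ^+ r * eps i) ((z ^+ i)^-1 ^+ r * nu ^+ r * eps i).
Proof.
have zi0 : z ^+ i != 0 by rewrite expf_neq0.
have ziR : R (z ^+ i)^-1 by rewrite -exprVn; exact: (srX RR).
elim: r => [|r IH]; first by rewrite !expr0 !mul1r; exact: cong_refl.
have -> : s ^+ r.+1 * eps i = s * (s ^+ r * eps i) by rewrite exprS mulrA.
apply: cong_trans (congMl mulR sR IH) _.
have -> : s * ((z ^+ i)^-1 ^+ r * nu ^+ r * eps i) =
    ((z ^+ i)^-1 ^+ r.+1 * nu ^+ r) * (z ^+ i * s * eps i).
  by rewrite exprS; field.
have -> : (z ^+ i)^-1 ^+ r.+1 * nu ^+ r.+1 * eps i =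
    ((z ^+ i)^-1 ^+ r.+1 * nu ^+ r) * (nu * eps i) by rewrite (exprS nu); ring.
by apply: (congMl mulR) => //; apply: (srM RR); apply: (srX RR).
Qed.

Let eps_mul (i j : 'I_l.+1) : cong e Q (eps j * eps i) (if j == i then lam * eps i else 0).
Proof.
have -> : (if j == i then lam * eps i else 0) =
    \sum_(r < l.+1) z ^+ (j * r) * nu ^+ (l - r) * ((z ^+ i)^-1 ^+ r * nu ^+ r * eps i).
  transitivity (nu ^+ l * eps i * \sum_(r < l.+1) (z ^+ j / z ^+ i) ^+ r).
    rewrite root_of_unity_sum; last first.
      by rewrite exprMn exprVn -!exprM ![(_ * l.+1)%N]mulnC !exprM zl !expr1n divr1.
    have zi0 : z ^+ i != 0 by rewrite expf_neq0.
    rewrite -(inj_eq (mulIf zi0)) divfK // mul1r (eq_prim_root_expr zprim).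
    rewrite !modn_small ?ltn_ord // (inj_eq val_inj).
    by case: eqP => _; rewrite ?mulr0 //; ring.
  rewrite mulr_sumr; apply: eq_bigr => r _.
  have -> : nu ^+ l = nu ^+ (l - r) * nu ^+ r by rewrite -exprD subnK // -ltnS.
  by rewrite exprMn -exprM; ring.
rewrite {1}/eps mulr_suml; apply: cong_sum => r.
have -> : z ^+ (j * r) * s ^+ r * nu ^+ (l - r) * eps i =
   z ^+ (j * r) * nu ^+ (l - r) * (s ^+ r * eps i) by ring.
by apply: (congMl mulR) (eps_power _ _); apply: (srM RR); apply: (srX RR).
Qed.

Lemma eigenprojector_sum : \sum_(i < l.+1) eps i = lam.
Proof.
rewrite /eps exchange_big big_ord_recl /= [X in _ + X]big1 ?addr0 => [|j _].
  under eq_bigr do rewrite muln0 expr0 !mul1r subn0.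
  by rewrite sumr_const card_ord mulr_natl.
rewrite -!mulr_suml; under eq_bigr do rewrite mulnC exprM.
rewrite root_of_unity_sum; last by rewrite -exprM mulnC exprM zl expr1n.
rewrite -(prim_order_dvd zprim) gtnNdvd ?mul0r //=.
by rewrite /bump /= add1n ltnS.
Qed.

(** The projectors are orthogonal up to the factor lam, so a power of the sum is the sum of the
    powers, and each multiplication costs one factor lam. *)
Lemma eigenprojector_power r :
  cong e Q ((\sum_(i < l.+1) eps i * eta ^+ i) ^+ r.+1)
    (lam ^+ r * \sum_(i < l.+1) eps i * eta ^+ (i * r.+1)).
Proof.
have lamR : R lam by apply: (srM RR); [exact: (in_span_nat (sr1 RR)) | exact: (srX RR)].
elim: r => [|r IH]; first by rewrite expr1 expr0 mul1r; under [in X in cong _ _ _ X]eq_bigr do rewrite muln1; exact: cong_refl.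
have XR : R (\sum_(i < l.+1) eps i * eta ^+ i).
  by apply: (sr_sum RR) => i _; apply: (srM RR) => //; apply: (srX RR).
rewrite exprS; apply: cong_trans (congMl mulR XR IH) _.
rewrite mulrCA (exprS lam) [lam * _]mulrC -mulrA.
apply: (congMl mulR); first exact: (srX RR).
rewrite !mulr_sumr; apply: cong_sum => i; rewrite mulr_suml.
have -> : lam * (eps i * eta ^+ (i * r.+2)) =
    \sum_(j < l.+1) eta ^+ j * eta ^+ (i * r.+1) * (if j == i then lam * eps i else 0).
  rewrite (bigD1 i) //= eqxx big1 ?addr0 => [|j /negPf ->]; last by rewrite mulr0.
  by rewrite -exprD -mulnS; ring.
apply: cong_sum => j.
have -> : eps j * eta ^+ j * (eps i * eta ^+ (i * r.+1)) =
  eta ^+ j * eta ^+ (i * r.+1) * (eps j * eps i) by ring.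
by apply: (congMl mulR) (eps_mul _ _); apply: (srM RR); apply: (srX RR).
Qed.

(* If T is b0 times an (l+1)-th root of unity s (up to the scaling nu), then T
   times the m-th power of a suitable element is b0 times an m-th power. *)
Lemma eigenprojector_root b0 t : (0 < m)%N -> R b0 -> R t -> t ^+ m = b0 * s ->
  exists2 t', R t' & cong e Q (t' ^+ m) (b0 * (lam ^+ m * nu)).
Proof.
move=> m0 b0R tR tE; have lamR : R lam.
  by apply: (srM RR); [exact: (in_span_nat (sr1 RR)) | exact: (srX RR)].
exists (t * \sum_(i < l.+1) eps i * eta ^+ i).
  apply: (srM RR) => //; apply: (sr_sum RR) => i _.
  by apply: (srM RR) => //; apply: (srX RR).
rewrite exprMn tE -{1 2}(prednK m0).
apply: cong_trans (congMl mulR (srM RR b0R sR) (eigenprojector_power m.-1)) _.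
rewrite (prednK m0).
have -> : b0 * s * (lam ^+ m.-1 * \sum_(i < l.+1) eps i * eta ^+ (i * m)) =
    b0 * lam ^+ m.-1 * \sum_(i < l.+1) z ^+ i * s * eps i.
  have <- : s * \sum_(i < l.+1) eps i * eta ^+ (i * m) = \sum_(i < l.+1) z ^+ i * s * eps i.
    by rewrite mulr_sumr; apply: eq_bigr => i _; rewrite mulnC exprM -/z; ring.
  by ring.
have -> : b0 * (lam ^+ m * nu) = b0 * lam ^+ m.-1 * \sum_(i < l.+1) nu * eps i.
  by rewrite -mulr_sumr eigenprojector_sum -[in LHS](prednK m0) exprSr; ring.
apply: (congMl mulR); first by apply: (srM RR) => //; apply: (srX RR).
exact: cong_sum.
Qed.

End SplitRoots.

Definition unit_of (k : C -> Prop) (u : C) : Prop :=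
  [/\ u != 0, ring_of_integers k u & ring_of_integers k u^-1].

(* Induction on M = l * m with l prime: kummer_prime gives an l-th root of u, and
   the eigenprojector turns t into an approximate m-th root of it. *)
Theorem kummer_power (k : C -> Prop) (M : nat) (zeta u : C) (N : nat) :
  number_field k -> M.-primitive_root zeta -> k zeta -> unit_of k u -> (0 < N)%N ->
  (forall Q : nat, (0 < Q)%N -> exists2 t, ring_of_integers k t &
     exists2 w, ring_of_integers k w & t ^+ M - N%:R ^+ M * u = Q%:R * w) ->
  exists2 y, k y & y ^+ M = u.
Proof.
move=> kP; have OR := OK_subring kP.
elim/ltn_ind: M zeta u N => M IH zeta u N zP kz [u0 uO uO'] N0 hyp.
have M0 := prim_order_gt0 zP.
have ku : k u by case/(ring_of_integersE k): uO.
case: (ltngtP M 1) => [|M1|M1]; first by rewrite ltnNge M0.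
  2: by exists u; rewrite // M1 expr1.
have [l lp /dvdnP[m ME]] : exists2 l, prime l & (l %| M)%N.
  by exists (pdiv M); [apply: pdiv_prime | apply: pdiv_dvd].
have l0 := prime_gt0 lp.
have m0 : (0 < m)%N by move: M0; rewrite ME muln_gt0 => /andP[].
have Nc0 : N%:R != 0 :> C by rewrite pnatr_eq0 -lt0n.
have ON : ring_of_integers k N%:R.
  by apply/(ring_of_integersE k); split; [apply: nf_nat | apply: aint_nat].
have OX x n : ring_of_integers k x -> ring_of_integers k (x ^+ n) by apply: srX.
have [||||||beta kbeta betaE] := @kummer_prime k l (zeta ^+ m) (N%:R ^+ M * u) kP lp.
- exact: (nfX kP).
- by rewrite -exprM -ME (prim_expr_order zP).
- rewrite -(expr0 zeta) (eq_prim_root_expr zP) mod0n modn_small -?lt0n // ME.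
  by rewrite ltn_Pmulr // prime_gt1.
- by apply: (srM OR) => //; apply: OX.
- by rewrite mulf_neq0 // expf_neq0.
- move=> Q /hyp[t tO [w wO tE]]; exists (t ^+ m); first exact: OX.
  by exists w; rewrite // -exprM -ME.
pose nu : C := N%:R ^+ m; pose b := beta / nu.
have nu0 : nu != 0 by rewrite expf_neq0.
have nuO : ring_of_integers k nu by apply: OX.
have kb : k b by apply: (nfM kP) => //; apply: (nfV kP); apply: (nfX kP); apply: nf_nat.
have bl : b ^+ l = u by rewrite exprMn betaE exprVn /nu -exprM -ME mulrAC divff ?mul1r // expf_neq0.
have bO : ring_of_integers k b by apply: (OK_root kP l0 kb); rewrite bl.
have bO' : ring_of_integers k b^-1.
  by apply: (OK_root kP l0 (nfV kP kb)); rewrite exprVn bl.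
have b0 : b != 0 by apply: contraNneq u0 => b0; rewrite -bl b0 expr0n eqn0Ngt l0.
have [d [e fe eO]] := integral_basis kP.
have RR : subring_pred (in_span e).
  by case: OR => h1 h2 h3; split=> [|x z /eO hx /eO hz|x z /eO hx /eO hz]; apply/eO; auto.
have lS : l.-1.+1 = l by rewrite prednK.
pose eta := zeta^-1.
have etaP : (l.-1.+1 * m).-primitive_root eta.
  rewrite lS mulnC -ME /eta; have -> : zeta^-1 = zeta ^+ M.-1.
    apply: (mulIf (_ : zeta != 0)); first by rewrite (prim_root_eq0 zP) -lt0n.
    by rewrite mulVf -?exprSr ?prednK ?(prim_expr_order zP) // (prim_root_eq0 zP) -lt0n.
  by rewrite prim_root_exp_coprime // coprimePn.
have zO : ring_of_integers k zeta.
  by apply: (OK_root kP M0 kz); rewrite (prim_expr_order zP); exact: sr1.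
have etaO : ring_of_integers k eta.
  apply: (OK_root kP M0 (nfV kP kz)); rewrite exprVn (prim_expr_order zP) invr1; exact: sr1.
have [y ky yE] : exists2 y, k y & y ^+ m = b.
  (* With nu = N ^ m and lam = l * nu ^ (l - 1), the new N is chosen so that its m-th power is lam ^
     m * nu. The statement allows a general N in order to absorb this factor. *)
  apply: (IH m _ (zeta ^+ l) b (l * N ^ (m * l.-1) * N)%N) => //.
  - by rewrite ME ltn_Pmulr // prime_gt1.
  - have -> : l = (M %/ m)%N by rewrite ME mulKn.
    by apply: dvdn_prim_root; rewrite // ME dvdn_mulr.
  - exact: (nfX kP).
  - by rewrite !muln_gt0 l0 expn_gt0 N0.
  move=> Q /hyp[t tO [w wO tE]].
  pose s := t ^+ m / b.
  have sO : ring_of_integers k s by apply: (srM OR) => //; apply: OX.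
  have snu : cong e Q%:R (s ^+ l.-1.+1) (nu ^+ l.-1.+1).
    exists (w / u); first by apply/eO; apply: (srM OR).
    rewrite lS exprMn -exprM -ME exprVn bl /nu -exprM -ME mulrA -tE mulrBl mulfK //.
  have eR : in_span e eta by apply/eO.
  have eR' : in_span e eta^-1 by apply/eO; rewrite invrK.
  have sR : in_span e s by apply/eO.
  have nR : in_span e nu by apply/eO.
  have bR : in_span e b by apply/eO.
  have tR : in_span e t by apply/eO.
  have tb : t ^+ m = b * s by rewrite mulrC divfK.
  have [t' /eO t'O] := eigenprojector_root RR etaP eR sR nR eR' snu m0 bR tR tb.
  case=> v /eO vO vE; exists t' => //; exists v => //.
  rewrite -vE; congr (_ - _); rewrite mulrC lS /nu; congr (_ * _).
  by rewrite !natrM natrX !exprMn -!exprM; ring.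
by exists y; rewrite // ME exprM yE bl.
Qed.

Lemma over_comp k A B : subring_pred k -> poly_in k A -> poly_in k B -> poly_in k (A \Po B).
Proof.
move=> kR hA hB; rewrite comp_polyE => j; rewrite coef_sum.
apply: (sr_sum kR) => i _; rewrite coefZ; apply: (srM kR) => //.
elim: (i : nat) j => [|n IH] j; first by rewrite expr0 -polyC1; apply: (overC kR); exact: sr1.
by rewrite exprS; apply: overM.
Qed.

Lemma over_exp k A n : subring_pred k -> poly_in k A -> poly_in k (A ^+ n).
Proof.
move=> kR hA; rewrite -[_ ^+ n]comp_Xn_poly; apply: over_comp => //; exact: overXn.
Qed.

(* Galois theory of k(zeta) over k, phrased through the exponents s for which
   zeta ^+ s is conjugate to zeta. *)
Section Cyclotomic.
Variables (k : C -> Prop) (M : nat) (zeta : C).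
Hypotheses (kP : number_field k) (zP : M.-primitive_root zeta).
Let kR := nf_subring kP.

Definition conjugate_exponent (s : nat) : Prop :=
  forall A, poly_in k A -> root A zeta -> root A (zeta ^+ s).

(** Reduced modulo the minimal polynomial of zeta, P takes the value P.[zeta] at all conjugates,
    which are distinct and more numerous than the degree of the remainder. The remainder is
    therefore constant. *)
Lemma constant_on_conjugates P : poly_in k P ->
  (forall s, (0 < s)%N -> conjugate_exponent s -> P.[zeta ^+ s] = P.[zeta]) -> k P.[zeta].
Proof.
move=> hP const; have M0 := prim_order_gt0 zP.
have hX : poly_in k ('X^M - 1%:P) by apply: over_XnsubC => //; exact: sr1.
have zX : root ('X^M - 1%:P) zeta.
  by rewrite rootE hornerD hornerN hornerC hornerXn (prim_expr_order zP) subrr.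
have X0 : 'X^M - 1%:P != 0 :> {poly C} by rewrite -size_poly_eq0 size_XnsubC.
have [|g [gm hg gz gdvd]] := @nf_minpoly k zeta kP; first by exists ('X^M - 1%:P).
have [B hB BE] := gdvd _ hX zX.
have [rs gE] := closed_field_poly_normal g.
move: gE; rewrite (monicP gm) scale1r => gE.
have urs : uniq rs.
  rewrite -separable_prod_XsubC -gE.
  apply: (dvdp_separable (_ : g %| 'X^M - 1%:P)); first by rewrite BE dvdp_mull.
  by rewrite polyC1; apply: separable_Xn_sub_1; apply: prim_root_natf_neq0 zP.
have sg : size g = (size rs).+1 by rewrite gE size_prod_XsubC.
have [q [r [hq hr sr PE]]] := over_divmod kR gm hg hP.
have Pr x : root g x -> P.[x] = r.[x].
  by move=> gx; rewrite PE hornerD hornerM (eqP gx) mulr0 add0r.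
have conj x : root g x -> exists2 s, (0 < s)%N & x = zeta ^+ s /\ conjugate_exponent s.
  move=> gx; have : x ^+ M = 1.
    have /eqP : ('X^M - 1%:P).[x] == 0 by rewrite BE hornerM (eqP gx) mulr0.
    by rewrite hornerD hornerN hornerC hornerXn => /eqP; rewrite subr_eq0 => /eqP.
  (* Adding M keeps the exponent positive when i = 0. *)
  case/(prim_rootP zP) => i xi; exists (i + M)%N; first by rewrite addn_gt0 M0 orbT.
  have xE : x = zeta ^+ (i + M) by rewrite exprD (prim_expr_order zP) mulr1.
  split => // A hA Az; have [A' hA' ->] := gdvd _ hA Az.
  by rewrite -xE rootM gx orbT.
suff rE : r = (P.[zeta])%:P by have := hr 0%N; rewrite rE coefC.
apply/eqP; rewrite -subr_eq0; apply/negPn/negP => n0.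
have := max_poly_roots n0 _ urs.
have -> : all (root (r - (P.[zeta])%:P)) rs.
  apply/allP => x; rewrite -root_prod_XsubC -gE => gx.
  rewrite rootE hornerD hornerN hornerC -Pr //.
  have [s s0 [xE hs]] := conj _ gx.
  by rewrite xE const // subrr.
move/(_ isT); apply/negP; rewrite -leqNgt -ltnS -sg.
apply: leq_ltn_trans (size_polyD _ _) _.
rewrite size_polyN gtn_max sr size_polyC (leq_ltn_trans (leq_b1 _)) //.
rewrite sg ltnS -has_predT; apply/hasP; exists zeta => //.
by rewrite -root_prod_XsubC -gE.
Qed.

(* Schinzel's argument: if c is an M-th power in k(zeta), the quotients
   y ^+ s / sigma_s y lie in k, so c ^+ s / c is an M-th power in k. *)
Theorem schinzel (c : C) (Y : {poly C}) (W : nat) :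
  k c -> c != 0 -> poly_in k Y -> Y.[zeta] ^+ M = c ->
  (forall w omega, w.-primitive_root omega -> k omega -> w %| W)%N ->
  exists2 z, k z & z ^+ M = c ^+ W.
Proof.
move=> kc c0 hY yM WP; have M0 := prim_order_gt0 zP.
pose y := Y.[zeta].
have y0 : y != 0 by apply: contraNneq c0 => y0; rewrite -yM -/y y0 expr0n eqn0Ngt M0.
have sY s : conjugate_exponent s -> Y.[zeta ^+ s] ^+ M = c.
  move=> /(_ (Y ^+ M - c%:P)); rewrite !rootE !hornerD !hornerN !hornerC !horner_exp.
  rewrite yM subrr eqxx => h; apply/eqP; rewrite -subr_eq0; apply: h => //.
  by apply: overB => //; [apply: over_exp | apply: overC].
have exA s : conjugate_exponent s -> exists a, Y.[zeta ^+ s] = zeta ^+ a * y.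
  move=> hs; have : (Y.[zeta ^+ s] / y) ^+ M = 1.
    by rewrite exprMn exprVn sY // yM divff.
  by case/(prim_rootP zP) => i E; exists i; rewrite -E divfK.
have hXn n : poly_in k 'X^n by apply: overXn.
have quot s : (0 < s)%N -> conjugate_exponent s -> exists2 z, k z & z ^+ M * c = c ^+ s.
  move=> s0 hs; have [a aE] := exA s hs.
  (* Composition with 'X^s represents sigma_s y, whose M-th power is c. So the value of Z at zeta is
     c * y ^+ s / sigma_s y, written without division. *)
  pose Z := Y ^+ s * (Y \Po 'X^s) ^+ M.-1.
  have hZ : poly_in k Z.
    by apply: overM => //; apply: over_exp => //; apply: over_comp.
  have kZ : k Z.[zeta].
    apply: constant_on_conjugates => // r r0 hr.
    have [a' aE'] := exA r hr.
    have comm : Y.[(zeta ^+ s) ^+ r] = (zeta ^+ s) ^+ a' * Y.[zeta ^+ s].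
      have := hs (Y \Po 'X^r - 'X^a' * Y).
      rewrite !rootE !hornerD !hornerN !hornerM !horner_comp !hornerXn -/y aE' subrr eqxx.
      move=> h; apply/eqP; rewrite -subr_eq0; apply: h => //.
      by apply: overB => //; [apply: over_comp | apply: overM].
    pose x := zeta ^+ (s * a').
    have xM : x * x ^+ M.-1 = 1.
      by rewrite -exprS prednK // /x -exprM mulnC exprM (prim_expr_order zP) expr1n.
    rewrite !hornerM !horner_exp !horner_comp !hornerXn exprAC comm aE' aE.
    rewrite -exprM -/x !exprMn -[X in X * _ * _]exprM mulnC -/x.
    transitivity (x * x ^+ M.-1 * (y ^+ s * ((zeta ^+ a) ^+ M.-1 * y ^+ M.-1))); first by ring.
    by rewrite xM mul1r.
  exists (Z.[zeta] / c); first by apply: (nfM kP) => //; apply: (nfV kP).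
  rewrite hornerM !horner_exp horner_comp hornerXn -/y.
  have -> : (y ^+ s * Y.[zeta ^+ s] ^+ M.-1 / c) ^+ M =
      (y ^+ M) ^+ s * (Y.[zeta ^+ s] ^+ M) ^+ M.-1 / c ^+ M.
    by rewrite !exprMn exprVn -!exprM (mulnC s) (mulnC M.-1).
  have cM : c ^+ M = c ^+ M.-1 * c by rewrite -exprSr prednK.
  rewrite yM sY // cM; field.
  by rewrite c0 expf_neq0.
(* The least such exponent w is the order of c modulo M-th powers of k. It divides M and s - 1 for
   each conjugate exponent s, so zeta ^+ (M %/ w) is fixed by all conjugations and lies in k; hence
   w divides W. *)
pose P j := (0 < j)%N /\ exists2 z, k z & z ^+ M = c ^+ j.
have PM : P M by split => //; exists c.
have [|w [w0 [z kz zE]] min] := @minimal_witness _ P id; first by exists M.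
have dvd j : (exists2 z, k z & z ^+ M = c ^+ j) -> (w %| j)%N.
  move=> [x kx xE]; rewrite /dvdn; apply/negPn/negP; rewrite -lt0n => r0.
  suff /min : P (j %% w)%N by rewrite leqNgt ltn_mod w0.
  split => //; exists (x / z ^+ (j %/ w)).
    by apply: (nfM kP) => //; apply: (nfV kP); apply: (nfX kP).
  rewrite exprMn xE exprVn -exprM mulnC exprM zE {1}(divn_eq j w) exprD -exprM mulnC.
  by rewrite (mulnC w) [_ * c ^+ (j %% w)]mulrC mulfK ?expf_neq0.
have wM : (w %| M)%N by apply: dvd; exists c.
have kom : k (zeta ^+ (M %/ w)).
  have -> : zeta ^+ (M %/ w) = ('X^(M %/ w)).[zeta] by rewrite hornerXn.
  apply: constant_on_conjugates => // s s0 hs; rewrite !hornerXn.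
  have [x kx xE] := quot s s0 hs.
  have /dvdnP[t st] : (w %| s.-1)%N.
    apply: dvd; exists x => //; apply: (mulIf c0).
    by rewrite xE -exprSr prednK.
  rewrite -exprM -{1}(prednK s0) st mulSn exprD -mulnA (mulnC w) divnK //.
  by rewrite mulnC exprM (prim_expr_order zP) expr1n mulr1.
have /dvdnP[t ->] := WP w _ (dvdn_prim_root zP wM) kom.
by exists (z ^+ t); [apply: (nfX kP) | rewrite exprAC zE -exprM mulnC].
Qed.
End Cyclotomic.

(** * Simultaneous triangularization *)

Section Regular.
Variable n : nat.
Implicit Types A : 'M[C]_n.

(** Membership of the restriction of f to GL(n) in the coordinate ring C[x_ij, 1/det]. *)
Definition regular (f : 'M[C]_n -> C) : Prop :=
  exists N (q : mxpolyC n), forall A, GLC A -> mxev q A = \det A ^+ N * f A.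

Definition generic_matrix : 'M[mxpolyC n]_n := \matrix_(i, j) 'X_(mxvec_index i j).

Lemma mxev_generic A : map_mx (fun p => mxev p A) generic_matrix = A.
Proof. by apply/matrixP => i j; rewrite !mxE /mxev mevalXU mxvecE. Qed.

Lemma mxev_det A : mxev (\det generic_matrix) A = \det A.
Proof. by rewrite -[in RHS](mxev_generic A) /mxev det_map_mx. Qed.

Lemma regular_const c : regular (fun=> c).
Proof. by exists 0, c%:MP => A _; rewrite /mxev mevalC expr0 mul1r. Qed.

Lemma regular_ext f g : (forall A, GLC A -> f A = g A) -> regular f -> regular g.
Proof. by move=> fg [N [q qP]]; exists N, q => A hA; rewrite -fg // qP. Qed.

Lemma regularD f g : regular f -> regular g -> regular (fun A => f A + g A).
Proof.
move=> [N [q qP]] [N' [q' qP']]; exists (N + N')%N.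
exists (q * (\det generic_matrix) ^+ N' + q' * (\det generic_matrix) ^+ N) => A hA.
have := qP A hA; have := qP' A hA; have := mxev_det A; rewrite /mxev => hd h' h.
by rewrite mevalD !mevalM !rmorphXn /= hd h h' exprD; ring.
Qed.

Lemma regularM f g : regular f -> regular g -> regular (fun A => f A * g A).
Proof.
move=> [N [q qP]] [N' [q' qP']]; exists (N + N')%N, (q * q') => A hA.
have := qP A hA; have := qP' A hA; rewrite /mxev => h' h.
by rewrite mevalM h h' exprD; ring.
Qed.

Lemma regularX f m : regular f -> regular (fun A => f A ^+ m).
Proof.
move=> hf; elim: m => [|m IH]; first exact: (regular_ext _ (regular_const 1)).
by apply: regular_ext (regularM hf IH) => A _; rewrite exprS.
Qed.

Lemma regular_sum (I : Type) (r : seq I) (F : I -> 'M[C]_n -> C) :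
  (forall i, regular (F i)) -> regular (fun A => \sum_(i <- r) F i A).
Proof.
move=> hF; elim: r => [|i r IH].
  by apply: regular_ext (regular_const 0) => A _; rewrite big_nil.
by apply: regular_ext (regularD (hF i) IH) => A _; rewrite big_cons.
Qed.

Lemma regular_prod (I : Type) (r : seq I) (F : I -> 'M[C]_n -> C) :
  (forall i, regular (F i)) -> regular (fun A => \prod_(i <- r) F i A).
Proof.
move=> hF; elim: r => [|i r IH].
  by apply: regular_ext (regular_const 1) => A _; rewrite big_nil.
by apply: regular_ext (regularM (hF i) IH) => A _; rewrite big_cons.
Qed.

Definition mregular p q (F : 'M[C]_n -> 'M[C]_(p, q)) : Prop :=
  forall i j, regular (fun A => F A i j).

Lemma mregular_const p q (M : 'M[C]_(p, q)) : mregular (fun=> M).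
Proof. by move=> i j; exact: regular_const. Qed.

Lemma mregular_id : mregular id.
Proof.
move=> i j; exists 0, 'X_(mxvec_index i j) => A _.
by rewrite /mxev mevalXU mxvecE expr0 mul1r.
Qed.

Lemma mregular_inv : mregular (@invmx C n).
Proof.
move=> i j; exists 1, ((\adj generic_matrix) i j) => A hA.
have d0 : \det A != 0 by rewrite -unitfE -unitmxE.
have -> : \det A ^+ 1 * invmx A i j = (\adj A) i j.
  by rewrite /invmx [A \in unitmx]hA -[X in _ = X](mulVKf d0) expr1 mxE.
by rewrite -[in RHS](mxev_generic A) /mxev -map_mx_adj [RHS]mxE.
Qed.

Lemma mregularM p q r (F : 'M[C]_n -> 'M[C]_(p, q)) (G : 'M[C]_n -> 'M[C]_(q, r)) :
  mregular F -> mregular G -> mregular (fun A => F A *m G A).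
Proof.
move=> hF hG i j; apply: (@regular_ext (fun A => \sum_k F A i k * G A k j)).
  by move=> A _; rewrite mxE.
by apply: regular_sum => k; apply: regularM.
Qed.

Lemma mregular_linear p q p' q' (F : 'M[C]_n -> 'M[C]_(p, q))
    (T : {linear 'M[C]_(p, q) -> 'M[C]_(p', q')}) :
  mregular F -> mregular (fun A => T (F A)).
Proof.
move=> hF i j.
apply: (@regular_ext (fun A => \sum_k \sum_l F A k l * T (delta_mx k l) i j)).
  move=> A _; rewrite {2}[F A]matrix_sum_delta linear_sum summxE.
  apply: eq_bigr => k _; rewrite linear_sum summxE; apply: eq_bigr => l _.
  by rewrite linearZ mxE.
by do 2!apply: regular_sum => ?; apply: regularM => //; exact: regular_const.
Qed.

Lemma mregularB p q (F G : 'M[C]_n -> 'M[C]_(p, q)) :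
  mregular F -> mregular G -> mregular (fun A => F A - G A).
Proof.
move=> hF hG i j; apply: regular_ext (regularD (hF i j) (regularM (regular_const (-1)) (hG i j))).
by move=> A _; rewrite !mxE mulN1r.
Qed.

Lemma closed_zeros p q (F : 'M[C]_n -> 'M[C]_(p, q)) :
  mregular F -> zariski_closed (fun A => GLC A /\ F A = 0).
Proof.
move=> hF.
exists (fun r => exists N i j, forall A, GLC A -> mxev r A = \det A ^+ N * F A i j) => A.
split=> [[hA FA]|[hA rA]]; first by split => // r [N [i [j ->]]] //; rewrite FA mxE mulr0.
split => //; apply/matrixP => i j; have [N [r rP]] := hF i j.
have /eqP : mxev r A = 0 by apply: rA; exists N, i, j.
rewrite rP // mulf_eq0 expf_eq0 => /orP[/andP[_ /eqP d0]|/eqP ->]; last by rewrite mxE.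
by move: hA; rewrite /GLC unitmxE unitfE d0 eqxx.
Qed.

Lemma closed_preimage (Z : 'M[C]_n -> Prop) (F : 'M[C]_n -> 'M[C]_n) :
  zariski_closed Z -> mregular F -> (forall A, GLC A -> GLC (F A)) ->
  zariski_closed (fun A => GLC A /\ Z (F A)).
Proof.
move=> [P PZ] hF FGL.
exists (fun r => exists2 p, P p & exists N, forall A, GLC A ->
  mxev r A = \det A ^+ N * mxev p (F A)) => A.
split=> [[hA /PZ[_ h]]|[hA h]]; first by split => // r [p /h pF [N ->]] //; rewrite pF mulr0.
split => //; apply/PZ; split=> [|p Pp]; first exact: FGL.
have [N [r rP]] : regular (fun A => mxev p (F A)).
  apply: (@regular_ext (fun A => \sum_(m <- msupp p) p@_m *
      \prod_(i < n * n) (mxvec (F A) 0 i) ^+ m i)).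
    by move=> A' _; rewrite /mxev mevalE.
  apply: regular_sum => m; apply: regularM; first exact: regular_const.
  apply: regular_prod => i; apply: regularX.
  by case/mxvec_indexP: i => i j; apply: regular_ext (hF i j) => A' _; rewrite mxvecE.
have /eqP : mxev r A = 0 by apply: h; exists p => //; exists N.
rewrite rP // mulf_eq0 expf_eq0 => /orP[/andP[_ /eqP d0]|/eqP //].
by move: hA; rewrite /GLC unitmxE unitfE d0 eqxx.
Qed.

Lemma connected_dichotomy (X Z1 Z2 : 'M[C]_n -> Prop) x0 :
  zariski_connected X -> (forall A, X A -> GLC A) ->
  zariski_closed Z1 -> zariski_closed Z2 -> (forall A, X A -> Z1 A \/ Z2 A) ->
  (forall A, X A -> Z1 A -> Z2 A -> False) -> X x0 -> Z1 x0 ->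
  forall x, X x -> Z1 x.
Proof.
move=> con XGL c1 c2 cov dis Xx0 Zx0 x Xx; case: (cov x Xx) => // Zx.
by exfalso; apply: con; exists Z1, Z2; split => //; split; [exists x0 | exists x].
Qed.

(* For each eigenvalue c in s the locus T (F x) = c *: F x is closed, and these
   finitely many disjoint loci cover X. *)
Lemma connected_eigenvalue p q (X : 'M[C]_n -> Prop) (F : 'M[C]_n -> 'M[C]_(p, q))
    (T : {linear 'M[C]_(p, q) -> 'M[C]_(p, q)}) (s : seq C) x0 c0 :
  zariski_connected X -> (forall A, X A -> GLC A) -> mregular F ->
  (forall x, X x -> F x != 0 /\ exists2 c, c \in s & T (F x) = c *: F x) ->
  X x0 -> T (F x0) = c0 *: F x0 ->
  forall x, X x -> T (F x) = c0 *: F x.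
Proof.
move=> con XGL hF hT Xx0 Tx0.
pose step c (D : 'M[C]_(p, q)) := T D - c *: D.
pose others := [seq c <- s | c != c0].
(* The product of the operators T - c over the c in s other than c0, applied to F x. On X it
   vanishes exactly where the eigenvalue is not c0. *)
pose G x := foldr step (F x) others.
have Gs x c r : T (F x) = c *: F x ->
    foldr step (F x) r = (\prod_(z <- r) (c - z)) *: F x.
  move=> Tx; elim: r => [|z r IH]; first by rewrite big_nil scale1r.
  by rewrite /= IH /step linearZ /= Tx big_cons !scalerA -scalerBl; congr (_ *: _); ring.
have hG r : mregular (fun x => foldr step (F x) r).
  elim: r => [//|z r IH] /=.
  apply: mregularB; first exact: mregular_linear.
  exact: (@mregular_linear _ _ _ _ _ (GRing.scale z : {linear _ -> _})).
pose Z1 x := GLC x /\ T (F x) - c0 *: F x = 0.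
pose Z2 x := GLC x /\ G x = 0.
have nz x : X x -> G x = 0 -> T (F x) = c0 *: F x -> False.
  move=> Xx /eqP; rewrite /G => Gx Tx; move: Gx; rewrite (Gs _ _ _ Tx) scaler_eq0.
  case/orP => [|/eqP F0]; last by have [/eqP] := hT x Xx.
  rewrite prodf_seq_eq0 => /hasP[z]; rewrite mem_filter => /andP[zc _] /=.
  by rewrite subr_eq0 eq_sym (negPf zc).
move=> x Xx; apply/eqP; rewrite -subr_eq0; apply/eqP.
suff [] : Z1 x by [].
apply: (@connected_dichotomy X Z1 Z2 x0) => //.
- apply: closed_zeros; apply: mregularB; first exact: mregular_linear.
  exact: (@mregular_linear _ _ _ _ _ (GRing.scale c0 : {linear _ -> _})).
- exact: closed_zeros (hG others).
- move=> A XA; have [F0 [c cs Tc]] := hT A XA; have GA := XGL A XA.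
  case: (eqVneq c c0) => [cE|cc]; [by left; split => //; rewrite Tc cE subrr | right].
  split => //; rewrite /G (Gs _ _ _ Tc) (_ : \prod_(z <- _) _ = 0) ?scale0r //.
  apply/eqP; rewrite prodf_seq_eq0; apply/hasP; exists c; first by rewrite mem_filter cc.
  by rewrite /= subrr.
- move=> A XA [_ /eqP]; rewrite subr_eq0 => /eqP TA [_ GA].
  exact: nz XA GA TA.
- by split; [exact: XGL | rewrite Tx0 subrr].
Qed.

(** Inverses come for free, because the inverse of a commutator is a commutator. No Zariski closure
    is taken: connectedness makes sense for any set of matrices. *)
Inductive derived (X : 'M[C]_n -> Prop) : 'M[C]_n -> Prop :=
| derived1 : derived X 1%:M
| derivedM w a b : derived X w -> X a -> X b ->
    derived X (w *m (invmx a *m invmx b *m a *m b)).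

Lemma derived_sub X A : is_subgroup X -> derived X A -> X A.
Proof.
move=> [GL [X1 [XM XV]]]; elim=> // w a b _ Xw Xa Xb.
by apply: (XM) => //; do 3!(apply: (XM) => //); apply: XV.
Qed.

Lemma derived_mul X A B : derived X A -> derived X B -> derived X (A *m B).
Proof.
move=> hA; elim=> [|w a b _ IH Xa Xb]; first by rewrite mulmx1.
by rewrite mulmxA; apply: derivedM.
Qed.

Lemma derived_commutator X a b : X a -> X b -> derived X (invmx a *m invmx b *m a *m b).
Proof. by move=> Xa Xb; rewrite -[X in derived _ X]mul1mx; apply: derivedM => //; exact: derived1. Qed.

Lemma derived_subgroup X : is_subgroup X -> is_subgroup (derived X).
Proof.
move=> hX; have [GL [X1 [XM XV]]] := hX.
split; first by move=> A /(derived_sub hX)/GL.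
split; [exact: derived1 | split; first exact: derived_mul].
move=> A; elim=> [|w a b hw IH Xa Xb]; first by rewrite invmx1; exact: derived1.
have ua : a \in unitmx := GL _ Xa; have ub : b \in unitmx := GL _ Xb.
have uw : w \in unitmx := GL _ (derived_sub hX hw).
rewrite (_ : invmx _ = invmx b *m invmx a *m b *m a *m invmx w).
  by apply: derived_mul => //; apply: derived_commutator.
apply: (can_inj (mulKmx (_ : w *m (invmx a *m invmx b *m a *m b) \in unitmx))).
  by rewrite !unitmx_mul !unitmx_inv uw ua ub.
rewrite mulmxV ?unitmx_mul ?unitmx_inv ?uw ?ua ?ub //.
by rewrite -!mulmxA (mulKVmx ub) (mulKVmx ua) (mulKmx ub) (mulKmx ua) mulmxV.
Qed.

(** For fixed w and b the map sending x to w * [x, b] is regular, takes X into the derived group and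
    takes 1 to w. So each element is joined to 1 one commutator at a time. *)
Lemma derived_connected X : is_subgroup X -> zariski_connected X ->
  zariski_connected (derived X).
Proof.
move=> hX con [Z1 [Z2 [c1 c2 cov [ne1 ne2] dis]]]; have [GL [X1 [XM XV]]] := hX.
wlog Z11 : Z1 Z2 c1 c2 cov ne1 ne2 dis / Z1 1%:M => [wl|].
  case: (cov _ (derived1 X)) => h; first exact: (wl Z1 Z2).
  by apply: (wl Z2 Z1) => // A hA; [case: (cov A hA); auto | move=> h1 h2; apply: (dis A)].
have all1 A : derived X A -> Z1 A.
  elim=> // w a b hw Zw Xa Xb.
  have uw : w \in unitmx := GL _ (derived_sub hX hw).
  have ub : b \in unitmx := GL _ Xb.
  pose f x := w *m (invmx x *m invmx b *m x *m b).
  have hf : mregular f.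
    apply: mregularM; first exact: mregular_const.
    apply: mregularM; last exact: mregular_const.
    apply: mregularM; last exact: mregular_id.
    by apply: mregularM; [exact: mregular_inv | exact: mregular_const].
  have fGL x : GLC x -> GLC (f x).
    by move=> ux; rewrite /GLC !unitmx_mul !unitmx_inv uw ub [x \in _]ux.
  have fX x : X x -> derived X (f x) by move=> Xx; apply: derivedM.
  suff [] : GLC a /\ Z1 (f a) by [].
  apply: (@connected_dichotomy X (fun x => GLC x /\ Z1 (f x)) (fun x => GLC x /\ Z2 (f x)) 1%:M) => //.
  - exact: closed_preimage.
  - exact: closed_preimage.
  - by move=> x Xx; have GLx := GL _ Xx; case: (cov _ (fX x Xx)); [left|right].
  - by move=> x Xx [_ h1] [_ h2]; apply: (dis (f x)) => //; apply: fX.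
  - by split; [exact: GL | rewrite /f invmx1 mul1mx mulmx1 mulVmx // mulmx1].
by case: ne2 => A [hA ZA]; apply: (dis A) => //; apply: all1.
Qed.

End Regular.

Lemma char_poly_root (m : nat) (A : 'M[C]_m) : (0 < m)%N -> exists c, eigenvalue A c.
Proof.
move=> m0; have /closed_rootP[c rc] : size (char_poly A) != 1%N.
  by rewrite size_char_poly -lt0n in m0 *; case: m m0 A.
by exists c; rewrite eigenvalue_root_char.
Qed.

Lemma stable_eigenvector m (W A : 'M[C]_m) : W != 0 -> (W *m A <= W)%MS ->
  exists c, exists2 v : 'rV_m, v != 0 & (v <= W)%MS /\ v *m A = c *: v.
Proof.
move=> W0 WA; pose Wb := row_base W.
have fW : row_free Wb by exact: row_base_free.
have stab : (Wb *m A <= Wb)%MS.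
  by rewrite (eqmxMr A (eq_row_base W)) (submx_trans WA) // eq_row_base.
have r0 : (0 < \rank W)%N by rewrite lt0n mxrank_eq0.
have [c /eigenvalueP[u uA u0]] := char_poly_root (Wb *m A *m pinvmx Wb) r0.
exists c, (u *m Wb).
  by apply: contraNneq u0 => uW; rewrite -(mulmxKp fW u) uW mul0mx.
split; first by rewrite -(eq_row_base W) submxMl.
by rewrite -mulmxA -(mulmxKpV stab) mulmxA uA scalemxAl.
Qed.

(** On a nonzero stable subspace of least rank every element of S acts as a scalar, since an
    eigenspace inside it is again stable. *)
Lemma commuting_eigenvector m (S : 'M[C]_m -> Prop) : (0 < m)%N ->
  (forall A B, S A -> S B -> A *m B = B *m A) ->
  exists2 v : 'rV_m, v != 0 & forall A, S A -> exists c, v *m A = c *: v.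
Proof.
move=> m0 comm.
pose P (W : 'M[C]_m) := W != 0 /\ forall A, S A -> (W *m A <= W)%MS.
have [|W [W0 WS] min] := @minimal_witness _ P (fun W => \rank W).
  exists 1%:M; split=> [|A _]; last exact: submx1.
  by rewrite -mxrank_eq0 mxrank1 -lt0n.
have /rowV0Pn[v vW v0] : W != 0 by [].
exists v => // A SA.
have [c [u u0 [uW uA]]] := stable_eigenvector W0 (WS A SA); exists c.
pose V := (W :&: kermx (A - c%:M))%MS.
have uker : (u <= V)%MS.
  by rewrite sub_capmx uW; apply/sub_kermxP; rewrite mulmxBr uA mul_mx_scalar subrr.
have PV : P V.
  split; first by apply: contraNneq u0 => V0; move: uker; rewrite V0 submx0.
  move=> B SB; rewrite sub_capmx; apply/andP; split.
    by apply: submx_trans (WS B SB); rewrite submxMr // capmxSl.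
  apply/sub_kermxP; rewrite -mulmxA mulmxBr -(comm _ _ SA SB) mul_mx_scalar -mul_scalar_mx.
  rewrite -mulmxBl mulmxA; suff -> : V *m (A - c%:M) = 0 by rewrite mul0mx.
  by apply/sub_kermxP; exact: capmxSr.
have WV : (W <= V)%MS by rewrite -(mxrank_leqif_sup (capmxSl _ _)).2 eqn_leq mxrankS ?capmxSl ?min.
have /sub_kermxP : (v <= kermx (A - c%:M))%MS.
  exact: submx_trans (submx_trans vW WV) (capmxSr _ _).
by rewrite mulmxBr mul_mx_scalar => /eqP; rewrite subr_eq0 => /eqP.
Qed.

(** * The Lie-Kolchin theorem *)

Section LieKolchin.
Variable n : nat.

(* L and R are a section and a projection for a subquotient of the natural module. *)
Definition representation m (X : 'M[C]_n -> Prop) (L : 'M[C]_(m, n)) (R : 'M[C]_(n, m)) :=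
  L *m R = 1%:M /\
  forall A B, X A -> X B -> L *m (A *m B) *m R = (L *m A *m R) *m (L *m B *m R).

Definition has_common_eigenvector m (X : 'M[C]_n -> Prop) (L : 'M[C]_(m, n)) (R : 'M[C]_(n, m)) :=
  exists2 v : 'rV_m, v != 0 & forall A, X A -> exists c, v *m (L *m A *m R) = c *: v.

Lemma representation_restrict m X (L : 'M[C]_(m, n)) R (W : 'M[C]_m) :
  representation X L R -> (forall A, X A -> (W *m (L *m A *m R) <= W)%MS) ->
  let Wb := row_base W in
  representation X (Wb *m L) (R *m pinvmx Wb) /\
  forall A, X A -> (Wb *m L *m A *m (R *m pinvmx Wb)) *m Wb = Wb *m (L *m A *m R).
Proof.
move=> [LR LM] stab Wb.
have fW : row_free Wb by exact: row_base_free.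
have stab' A : X A -> (Wb *m (L *m A *m R) <= Wb)%MS.
  move=> XA; rewrite (eqmxMr _ (eq_row_base W)) (submx_trans (stab A XA)) //.
  by rewrite eq_row_base.
have act A : X A -> (Wb *m L *m A *m (R *m pinvmx Wb)) *m Wb = Wb *m (L *m A *m R).
  by move=> XA; rewrite -(mulmxKpV (stab' A XA)) !mulmxA.
split => //; split; first by rewrite mulmxA -(mulmxA Wb) LR mulmx1 mulmxVp.
move=> A B XA XB.
have E D : Wb *m L *m D *m (R *m pinvmx Wb) = Wb *m (L *m D *m R) *m pinvmx Wb.
  by rewrite !mulmxA.
rewrite E LM // (mulmxA Wb (L *m A *m R)) -act //.
by rewrite -(mulmxA _ Wb) -(mulmxA _ (Wb *m _)) -E.
Qed.

Lemma eigenvalue_roots m (A : 'M[C]_m) : exists s : seq C,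
  forall (v : 'rV_m) c, v != 0 -> v *m A = c *: v -> c \in s.
Proof.
have [s sE] := closed_field_poly_normal (char_poly A); exists s => v c v0 vA.
have : root (char_poly A) c by rewrite -eigenvalue_root_char; apply/eigenvalueP; exists v.
by rewrite sE (monicP (char_poly_monic _)) scale1r root_prod_XsubC.
Qed.

(* A weight space of the derived group is stable under X. On it commutators act
   as scalars of determinant one, which must be 1 by connectedness, so that X acts
   by commuting operators. *)
Theorem lie_kolchin_eigenvector N (X : 'M[C]_n -> Prop) :
  is_subgroup X -> zariski_connected X ->
  (forall A, iter N (@derived n) X A -> A = 1%:M) ->
  forall m (L : 'M[C]_(m, n)) R, (0 < m)%N -> representation X L R -> has_common_eigenvector X L R.
Proof.
elim: N X => [|N IH] X hX con triv m L R m0 rep.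
  exists (const_mx 1).
    by apply/rV0Pn; exists (Ordinal m0); rewrite mxE oner_neq0.
  by move=> A /triv ->; exists 1; rewrite mulmx1 rep.1 mulmx1 scale1r.
have [GL [X1 [XM XV]]] := hX; have [LR LM] := rep.
pose Y := derived X; have YX A : Y A -> X A by apply: derived_sub.
pose rho A := L *m A *m R.
have rhoM A B : X A -> X B -> rho (A *m B) = rho A *m rho B by apply: LM.
have rho1 : rho 1%:M = 1%:M by rewrite /rho mulmx1.
have rhoU A : X A -> rho A \in unitmx.
  move=> XA; have uA : A \in unitmx := GL A XA.
  have E : rho A *m rho (invmx A) = 1%:M by rewrite -rhoM ?mulmxV ?rho1 //; exact: XV.
  exact: (mulmx1_unit E).1.
have regrho : mregular rho.
  apply: mregularM; last exact: mregular_const.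
  by apply: mregularM; [exact: mregular_const | exact: mregular_id].
have [v0 v00 v0P] : has_common_eigenvector Y L R.
  apply: (IH Y) => //; [exact: derived_subgroup | exact: derived_connected | | ].
    by move=> A; rewrite -iterSr; apply: triv.
  by split => // A B /YX XA /YX XB; apply: LM.
have chiH A : exists c, Y A -> v0 *m rho A = c *: v0.
  case: (pselect (Y A)) => [/v0P[c cP]|nY]; last by exists 0.
  by exists c.
have [chi chiP] := choice chiH.
pose weight p (w : 'M_(p, m)) := forall y, Y y -> w *m rho y = chi y *: w.
(* v *m rho x is an eigenvector of rho y with eigenvalue chi of the conjugate x y x^-1. Since rho y
   has finitely many eigenvalues and X is connected, this eigenvalue keeps its value chi y at x =
   1. *)
have weight_stable (v : 'rV_m) x : weight 1%N v -> X x -> weight 1%N (v *m rho x).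
  move=> vw Xx y Yy; have [->|vn0] := eqVneq v 0; first by rewrite !mul0mx scaler0.
  have [s sP] := eigenvalue_roots (rho y).
  apply: (@connected_eigenvalue _ _ _ X (fun x => v *m rho x)
     (mulmxr (rho y) : {linear _ -> _}) s 1%:M (chi y)) => //.
  - by apply: mregularM => //; exact: mregular_const.
  - move=> z Xz; have n0 : v *m rho z != 0.
      by apply: contraNneq vn0 => vz; rewrite -(mulmxK (rhoU z Xz) v) vz mul0mx.
    split => //; have Yzy : Y (z *m y *m invmx z).
      rewrite (_ : z *m y *m invmx z = y *m (invmx y *m invmx (invmx z) *m y *m invmx z)).
        by apply: derived_mul => //; apply: derived_commutator; [exact: YX | exact: XV].
      by rewrite invmxK !mulmxA mulmxV ?mul1mx //; apply: GL; apply: YX.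
    have zy : v *m rho z *m rho y = chi (z *m y *m invmx z) *: (v *m rho z).
      rewrite -mulmxA -rhoM //; last exact: YX.
      rewrite -{1}(mulmxKV (GL z Xz : z \in unitmx) (z *m y)) rhoM //; last exact: YX.
      by rewrite mulmxA vw // scalemxAl.
    by exists (chi (z *m y *m invmx z)) => //; apply: sP n0 zy.
  - by rewrite /= rho1 mulmx1 vw.
pose P (W : 'M[C]_m) := weight m W.
(* Least codimension makes W the whole weight space. *)
have [|W Ww max] := @minimal_witness _ P (fun W => m - \rank W)%N.
  by exists 0 => y _; rewrite mul0mx scaler0.
have wsub (v : 'rV_m) : weight 1%N v -> (v <= W)%MS.
  move=> vw; have PWv : P (W + v)%MS.
    move=> y Yy; have : ((W + v)%MS <= kermx (rho y - (chi y)%:M))%MS.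
      rewrite addsmx_sub; apply/andP; split; apply/sub_kermxP.
        by rewrite mulmxBr mul_mx_scalar Ww // subrr.
      by rewrite mulmxBr mul_mx_scalar vw // subrr.
    by move/sub_kermxP/eqP; rewrite mulmxBr mul_mx_scalar subr_eq0 => /eqP.
  have := max _ PWv; have := rank_leq_row W; have := rank_leq_row (W + v)%MS.
  move=> h1 h2 h3; have rk : (\rank (W + v)%MS <= \rank W)%N by lia.
  have : (W + v <= W)%MS by rewrite -(mxrank_leqif_sup (addsmxSl W v)).2 eqn_leq rk mxrankS ?addsmxSl.
  by rewrite addsmx_sub => /andP[].
have W0 : W != 0.
  apply: contraNneq v00 => W0; rewrite -submx0 -W0; apply: wsub => y Yy.
  exact: chiP.
have Wstab x : X x -> (W *m rho x <= W)%MS.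
  move=> Xx; apply/row_subP => i; rewrite row_mul; apply: wsub; apply: weight_stable => //.
  by move=> y Yy; rewrite -row_mul Ww // linearZ.
have [repW actW] := representation_restrict rep Wstab.
move: repW actW; set Wb := row_base W; set L' := Wb *m L; set R' := R *m pinvmx Wb.
move=> [LR' LM'] actW; pose rhoW A := L' *m A *m R'.
have rhoWM A B : X A -> X B -> rhoW (A *m B) = rhoW A *m rhoW B by apply: LM'.
have rhoW1 : rhoW 1%:M = 1%:M by rewrite /rhoW mulmx1.
have fW : row_free Wb by exact: row_base_free.
have r0 : (0 < \rank W)%N by rewrite lt0n mxrank_eq0.
have rhoWU A : X A -> rhoW A \in unitmx.
  move=> XA; have uA : A \in unitmx := GL A XA.
  have E : rhoW A *m rhoW (invmx A) = 1%:M by rewrite -rhoWM ?mulmxV ?rhoW1 //; exact: XV.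
  exact: (mulmx1_unit E).1.
have rhoWY y : Y y -> rhoW y = (chi y)%:M.
  move=> Yy; apply: (can_inj (mulmxKp fW)).
  rewrite actW; last exact: YX.
  rewrite mul_scalar_mx; apply/eqP; rewrite -subr_eq0 -mul_mx_scalar -mulmxBr; apply/eqP.
  apply/sub_kermxP; rewrite eq_row_base; apply/sub_kermxP.
  by rewrite mulmxBr mul_mx_scalar Ww // subrr.
have regrhoW : mregular rhoW.
  apply: mregularM; last exact: mregular_const.
  by apply: mregularM; [exact: mregular_const | exact: mregular_id].
have {}actW A : X A -> rhoW A *m Wb = Wb *m (L *m A *m R) by apply: actW.
clearbody rhoW.
have comm A B : X A -> X B -> rhoW A *m rhoW B = rhoW B *m rhoW A.
  move=> XA XB; have UB := rhoWU B XB.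
  (* T is conjugation by rhoW B. It multiplies rhoW x by the scalar of a commutator, whose power of
     exponent \rank W is 1 by comparing determinants; at x = 1 the scalar is 1, hence everywhere. *)
  pose T := (mulmx (invmx (rhoW B)) \o mulmxr (rhoW B)) : {linear 'M[C]_(\rank W) -> 'M[C]_(\rank W)}.
  have [s sE] := closed_field_poly_normal ('X^(\rank W) - 1%:P : {poly C}).
  have : T (rhoW A) = 1 *: rhoW A.
    apply: (@connected_eigenvalue _ _ _ X rhoW T s 1%:M 1) => //.
    - move=> x Xx; have Ux := rhoWU x Xx; split.
        by apply: contraTneq Ux => ->; rewrite unitmxE -(prednK r0) det0 unitr0.
      pose y := invmx x *m invmx B *m x *m B.
      have Yy : Y y by apply: derived_commutator.
      have xB : rhoW x *m rhoW B = chi y *: (rhoW B *m rhoW x).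
        rewrite -mul_mx_scalar -rhoWY // -!rhoWM //; [congr rhoW | exact: XM | exact: YX].
        have ux : x \in unitmx := GL x Xx; have uB : B \in unitmx := GL B XB.
        by rewrite /y -!mulmxA mulKVmx // mulKVmx.
      exists (chi y); last by rewrite /= xB -scalemxAr mulKmx.
      have : root ('X^(\rank W) - 1%:P) (chi y).
        rewrite rootE hornerD hornerN hornerC hornerXn subr_eq0; apply/eqP.
        have := congr1 determinant xB; rewrite detZ !det_mulmx [_ * \det (rhoW B)]mulrC.
        move/esym; rewrite -[X in _ = X]mul1r; apply: mulIf.
        by rewrite mulf_neq0 // -unitfE -unitmxE.
      by rewrite sE rootZ ?root_prod_XsubC // lead_coef_eq0 -size_poly_eq0 size_XnsubC.
    by rewrite /= rhoW1 mul1mx mulVmx // scale1r.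
  by rewrite scale1r /= => h; rewrite -{2}h mulKVmx.
have [|u u0 uP] := @commuting_eigenvector _ (fun D => exists2 A, X A & D = rhoW A) r0.
  by move=> _ _ [A XA ->] [B XB ->]; apply: comm.
exists (u *m Wb).
  by apply: contraNneq u0 => uW; rewrite -(mulmxKp fW u) uW mul0mx.
move=> A XA; have [c cP] := uP (rhoW A) (ex_intro2 _ _ A XA erefl); exists c.
by rewrite -mulmxA -actW // mulmxA cP scalemxAl.
Qed.
End LieKolchin.

(** * Algebraic numbers and triangularization over a number field *)

Definition algebraic (x : C) : Prop := algebraicOver (ratr : rat -> C) x.

Lemma algB x y : algebraic x -> algebraic y -> algebraic (x - y). Proof. exact: algebraic_sub. Qed.
Lemma algM x y : algebraic x -> algebraic y -> algebraic (x * y). Proof. exact: algebraic_mul. Qed.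
Lemma algV x : algebraic x -> algebraic x^-1. Proof. exact: algebraic_inv. Qed.
Lemma alg1 : algebraic 1. Proof. exact: algebraic1. Qed.
Lemma alg_subring : subring_pred algebraic.
Proof. by split; [exact: alg1 | exact: algB | exact: algM]. Qed.

Lemma alg_root (p : {poly C}) x : p != 0 -> poly_in algebraic p -> root p x -> algebraic x.
Proof.
move=> p0 hp px; apply/integral_algebraic.
apply: (@integral_root _ _ (ratr : {rmorphism rat -> C}) _ _ p0 px) => _ /(nthP 0)[i _ <-].
by apply/integral_algebraic; apply: hp.
Qed.

Lemma map_ratr_intr (p : {poly int}) : map_poly ratr (map_poly intr p) = map_poly intr p :> {poly C}.
Proof. by rewrite -map_poly_comp; apply: eq_map_poly => z; rewrite /= ratr_int. Qed.

Lemma aint_alg x : aint x -> algebraic x.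
Proof.
case=> p pm px; exists (map_poly intr p).
  by rewrite -size_poly_eq0 size_map_inj_poly ?size_poly_eq0 ?monic_neq0 //; exact: intr_inj.
by rewrite map_ratr_intr.
Qed.

Lemma nf_alg k x : number_field k -> k x -> algebraic x.
Proof.
move=> kP kx; have [N N0 /aint_alg aNx] := nf_denominator kP kx.
rewrite -[x](mulKf (_ : N%:R != 0)) ?pnatr_eq0 -?lt0n //.
apply: algM => //; apply: algV; rewrite -(ratr_nat C); exact: algebraic_id.
Qed.

Lemma alg_inv_poly x : algebraic x -> x != 0 -> exists P : {poly rat}, x^-1 = (map_poly ratr P).[x].
Proof.
move=> ax x0; pose Z (p : {poly rat}) := p != 0 /\ root (map_poly ratr p) x.
have [|p [p0 px] min] := @minimal_witness _ Z (fun p => size p).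
  by case: ax => p p0 px; exists p.
elim/poly_ind: p p0 px min => [|p c _]; first by rewrite eqxx.
move=> p0; rewrite rootE rmorphD rmorphM /= map_polyX map_polyC hornerMXaddC => px min.
have c0 : c != 0.
  apply/eqP => c0; move: p0 px min; rewrite c0 polyC0 addr0 raddf0 addr0.
  have [->|p0] := eqVneq p 0; first by rewrite mul0r eqxx.
  move=> _; rewrite mulf_eq0 (negPf x0) orbF => px /(_ p) h; have := h (conj p0 px).
  by rewrite size_mulX // ltnn.
exists (- c^-1 *: p); rewrite map_polyZ hornerZ; apply: (mulIf x0).
rewrite mulVf // -mulrA; have -> : (map_poly ratr p).[x] * x = - ratr c.
  by apply/eqP; rewrite -addr_eq0.
by rewrite rmorphN fmorphV mulrNN mulVf // fmorph_eq0.
Qed.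

(** k[a] is already a field, because the inverse of an algebraic number is a rational polynomial in
    it; reduction modulo the minimal polynomial gives finite dimension. *)
Theorem nf_adjoin k a : number_field k -> algebraic a ->
  exists2 K, number_field K & (forall x, k x -> K x) /\
    (forall x, K x <-> exists2 A, poly_in k A & x = A.[a]).
Proof.
move=> kP aa; have kR := nf_subring kP.
pose K x := exists2 A, poly_in k A & x = A.[a].
have Kk x : k x -> K x by move=> kx; exists x%:P; rewrite ?hornerC //; apply: overC.
have Kmul x y : K x -> K y -> K (x * y).
  by move=> [A hA ->] [B hB ->]; exists (A * B); rewrite ?hornerM //; apply: overM.
have Kadd x y : K x -> K y -> K (x + y).
  by move=> [A hA ->] [B hB ->]; exists (A + B); rewrite ?hornerD //; apply: overD.
have Kopp x : K x -> K (- x).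
  by move=> Kx; rewrite -mulN1r; apply: Kmul => //; apply: Kk; apply: (nfN kP); exact: nf1.
have [|g [gm hg ga gdvd]] := @nf_minpoly k a kP.
  case: aa => p p0 pa; exists (map_poly ratr p); split => //.
    by move=> i; rewrite coef_map; apply: nf_rat.
  by rewrite map_poly_eq0.
have Kalg x : K x -> algebraic x.
  move=> [A hA ->]; apply: (over_horner alg_subring) => //.
  by move=> i; apply: nf_alg kP (hA i).
exists K => //; split.
- by split; apply: Kk; [exact: nf0 | exact: nf1].
- by split.
- exact: Kmul.
- move=> x Kx x0; have [P ->] := alg_inv_poly (Kalg x Kx) x0.
  elim/poly_ind: P => [|P c IH].
    by rewrite rmorph0 horner0; apply: Kk; exact: nf0.
  rewrite rmorphD rmorphM /= map_polyX map_polyC hornerMXaddC.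
  by apply: Kadd; [apply: Kmul | apply: Kk; apply: nf_rat].
have [d [b [bk fb] bs]] := nf_basis kP.
pose n := (size g).-1.
exists (d * n)%N, (fun i => mxvec (\matrix_(i < d, j < n) (b i * a ^+ j)) 0 i); split.
  move=> i; case/mxvec_indexP: i => i j; rewrite mxvecE mxE; apply: Kmul; first exact: Kk.
  by exists 'X^j; rewrite ?hornerXn //; apply: overXn.
move=> x [A hA ->]; have [q [r [hq hr sr ->]]] := over_divmod kR gm hg hA.
rewrite hornerD hornerM (eqP ga) mulr0 add0r.
have h (j : 'I_n) : exists c, r`_j = qspan b c by apply: bs.
have [c cP] := fin_choice h.
exists (fun i => mxvec (\matrix_(i < d, j < n) c j 0 i) 0 i).
rewrite (reindex _ (curry_mxvec_bij d n)) /=.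
rewrite (eq_bigr (fun p => ratr (c p.2 0 p.1) * (b p.1 * a ^+ p.2))); last first.
  by case=> i j _; rewrite /= !mxvecE !mxE.
rewrite -(pair_bigA _ (fun i j => ratr (c j 0 i) * (b i * a ^+ j))) /= exchange_big /=.
have srn : (size r <= n)%N by rewrite -ltnS prednK // size_poly_gt0 monic_neq0.
rewrite (horner_coef_wide _ srn); apply: eq_bigr => j _.
by rewrite cP /qspan mulr_suml; apply: eq_bigr => i _; rewrite mulrA.
Qed.

Theorem nf_adjoin_seq k (s : seq C) : number_field k -> (forall x, x \in s -> algebraic x) ->
  exists2 K, number_field K & (forall x, k x -> K x) /\ forall x, x \in s -> K x.
Proof.
move=> kP; elim: s => [|a s IH] hs; first by exists k.
have [|K KP [kK sK]] := IH; first by move=> x xs; apply: hs; rewrite inE xs orbT.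
have [K' KP' [KK' KE]] := nf_adjoin KP (hs a (mem_head _ _)).
exists K' => //; split=> [x /kK/KK' //|x]; rewrite inE => /predU1P[->|/sK/KK' //].
by apply/KE; exists 'X; rewrite ?hornerX //; apply: overX; exact: nf_subring.
Qed.

Definition mx_in (S : C -> Prop) p q (M : 'M[C]_(p, q)) : Prop := forall i j, S (M i j).

(* The action of X on the quotient of the row space by the X-stable subspace
   ker R, in coordinates given by the section L. *)
Definition quotient_representation n m (X : 'M[C]_n -> Prop)
    (L : 'M[C]_(m, n)) (R : 'M[C]_(n, m)) : Prop :=
  L *m R = 1%:M /\ forall A, X A -> A *m R = R *m (L *m A *m R).

Lemma quotient_representationP n m X (L : 'M[C]_(m, n)) R :
  quotient_representation X L R -> representation X L R.
Proof.
move=> [LR AR]; split => // A B XA XB.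
by rewrite mulmxA -(mulmxA _ B) AR // !mulmxA.
Qed.

Section Triangularize.
Variable S : C -> Prop.
Hypotheses (SR : subring_pred S) (SV : forall x, S x -> S x^-1).

Lemma mx_in1 m : mx_in S (1%:M : 'M_m).
Proof. by move=> i j; rewrite mxE; case: eqP => _; [exact: sr1 | exact: sr0]. Qed.

Lemma mx_in0 p q : mx_in S (0 : 'M_(p, q)).
Proof. by move=> i j; rewrite mxE; exact: sr0. Qed.

Lemma mx_inM p q r (A : 'M_(p, q)) (B : 'M_(q, r)) : mx_in S A -> mx_in S B -> mx_in S (A *m B).
Proof. by move=> hA hB i j; rewrite mxE; apply: (sr_sum SR) => l _; apply: (srM SR). Qed.

Lemma sr_prod (I : Type) (r : seq I) (P : pred I) (h : I -> C) :
  (forall i, P i -> S (h i)) -> S (\prod_(i <- r | P i) h i).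
Proof. by move=> hh; apply: big_ind => //; [exact: sr1 | exact: srM]. Qed.

Lemma mx_in_det m (A : 'M_m) : mx_in S A -> S (\det A).
Proof.
move=> hA; apply: (sr_sum SR) => s _; apply: (srM SR); last by apply: sr_prod => i _; exact: hA.
by apply: (srX SR); apply: (srN SR); exact: sr1.
Qed.

Lemma mx_in_inv m (A : 'M_m) : mx_in S A -> mx_in S (invmx A).
Proof.
move=> hA i j; rewrite /invmx; case: ifP => // uA; rewrite !mxE.
apply: (srM SR); first by apply: SV; exact: mx_in_det.
rewrite /cofactor; apply: (srM SR); first by apply: (srX SR); apply: (srN SR); exact: sr1.
by apply: mx_in_det => k l; rewrite !mxE.
Qed.

Lemma complete_row m (v : 'rV[C]_m.+1) : v != 0 -> mx_in S v ->
  exists2 Q : 'M_m.+1, Q \in unitmx & mx_in S Q /\ row 0 Q = v.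
Proof.
move=> /rV0Pn[j vj] hv.
pose Q0 : 'M[C]_m.+1 := \matrix_(i, l) if i == j then v 0 l else (i == l)%:R.
exists (xrow 0 j Q0).
  rewrite xrowE unitmx_mul unitmx_perm /= unitmxE det_row_replaced unitfE //.
split=> [i l|]; last first.
  by apply/rowP => l; rewrite !mxE tpermL eqxx.
rewrite !mxE; case: eqP => _; first exact: hv.
by case: eqP => _; [exact: sr1 | exact: sr0].
Qed.

Variables (n : nat) (X : 'M[C]_n -> Prop).
Hypothesis eig : forall m (L : 'M[C]_(m, n)) R, (0 < m)%N -> mx_in S L -> mx_in S R ->
  quotient_representation X L R -> exists2 v : 'rV_m, v != 0 /\ mx_in S v &
    forall A, X A -> exists c, v *m (L *m A *m R) = c *: v.

(** A common eigenvector becomes the first row of the base change, and the remaining block is the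
    action on the quotient by it. As eigenvectors are demanded of all quotients over S, the same
    induction serves the complex Lie-Kolchin theorem, its descent to algebraic numbers and the
    multiplication matrices of a number field. *)
Theorem triangularize m (L : 'M[C]_(m, n)) R :
  mx_in S L -> mx_in S R -> quotient_representation X L R ->
  exists2 P : 'M_m, P \in unitmx /\ mx_in S P &
    forall A, X A -> is_trig_mx (P *m (L *m A *m R) *m invmx P).
Proof.
elim: m L R => [|m IH] L R hL hR rep.
  exists 1%:M; first by split; [exact: unitmx1 | exact: mx_in1].
  by move=> A _; apply/is_trig_mxP => -[].
have [v [v0 hv] vP] := eig (ltn0Sn m) hL hR rep.
have [Q uQ [hQ Qv]] := complete_row v0 hv; have [LR AR] := rep.
pose B A : 'M_(1 + m) := (Q *m (L *m A *m R) *m invmx Q).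
pose Q' : 'M_(1 + m) := Q; pose Qi : 'M_(1 + m) := invmx Q.
have QQi : Q' *m Qi = 1%:M by rewrite mulmxV.
pose L' := dsubmx Q' *m L; pose R' := R *m rsubmx Qi.
have dr A : L' *m A *m R' = drsubmx (B A).
  by rewrite /drsubmx /B -mul_dsub_mx -mulmx_rsub -mul_dsub_mx /L' /R' !mulmxA.
have uQ' : usubmx Q' = v.
  by rewrite -Qv; apply/rowP => i; rewrite !mxE; congr (Q _ _); apply: val_inj.
have ur A : X A -> ursubmx (B A) = 0.
  move=> XA; have [c cP] := vP A XA.
  rewrite /ursubmx /B -mul_usub_mx -mul_usub_mx uQ' cP -scalemxAl -uQ' mul_usub_mx QQi.
  by rewrite (scalar_mx_block 1) /block_mx col_mxKu linearZ /= row_mxKr scaler0.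
have rep' : quotient_representation X L' R'.
  split.
    rewrite /L' /R' mulmxA -(mulmxA _ L) LR mulmx1 mulmx_rsub mul_dsub_mx QQi.
    by rewrite (scalar_mx_block 1) /block_mx col_mxKd row_mxKr.
  move=> A XA; rewrite dr /R' mulmxA AR // -mulmxA -[RHS]mulmxA; congr (R *m _).
  have QB : (L *m A *m R : 'M_(1 + m)) *m Qi = Qi *m B A.
    by rewrite /B -(mulmxA Q) mulKmx.
  rewrite mulmx_rsub QB -{1}[Qi]hsubmxK -{1}[B A]submxK mul_row_block row_mxKr.
  by rewrite ur // mulmx0 add0r.
have [|||P' [uP' hP'] P'T] := IH L' R' => //.
- by apply: mx_inM => // i j; rewrite mxE.
- by apply: mx_inM => // i j; rewrite mxE; apply: mx_in_inv.
pose P1 : 'M_(1 + m) := block_mx 1%:M 0 0 P'.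
have uP1 : P1 \in unitmx by rewrite unitmxE det_ublock det1 mul1r -unitmxE.
have P1V : invmx P1 = block_mx 1%:M 0 0 (invmx P').
  apply: (can_inj (mulKmx uP1)); rewrite mulmxV // mulmx_block !mulmx0 !mul0mx !mulmx1.
  by rewrite !addr0 !add0r mulmxV // -scalar_mx_block.
exists (P1 *m Q).
  split; first by rewrite unitmx_mul uP1.
  apply: mx_inM => // i j; rewrite /P1 /block_mx mxE.
  case: split => i'; rewrite mxE; case: split => j';
    [exact: mx_in1 | exact: mx_in0 | exact: mx_in0 | exact: hP'].
move=> A XA.
have -> : P1 *m Q *m (L *m A *m R) *m invmx (P1 *m Q) = P1 *m B A *m invmx P1.
  have uPQ : P1 *m Q \in unitmx by rewrite unitmx_mul uP1.
  have -> : invmx (P1 *m Q) = invmx Q *m invmx P1.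
    by apply: (can_inj (mulKmx uPQ)); rewrite mulmxV // -mulmxA mulKVmx // mulmxV.
  by rewrite /B !mulmxA.
rewrite P1V -[B A]submxK ur // !mulmx_block !(mulmx0, mul0mx, mulmx1, mul1mx, addr0, add0r).
rewrite (is_trig_block_mx _ _ _ _ (erefl 1%N)) eqxx -dr P'T // andbT.
by apply/is_trig_mxP => i j; rewrite !ord1.
Qed.
End Triangularize.

(** Elimination with row 0 as pivot stays over the field S, and a complex kernel vector restricts to
    one of the reduced matrix. *)
Lemma kernel_over (S : C -> Prop) m q (N : 'M[C]_(m, q)) :
  subring_pred S -> (forall x, S x -> S x^-1) -> mx_in S N ->
  (exists2 v : 'rV_m, v != 0 & v *m N = 0) ->
  exists2 u : 'rV_m, u != 0 /\ mx_in S u & u *m N = 0.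
Proof.
move=> SR SV; elim: m N => [|m IH] N hN [v v0 vN].
  by case/rV0Pn: v0 => -[].
have [/rowP N0|/rV0Pn[j Nj]] := eqVneq (row 0 N) 0.
  exists (delta_mx 0 0); last by rewrite -rowE; apply/rowP => j; rewrite N0.
  split; first by apply/rV0Pn; exists 0; rewrite mxE !eqxx oner_neq0.
  by move=> i j; rewrite mxE; case: (_ && _); [exact: sr1 | exact: sr0].
rewrite mxE in Nj.
pose f (i : 'I_m) := N (lift 0 i) j / N 0 j.
have fS i : S (f i) by apply: (srM SR) => //; apply: SV.
pose N' : 'M_(m, q) := \matrix_(i, l) (N (lift 0 i) l - f i * N 0 l).
have vE l : v 0 0 * N 0 l + \sum_(i < m) v 0 (lift 0 i) * N (lift 0 i) l = 0.
  by move/rowP/(_ l): vN; rewrite !mxE big_ord_recl.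
have [||u' [u'0 hu'] u'N] := IH N'.
- by move=> i l; rewrite mxE; apply: (srB SR) => //; apply: (srM SR).
- have v00 : v 0 0 = - \sum_(i < m) v 0 (lift 0 i) * f i.
    apply: (mulIf Nj); apply/eqP; rewrite mulNr -addr_eq0 mulr_suml; apply/eqP; rewrite -[RHS](vE j).
    by congr (_ + _); apply: eq_bigr => i _; rewrite -mulrA divfK.
  exists (\row_i v 0 (lift 0 i)).
    apply: contraNneq v0 => /rowP v'0; apply/eqP/rowP => i; rewrite [RHS]mxE.
    have h k : v 0 (lift 0 k) = 0 by have := v'0 k; rewrite !mxE.
    case: (unliftP 0 i) => [k|] ->; first exact: h.
    by rewrite v00 big1 ?oppr0 // => k _; rewrite h mul0r.
  apply/rowP => l; rewrite [RHS]mxE -[RHS](vE l) v00 mulNr mulr_suml addrC -sumrB mxE.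
  by apply: eq_bigr => i _; rewrite !mxE mulrBr mulrA.
exists (\row_i if unlift 0 i is Some k then u' 0 k else - \sum_(k < m) u' 0 k * f k).
  split.
    case/rV0Pn: u'0 => k uk; apply/rV0Pn; exists (lift 0 k); by rewrite mxE liftK.
  move=> i l; rewrite !mxE; case: unlift => [k|]; first exact: hu'.
  by apply: (srN SR); apply: (sr_sum SR) => k _; apply: (srM SR).
apply/rowP => l; rewrite !mxE big_ord_recl !mxE unlift_none.
move/rowP/(_ l): u'N; rewrite !mxE => h; rewrite -[RHS]h.
rewrite mulNr mulr_suml addrC -sumrB; apply: eq_bigr => i _.
rewrite !mxE; have -> : unlift 0 (lift ord0 i) = Some i by exact: liftK.
by rewrite mulrBr [in RHS]mulrA.
Qed.

Lemma char_poly_over (S : C -> Prop) m (A : 'M[C]_m) :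
  subring_pred S -> mx_in S A -> poly_in S (char_poly A).
Proof.
move=> SR hA; rewrite /char_poly /determinant.
apply: (big_ind (poly_in S)); [exact: over0 | by move=> *; apply: overD | move=> s _].
apply: overM => //.
  elim: (nat_of_bool _) => [|b IH]; first by rewrite expr0 -polyC1; apply: (overC SR); exact: sr1.
  rewrite exprS; apply: overM => //; rewrite -polyC1 -polyCN.
  by apply: (overC SR); apply: (srN SR); exact: sr1.
apply: (big_ind (poly_in S)); first by rewrite -polyC1; apply: (overC SR); exact: sr1.
  by move=> *; apply: overM.
move=> i _; rewrite !mxE; apply: overB => //; last exact: overC.
by rewrite -mulr_natr; apply: overM => //; [exact: overX | rewrite -polyC_natr; apply: overC => //; case: eqP => _; [exact: sr1 | exact: sr0]].
Qed.

Lemma algebraic_entries_eigenvalue m (A : 'M[C]_m) (v : 'rV_m) c :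
  mx_in algebraic A -> v != 0 -> v *m A = c *: v -> algebraic c.
Proof.
move=> hA v0 vA; apply: (@alg_root (char_poly A)).
- by rewrite monic_neq0 // char_poly_monic.
- exact: char_poly_over alg_subring hA.
- by rewrite -eigenvalue_root_char; apply/eigenvalueP; exists v.
Qed.

Lemma kermx_row_mx (F : fieldType) m q r (M : 'M[F]_(m, q)) (N : 'M_(m, r)) :
  (\rank (row_mx M N) <= \rank M)%N -> (kermx M <= kermx (row_mx M N))%MS.
Proof.
move=> rk; have sub : (kermx (row_mx M N) <= kermx M)%MS.
  apply/sub_kermxP; have := mulmx_ker (row_mx M N).
  by rewrite mul_mx_row => /eqP; rewrite row_mx_eq0 => /andP[/eqP].
by rewrite -(mxrank_leqif_sup sub).2 eqn_leq (mxrankS sub) !mxrank_ker leq_sub2l.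
Qed.

(** The weights are eigenvalues of matrices with algebraic entries, hence algebraic. The vectors of
    weight chi solve a possibly infinite linear system with algebraic coefficients; a finite system
    of largest rank among those satisfied by v implies all its equations. *)
Lemma eigenvector_descent n m (X : 'M[C]_n -> Prop) (L : 'M[C]_(m, n)) R :
  (forall A, X A -> mx_in algebraic A) -> mx_in algebraic L -> mx_in algebraic R ->
  has_common_eigenvector X L R ->
  exists2 v : 'rV_m, v != 0 /\ mx_in algebraic v &
    forall A, X A -> exists c, v *m (L *m A *m R) = c *: v.
Proof.
move=> hX hL hR [v v0 vP].
have algR := alg_subring.
have chiH A : exists c, X A -> v *m (L *m A *m R) = c *: v.
  case: (pselect (X A)) => [/vP[c cP]|nX]; last by exists 0.
  by exists c.
have [chi chiP] := choice chiH.
pose N A := L *m A *m R - (chi A)%:M.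
have hN A : X A -> mx_in algebraic (N A).
  move=> XA; have hrho : mx_in algebraic (L *m A *m R).
    by do 2?apply: (mx_inM algR) => //; apply: hX.
  move=> i j; rewrite !mxE; apply: (srB algR); first by have := hrho i j; rewrite mxE.
  case: eqP => _; last exact: sr0.
  exact: algebraic_entries_eigenvalue hrho v0 (chiP A XA).
have vN A : X A -> v *m N A = 0.
  by move=> XA; rewrite mulmxBr chiP // mul_mx_scalar subrr.
pose P (M : {q : nat & 'M[C]_(m, q)}) := mx_in algebraic (projT2 M) /\ v *m projT2 M = 0.
have [|[q M] [/= hM vM] max] := @minimal_witness _ P (fun M => m - \rank (projT2 M))%N.
  exists (existT _ 0 (0 : 'M_(m, 0))); split=> [i j|] /=; last exact: mulmx0.
  by case: j.
have [|u [u0 hu] uM] := @kernel_over algebraic m q M algR algV hM; first by exists v.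
exists u => // A XA; exists (chi A).
have PMN : P (existT _ (q + m)%N (row_mx M (N A))).
  split=> /=; last by rewrite mul_mx_row vM vN // row_mx0.
  by move=> i j; rewrite mxE; case: split => k //; apply: hN.
have := max _ PMN; rewrite /= => le.
have rk : (\rank (row_mx M (N A)) <= \rank M)%N.
  by have := rank_leq_row M; have := rank_leq_row (row_mx M (N A)); lia.
have ker := kermx_row_mx rk.
have /sub_kermxP : (u <= kermx (row_mx M (N A)))%MS.
  by apply: submx_trans ker; apply/sub_kermxP.
rewrite mul_mx_row => /eqP; rewrite row_mx_eq0 => /andP[_].
by rewrite mulmxBr mul_mx_scalar subr_eq0 => /eqP.
Qed.

(** The first vector of the triangular basis with nonzero image in the quotient is a common
    eigenvector there. *)
Lemma trig_quotient_eigenvector n m (X : 'M[C]_n -> Prop) (P : 'M_n) (L : 'M[C]_(m, n)) R :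
  P \in unitmx -> (forall A, X A -> is_trig_mx (P *m A *m invmx P)) ->
  (0 < m)%N -> quotient_representation X L R -> has_common_eigenvector X L R.
Proof.
move=> uP PT m0 [LR AR].
have PR0 : P *m R != 0.
  apply: contraTneq m0 => PR; have R0 : R = 0 by rewrite -(mulKmx uP R) PR mulmx0.
  move: LR; rewrite R0 mulmx0 => /matrixP; case: m {L R AR PR R0} => // m' /(_ 0 0).
  by rewrite !mxE eqxx => /eqP; rewrite eq_sym oner_eq0.
have ex : exists i, row i (P *m R) != 0.
  apply/existsP; rewrite -negb_forall; apply: contra PR0 => /forallP h.
  by apply/eqP/row_matrixP => i; rewrite row0; apply/eqP.
have [i i0 min] := @minimal_witness _ _ (fun i : 'I_n => i : nat) ex.
exists (row i (P *m R)) => // A XA; exists ((P *m A *m invmx P) i i).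
have E : row i (P *m R) *m (L *m A *m R) = row i ((P *m A *m invmx P) *m (P *m R)).
  by rewrite -row_mul -mulmxA -(AR A XA) !mulmxA mulmxKV.
rewrite E row_mul mulmx_sum_row (bigD1 i) //= big1 ?addr0 => [|j ji]; first by rewrite [(row _ _) _ _]mxE.
have [lt|] := ltnP i j; first by rewrite [(row _ _) _ _]mxE (is_trig_mxP (PT A XA)) // scale0r.
rewrite leq_eqVlt (inj_eq val_inj) (negPf ji) /= => lt.
suff /eqP -> : row j (P *m R) == 0 by rewrite scaler0.
by apply/negPn/negP => /min; rewrite leqNgt lt.
Qed.

Lemma derived_series_sub n (X : 'M[C]_n -> Prop) : is_subgroup X -> solvable_grp X ->
  exists N, forall A, iter N (@derived n) X A -> A = 1%:M.
Proof.
move=> hX [N [H [H0 HN Hg Hs Hc]]]; exists N => A.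
suff sub i B : iter i (@derived n) X B -> H i B by move/sub; apply: HN.
elim: i B => [|i IH] B; first by move/H0.
rewrite iterS; elim=> [|w a b _ hw ha hb]; first by case: (Hg i.+1) => _ [].
by case: (Hg i.+1) => _ [_ [HM _]]; apply: HM => //; apply: Hc; apply: IH.
Qed.

(** B may contain matrices with transcendental entries, so Lie-Kolchin only gives a complex basis.
    It provides eigenvectors of H in every quotient, and these descend to algebraic numbers because
    H has entries in k. The finitely many entries of the new basis generate K. *)
Theorem triangular_over_number_field n k (B H : 'M[C]_n -> Prop) :
  number_field k -> is_subgroup B -> zariski_connected B -> solvable_grp B ->
  (forall A, H A -> B A /\ mx_in k A) ->
  exists2 K, number_field K /\ (forall x, k x -> K x) &
    exists2 P : 'M_n, P \in unitmx /\ mx_in K P &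
      forall A, H A -> is_trig_mx (P *m A *m invmx P).
Proof.
move=> kP hB con sol HB.
have [N triv] := derived_series_sub hB sol.
have rep1 (X : 'M[C]_n -> Prop) : quotient_representation X (1%:M : 'M_n) 1%:M.
  by split=> [|A _]; rewrite !mulmx1 // !mul1mx.
have T_ring : subring_pred (fun _ : C => True) by [].
have eigB m (L : 'M[C]_(m, n)) R : (0 < m)%N -> mx_in (fun=> True) L -> mx_in (fun=> True) R ->
    quotient_representation B L R -> exists2 v : 'rV_m, v != 0 /\ mx_in (fun=> True) v &
    forall A, B A -> exists c, v *m (L *m A *m R) = c *: v.
  move=> m0 _ _ /quotient_representationP rep.
  by have [v v0 vP] := lie_kolchin_eigenvector hB con triv m0 rep; exists v.
have [//|//|P1 [uP1 _] P1T] := triangularize T_ring (fun _ _ => I) eigB _ _ (rep1 B).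
have eigH m (L : 'M[C]_(m, n)) R : (0 < m)%N -> mx_in algebraic L -> mx_in algebraic R ->
    quotient_representation H L R -> exists2 v : 'rV_m, v != 0 /\ mx_in algebraic v &
    forall A, H A -> exists c, v *m (L *m A *m R) = c *: v.
  move=> m0 hL hR rep; apply: eigenvector_descent => //.
    by move=> A /HB[_ kA] i j; apply: nf_alg kP (kA i j).
  apply: (@trig_quotient_eigenvector _ _ _ P1) => // A /HB[BA _].
  by have := P1T A BA; rewrite mul1mx mulmx1.
have [P [uP hP] PT] := triangularize alg_subring algV eigH
  (mx_in1 alg_subring (m := n)) (mx_in1 alg_subring (m := n)) (rep1 H).
have [|K KP [kK sK]] := @nf_adjoin_seq k [seq P ij.1 ij.2 | ij <- enum {: 'I_n * 'I_n}] kP.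
  by move=> _ /mapP[[i j] _ ->]; apply: hP.
exists K => //; exists P.
  by split=> // i j; apply: sK; apply/mapP; exists (i, j); rewrite ?mem_enum.
by move=> A /PT; rewrite mul1mx mulmx1.
Qed.

(** * Dirichlet's unit theorem *)

Notation Rl := Rdefinitions.R.

Definition abslog (z : C) : Rl := Rpower.ln (complex.Re `|z|).

Lemma normC_Re (z : C) : `|z| = (complex.Re `|z|)%:C%C.
Proof. by rewrite normc_def. Qed.

Lemma Re_norm_gt0 (z : C) : z != 0 -> 0 < complex.Re `|z|.
Proof. by move=> z0; rewrite -ltcR -normC_Re normr_gt0. Qed.

Lemma abslogM x y : x != 0 -> y != 0 -> abslog (x * y) = abslog x + abslog y.
Proof.
move=> x0 y0; rewrite /abslog normrM normC_Re [`|y|]normC_Re -rmorphM /=.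
by apply: Rpower.ln_mult; apply/RltP; apply: Re_norm_gt0.
Qed.

Lemma norm_le_abslog x B : x != 0 -> abslog x <= B -> `|x| <= (Rtrigo_def.exp B)%:C%C.
Proof.
move=> x0 /RleP xB; rewrite normC_Re lecR; apply/RleP.
rewrite -(Rpower.exp_ln (complex.Re `|x|)); last by apply/RltP; apply: Re_norm_gt0.
rewrite -/(abslog x); case: xB => [/Rpower.exp_increasing h|->]; [by left|by right].
Qed.

Lemma finite_of_code (T : Type) (U : finType) (P : T -> Prop) (code : T -> U) :
  (forall x y, P x -> P y -> code x = code y -> x = y) ->
  exists s : seq T, (forall x, P x -> List.In x s) /\ forall x, List.In x s -> P x.
Proof.
move=> inj.
have h (u : U) : exists o : option T,
    (forall x, P x -> code x = u -> o = Some x) /\ forall x, o = Some x -> P x.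
  case: (pselect (exists2 x, P x & code x = u)) => [[x Px xu]|no].
    by exists (Some x); split=> [y Py yu|y [<-]] //; congr Some; apply: inj; rewrite ?xu ?yu.
  by exists None; split => // x Px xu; case: no; exists x.
have [o oP] := fin_choice h.
exists (pmap o (enum U)); split.
  move=> x Px; have ox := (oP (code x)).1 x Px erefl.
  have : code x \in enum U by rewrite mem_enum.
  elim: (enum U) => // u r IH; rewrite inE /= => /predU1P[<-|/IH h']; first by rewrite ox /=; left.
  by case: (o u) => [y|] //=; right.
move=> x; elim: (enum U) => //= u r IH; case E: (o u) => [y|] //=.
by case=> [<-|//]; apply: (oP u).2.
Qed.

Lemma trig_mul_diag (R : pzRingType) d (A B : 'M[R]_d) i :
  is_trig_mx A -> is_trig_mx B -> (A *m B) i i = A i i * B i i.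
Proof.
move=> /is_trig_mxP hA /is_trig_mxP hB; rewrite mxE (bigD1 i) //= big1 ?addr0 // => j ji.
case: (ltngtP i j) => [ij|ij|/val_inj ij]; last by rewrite ij eqxx in ji.
  by rewrite hA // mul0r.
by rewrite hB // mulr0.
Qed.

Section Characters.
Variable k : C -> Prop.
Hypothesis kP : number_field k.
Variables (d : nat) (e : 'I_d -> C).
Hypotheses (fe : qfree e) (eO : forall x, ring_of_integers k x <-> in_span e x).

Lemma ek i : k (e i).
Proof. by have /eO/(ring_of_integersE k)[] := in_span_e e i. Qed.

Lemma nf_qspan_integral x : k x -> exists c, x = qspan e c.
Proof.
move=> kx; have [N N0 aN] := nf_denominator kP kx.
have /eO[z zE] : ring_of_integers k (N%:R * x).
  by apply/(ring_of_integersE k); split => //; apply: (nfM kP) => //; exact: nf_nat.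
exists (N%:R^-1 *: map_mx intr z); rewrite qspanZ.
have -> : qspan e (map_mx intr z) = zspan e z.
  by apply: eq_bigr => i _; rewrite mxE ratr_int.
by rewrite -zE fmorphV rmorph_nat mulKf // pnatr_eq0 -lt0n.
Qed.

(* The complex embeddings of k, read off as diagonal entries after
   triangularizing the multiplication matrices simultaneously. *)
Lemma characters : exists lam : 'I_d -> C -> C,
  [/\ forall i x y, k x -> k y -> lam i (x * y) = lam i x * lam i y,
      forall i, lam i 1 = 1 &
      exists T : C -> rat, [/\ forall x y, k x -> k y -> T (x - y) = T x - T y,
        forall q x, k x -> T (ratr q * x) = q * T x,
        forall x, k x -> ratr (T x) = \sum_i lam i x,
        T 1 = d%:R &
        forall x, ring_of_integers k x -> T x \is a Num.int]].
Proof.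
have bs := nf_qspan_integral.
have [M MP] := mult_matrix kP ek bs.
pose X (A : 'M[C]_d) := exists2 x, k x & A = map_mx ratr (M x).
have XC A B : X A -> X B -> A *m B = B *m A.
  move=> [x kx ->] [y ky ->]; rewrite -!map_mxM.
  by rewrite -!(mult_matrixM kP fe MP) // mulrC.
have T_ring : subring_pred (fun _ : C => True) by [].
have rep1 : quotient_representation X (1%:M : 'M_d) 1%:M.
  by split=> [|A _]; rewrite !mulmx1 // !mul1mx.
have eig m (L : 'M[C]_(m, d)) R : (0 < m)%N -> mx_in (fun=> True) L -> mx_in (fun=> True) R ->
    quotient_representation X L R -> exists2 v : 'rV_m, v != 0 /\ mx_in (fun=> True) v &
    forall A, X A -> exists c, v *m (L *m A *m R) = c *: v.
  move=> m0 _ _ /quotient_representationP[_ LM].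
  have [|v v0 vP] := @commuting_eigenvector m (fun D => exists2 A, X A & D = L *m A *m R) m0.
    by move=> _ _ [A XA ->] [B XB ->]; rewrite -!LM // XC.
  by exists v => // A XA; apply: vP; exists A.
have [//|//|P [uP _] PT] := triangularize T_ring (fun _ _ => I) eig _ _ rep1.
have {}PT x : k x -> is_trig_mx (P *m map_mx ratr (M x) *m invmx P).
  by move=> kx; have := PT (map_mx ratr (M x)) (ex_intro2 _ _ x kx erefl); rewrite mul1mx mulmx1.
exists (fun i x => (P *m map_mx ratr (M x) *m invmx P) i i); split.
- move=> i x y kx ky; rewrite (mult_matrixM kP fe MP) // map_mxM.
  have -> : P *m (map_mx ratr (M x) *m map_mx ratr (M y)) *m invmx P =
      (P *m map_mx ratr (M x) *m invmx P) *m (P *m map_mx ratr (M y) *m invmx P).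
    by rewrite !mulmxA mulmxKV.
  by apply: trig_mul_diag; exact: PT.
- by move=> i; rewrite (mult_matrix1 kP fe MP) map_mx1 mulmx1 mulmxV // mxE eqxx.
exists (fun x => \tr (M x)); split.
- move=> x y kx ky; have -> : x - y = x + ratr (-1) * y by rewrite rmorphN1 mulN1r.
  rewrite (mult_matrixD kP fe MP) //; last by apply: (nfM kP) => //; exact: nf_rat.
  by rewrite (mult_matrixZ kP fe MP) // mxtraceD mxtraceZ mulN1r.
- by move=> q x kx; rewrite (mult_matrixZ kP fe MP) // mxtraceZ.
- move=> x kx; rewrite -trace_map_mx -[RHS]/(\tr (P *m map_mx ratr (M x) *m invmx P)).
  by rewrite mxtrace_mulC mulmxA mulVmx // mul1mx.
- by rewrite (mult_matrix1 kP fe MP) mxtrace1.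
- by move=> x /(ring_of_integersE k)[kx ax]; apply: (trace_int kP ek fe bs MP).
Qed.

(** The traces of the products x * e j are integers, bounded through the embeddings, and they
    determine x because the trace form is nondegenerate. *)
Lemma finite_bounded_integers (lam : 'I_d -> C -> C) (T : C -> rat) (B : Rl) :
  (forall i x y, k x -> k y -> lam i (x * y) = lam i x * lam i y) ->
  (forall x y, k x -> k y -> T (x - y) = T x - T y) ->
  (forall q x, k x -> T (ratr q * x) = q * T x) ->
  (forall x, k x -> ratr (T x) = \sum_i lam i x) -> T 1 = d%:R ->
  (forall x, ring_of_integers k x -> T x \is a Num.int) ->
  exists s : seq C, (forall x, ring_of_integers k x /\ (forall i, `|lam i x| <= B%:C%C) -> List.In x s)
    /\ forall x, List.In x s -> ring_of_integers k x /\ forall i, `|lam i x| <= B%:C%C.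
Proof.
move=> lamM TB TZ Tlam T1 Tint.
have OR := OK_subring kP.
have eOi i : ring_of_integers k (e i) by apply/eO; exact: in_span_e.
have kO x : ring_of_integers k x -> k x by move/(ring_of_integersE k) => [].
pose S : C := \sum_i \sum_j `|lam i (e j)| * B%:C%C.
have [b bP] : exists b : nat, `|S| < b%:R.
  exists (Num.bound (complex.Re `|S|)); rewrite {1}normC_Re -(rmorph_nat (real_complex Rl)) ltcR.
  by apply: archi_boundP; rewrite -lecR -(normC_Re S); exact: normr_ge0.
pose P x := ring_of_integers k x /\ forall i, `|lam i x| <= B%:C%C.
pose code x : {ffun 'I_d -> 'I_(2 * b).+1} := [ffun j => inord (absz (numq (T (x * e j)) + b%:Z))].
apply: (@finite_of_code _ _ P code) => x y [xO xB] [yO yB] xy.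
have kx := kO x xO; have ky := kO y yO.
have TE z : ring_of_integers k z -> (numq (T z))%:~R = T z by move=> /Tint /numqK.
have bnd z j : P z -> (absz (numq (T (z * e j)%R)) <= b)%N.
  move=> [zO zB]; have zeO : ring_of_integers k (z * e j) by apply: (srM OR).
  rewrite -(ler_nat C) natr_absz intr_norm -(ratr_int C) TE // Tlam; last exact: kO.
  apply: le_trans (ltW bP); apply: le_trans (ler_norm_sum _ _ _) _.
  have B0 i : 0 <= `|lam i (e j)| * B%:C%C by rewrite mulr_ge0 // (le_trans _ (zB i)).
  apply: le_trans (real_ler_norm _); last first.
    rewrite ger0_real //; apply: sumr_ge0 => i _; apply: sumr_ge0 => l _.
    by rewrite mulr_ge0 // (le_trans _ (zB i)).
  apply: ler_sum => i _; rewrite (bigD1 j) //= lamM //; try exact: kO.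
  rewrite normrM mulrC; apply: ler_wpDr; last by rewrite ler_wpM2l.
  by apply: sumr_ge0 => l _; rewrite mulr_ge0 // (le_trans _ (zB i)).
have Te j : T ((x - y) * e j) = 0.
  have kxe : k (x * e j) by apply: (nfM kP) => //; exact: ek.
  have kye : k (y * e j) by apply: (nfM kP) => //; exact: ek.
  rewrite mulrBl TB // -(TE (x * e j)); last exact: (srM OR).
  rewrite -(TE (y * e j)); last exact: (srM OR).
  apply/eqP; rewrite subr_eq0 eqr_int; apply/eqP.
  have bx := bnd x j (conj xO xB); have by_ := bnd y j (conj yO yB).
  move/ffunP/(_ j): xy; rewrite !ffunE => /(congr1 (@nat_of_ord _)).
  rewrite !inordK ?ltnS; lia.
apply/eqP; rewrite -subr_eq0; apply/negPn/negP => xy0.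
have kxy : k (x - y) by apply: (nfB kP).
have [c cE] := nf_qspan_integral (nfV kP kxy).
(* Orthogonality to the basis e extends to all of k, in particular to the inverse of x - y, where
   the trace is d. *)
have : T ((x - y) * (x - y)^-1) = 0.
  have T0 : T 0 = 0 by rewrite -(subrr 0) TB ?subrr //; exact: nf0.
  rewrite cE /qspan mulr_sumr; elim: (index_enum _) => [|i r IH]; first by rewrite big_nil.
  have kt j : k ((x - y) * (ratr (c 0 j) * e j)).
    by do 2 apply: (nfM kP) => //; [exact: nf_rat|exact: ek].
  rewrite big_cons -[X in T (_ + X)]opprK TB //; last by apply: (nfN kP); apply: nf_sum.
  rewrite -[X in _ - T X]sub0r TB; [|exact: nf0|by apply: nf_sum].
  rewrite IH T0 !subr0 mulrCA TZ; last by apply: (nfM kP) => //; exact: ek.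
  by rewrite Te mulr0.
rewrite divff // T1 => /eqP; rewrite pnatr_eq0 -leqn0 leqNgt.
by rewrite (nf_dim_gt0 kP nf_qspan_integral).
Qed.
End Characters.

Lemma row_free_extend (F : fieldType) q d (W : 'M[F]_(q, d)) (v : 'rV_d) :
  row_free W -> ~~ (v <= W)%MS -> row_free (col_mx W v).
Proof.
move=> fW vW; apply: inj_row_free => u; rewrite -[u]hsubmxK mul_row_col.
move: (lsubmx u) (rsubmx u) => a b; rewrite [b]mx11_scalar mul_scalar_mx => h.
have [b0|b0] := eqVneq (b 0 0) 0.
  move: h; rewrite b0 scale0r addr0 => h.
  have -> : a = 0 by apply: (row_free_inj fW); rewrite mul0mx.
  by rewrite raddf0 row_mx0.
case/negP: vW; apply/submxP; exists (- (b 0 0)^-1 *: a).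
move/eqP: h; rewrite addr_eq0 -scalemxAl => /eqP ->.
by rewrite scalerN scaleNr opprK scalerA mulVf // scale1r.
Qed.

Section Discrete.
Variables (F : archiRealFieldType) (L : fieldType) (d : nat).
Variables (U : L -> Prop) (lv : L -> 'rV[F]_d).
Hypotheses (U1 : U 1) (UM : forall x y, U x -> U y -> U (x * y)).
Hypotheses (UV : forall x, U x -> U x^-1) (U0 : forall x, U x -> x != 0).
Hypothesis (lvM : forall x y, U x -> U y -> lv (x * y) = lv x + lv y).

Lemma group_prod I (r : seq I) (w : I -> L) (z : I -> int) :
  (forall i, U (w i)) ->
  U (\prod_(i <- r) w i ^ z i) /\
  lv (\prod_(i <- r) w i ^ z i) = \sum_(i <- r) (z i)%:~R *: lv (w i).
Proof.
move=> Uw; have lv1 : lv 1 = 0.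
  by apply: (addrI (lv 1)); rewrite -lvM // mulr1 addr0.
have lvV x : U x -> lv x^-1 = - lv x.
  by move=> Ux; apply/eqP; rewrite -addr_eq0 -lvM ?mulVf ?lv1 //; [exact: U0|exact: UV].
have hX x m : U x -> U (x ^+ m) /\ lv (x ^+ m) = m%:R *: lv x.
  move=> Ux; elim: m => [|m [IH1 IH2]]; first by rewrite expr0 scale0r lv1.
  rewrite exprS; split; first exact: UM.
  by rewrite lvM // IH2 -[X in X + _]scale1r -scalerDl -natr1 addrC.
have hz x (a : int) : U x -> U (x ^ a) /\ lv (x ^ a) = a%:~R *: lv x.
  move=> Ux; case: a => m; first by have := hX x m Ux; rewrite exprnP.
  rewrite NegzE -invr_expz -exprnP; have [h1 h2] := hX x m.+1 Ux; split; first exact: UV.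
  by rewrite lvV // h2 mulrNz scaleNr.
elim: r => [|i r [IH1 IH2]]; first by rewrite !big_nil lv1.
by rewrite !big_cons; have [h1 h2] := hz _ (z i) (Uw i); split; [exact: UM|rewrite lvM // h2 IH2].
Qed.

(* Modulo a maximal independent family every element has a bounded logarithm. *)
Lemma discrete_finitely_generated :
  (forall B : F, exists s : seq L, forall x, U x -> (forall i, `|lv x 0 i| <= B) -> List.In x s) ->
  exists r, exists2 u : 'I_r -> L, (forall i, U (u i)) &
    forall x, U x -> exists z : 'rV[int]_r, x = \prod_i u i ^ z 0 i.
Proof.
move=> fin.
pose mat q (w : 'I_q -> L) := \matrix_i lv (w i).
pose P (t : {q & 'I_q -> L}) := (forall i, U (tagged t i)) /\ row_free (mat _ (tagged t)).
have exP : exists t, P t.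
  exists (existT (fun q => 'I_q -> L) 0%N (fun=> 1)); split=> [[]|] //=.
  by rewrite /row_free -leqn0 rank_leq_row.
have [[q w] [/= Uw fw] maxw] := minimal_witness (fun t : {q & 'I_q -> L} => d - tag t)%N exP.
have spanned x : U x -> (lv x <= mat q w)%MS.
  move=> Ux; apply: contraT => nx.
  pose w' (i : 'I_(q + 1)) := match split i with inl j => w j | inr _ => x end.
  have Pw' : P (Tagged (fun q => 'I_q -> L) w').
    split=> [i|] /=; first by rewrite /w'; case: split.
    have -> : mat _ w' = col_mx (mat q w) (lv x).
      by apply/matrixP => i j; rewrite !mxE /w'; case: split => l; rewrite ?mxE // ord1.
    exact: row_free_extend.
  have := maxw _ Pw'; rewrite /=; have := rank_leq_col (mat _ w').
  rewrite (eqP Pw'.2) /=. lia.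
(* This sum bounds every logarithm whose coefficients over the family lie between 0 and 1; the list
   s catches the remainders after division by powers of w. *)
have [s sP] := fin (\sum_i \sum_j `|mat q w i j|).
pose u (i : 'I_(q + size s)) := match split i with
  | inl j => w j | inr j => if `[< U (nth 1 s j) >] then nth 1 s j else 1 end.
exists (q + size s)%N; exists u.
  by move=> i; rewrite /u; case: split => // j; case: asboolP.
move=> x Ux; have /submxP[c cE] := spanned x Ux.
pose z : 'I_q -> int := fun i => Num.floor (c 0 i).
have [Up lvp] := group_prod (index_enum 'I_q) (fun i => - z i) Uw.
pose y := x * \prod_i w i ^ (- z i).
have Uy : U y by apply: UM.
have yB j : `|lv y 0 j| <= \sum_i \sum_l `|mat q w i l|.
  rewrite lvM // lvp cE !mxE summxE -big_split /=.
  apply: le_trans (ler_norm_sum _ _ _) _; apply: ler_sum => i _.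
  rewrite !mxE mulrNz mulNr -mulrBl normrM (bigD1 j) //= mxE.
  apply: ler_wpDr; first by apply: sumr_ge0.
  rewrite ler_piMl // ger0_norm ?subr_ge0 ?ge_floor // lerBlDl ltW //.
  by have := floorD1_gt (c 0 i); rewrite -/(z i) rmorphD addrC.
have ys : y \in s.
  by have := sP y Uy yB; elim: (s) => //= a r IH [->|/IH]; rewrite inE ?eqxx // orbC => ->.
have js : (index y s < size s)%N by rewrite index_mem.
exists (row_mx (\row_i z i) (delta_mx 0 (Ordinal js))).
rewrite big_split_ord /= [X in _ * X](bigD1 (Ordinal js)) //= [X in _ * (_ * X)]big1 ?mulr1.
  rewrite row_mxEr mxE !eqxx /u; case: (split _) (unsplitK (inr (Ordinal js) : 'I_q + 'I_(size s))).
  - by [].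
  move=> _ [->] /=; rewrite nth_index // asboolT // expr1z.
  rewrite /y mulrCA -big_split /= big1 ?mulr1 // => i _.
  rewrite row_mxEl mxE; case: (split _) (unsplitK (inl i : 'I_q + 'I_(size s))) => [_ [->]|//].
  by rewrite -expfzDr ?U0 // subrr expr0z.
by move=> j /negPf nj; rewrite row_mxEr mxE eqxx nj expr0z.
Qed.
End Discrete.

Section Units.
Variable k : C -> Prop.
Hypothesis kP : number_field k.

Lemma unitM x y : unit_of k x -> unit_of k y -> unit_of k (x * y).
Proof.
have OR := OK_subring kP.
move=> [x0 xO xV] [y0 yO yV]; split; first by rewrite mulf_neq0.
  exact: (srM OR).
by rewrite invfM; apply: (srM OR).
Qed.

Lemma unitV x : unit_of k x -> unit_of k x^-1.
Proof. by case=> x0 xO xV; split; rewrite ?invrK // invr_eq0. Qed.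

Lemma unit1 : unit_of k 1.
Proof. by have OR := OK_subring kP; split; rewrite ?oner_eq0 ?invr1 //; apply: sr1 OR. Qed.

Lemma unit_nf x : unit_of k x -> k x.
Proof. by case=> _ /(ring_of_integersE k)[]. Qed.

Lemma unitX x m : unit_of k x -> unit_of k (x ^+ m).
Proof.
by move=> ux; elim: m => [|m IH]; rewrite ?expr0 ?exprS; [exact: unit1|exact: unitM].
Qed.

Lemma embeddings : exists d, exists lam : 'I_d -> C -> C,
  [/\ forall i x y, k x -> k y -> lam i (x * y) = lam i x * lam i y,
      forall i, lam i 1 = 1 &
      forall B : Rl, exists s : seq C, forall x, ring_of_integers k x ->
        (forall i, `|lam i x| <= B%:C%C) -> List.In x s].
Proof.
have [d [e fe eO]] := integral_basis kP.
have [lam [lamM lam1 [T [TB TZ Tlam T1 Tint]]]] := characters kP fe eO.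
exists d, lam; split => // B.
have [s [sP _]] := finite_bounded_integers kP eO B lamM TB TZ Tlam T1 Tint.
by exists s => x xO xB; apply: sP.
Qed.

Theorem units_finitely_generated : exists r, exists2 u : 'I_r -> C, (forall i, unit_of k (u i)) &
  forall x, unit_of k x -> exists z : 'rV[int]_r, x = \prod_i u i ^ z 0 i.
Proof.
have [d [lam [lamM lam1 fin]]] := embeddings.
have lam0 i x : unit_of k x -> lam i x != 0.
  move=> ux; have := lamM i _ _ (unit_nf ux) (unit_nf (unitV ux)).
  rewrite divff; last by case: ux.
  by move/eqP; rewrite lam1; apply: contraTneq => ->; rewrite mul0r oner_eq0.
apply: (@discrete_finitely_generated _ _ d _ (fun x => \row_i abslog (lam i x))).
- exact: unit1.
- exact: unitM.
- exact: unitV.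
- by move=> x [].
- move=> x y ux uy; apply/rowP => i.
  by rewrite !mxE lamM ?abslogM ?lam0 //; apply: unit_nf.
move=> B; have [s sP] := fin (Rtrigo_def.exp B).
exists s => x ux xB; apply: sP => [|i]; first by case: ux.
by apply: norm_le_abslog; rewrite ?lam0 // (le_trans _ (xB i)) // mxE ler_norm.
Qed.

(** All powers of a root of unity have absolute value at most 1 under every embedding, so its order
    is at most the length of a finite list; the factorial is a common multiple. *)
Lemma roots_of_unity_bounded : exists2 W : nat, (0 < W)%N &
  forall m omega, m.-primitive_root omega -> k omega -> (m %| W)%N.
Proof.
have [d [lam [lamM lam1 fin]]] := embeddings.
have [s sP] := fin 1; exists (size s)`!; first exact: fact_gt0.
move=> m omega pm ko; have m0 := prim_order_gt0 pm.
suff ms : (m <= size s)%N by apply: dvdn_fact; rewrite m0.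
have kX j : k (omega ^+ j) by apply: nfX.
have lamX i j x : k x -> lam i (x ^+ j) = lam i x ^+ j.
  by move=> kx; elim: j => [|j IH]; rewrite ?expr0 // !exprS lamM ?IH //; apply: nfX.
have In_mem x (r : seq C) : List.In x r -> x \in r.
  by elim: r => //= a r IH [->|/IH]; rewrite inE ?eqxx // orbC => ->.
have sub : {subset [seq omega ^+ j | j : 'I_m] <= s}.
  move=> _ /mapP[j _ ->]; apply: In_mem; apply: sP => [|i].
    apply/(ring_of_integersE k); split => //; apply: aintX.
    apply: (@aint_root_monic ('X^m - 1)); first by apply: monicXnsubC.
    - by move=> i; rewrite coefB coefXn coef1; apply: aintB; apply: aint_nat.
    - by rewrite /root !hornerE (prim_expr_order pm) subrr.
  rewrite rmorph1 lamX // normrX exprn_ile1 // -(ler_pXn2r m0) ?nnegrE //.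
  by rewrite expr1n -normrX -lamX // (prim_expr_order pm) lam1 normr1.
have := uniq_leq_size _ sub; rewrite size_map -cardE card_ord; apply.
rewrite map_inj_in_uniq ?enum_uniq // => i j _ _ /eqP.
by rewrite (eq_prim_root_expr pm) !modn_small // => /eqP/val_inj.
Qed.
End Units.

(** * Congruence subgroups of the unit group *)

(** Among #|U| + 1 powers of a, two share a code, so a ^+ (j - i) is 1 modulo J with j - i at most
    #|U|. The ring may be noncommutative: the lemma serves units and matrices alike. *)
Lemma power_congruent_one (R : pzRingType) (S J : R -> Prop) (U : finType) (code : R -> U) :
  (forall x y, S x -> S y -> code x = code y -> J (x - y)) ->
  S 1 -> (forall x y, S x -> S y -> S (x * y)) -> (forall x y, S x -> S y -> S (x + y)) ->
  S 0 -> (forall x y, S x -> J y -> J (x * y)) -> (forall x y, S x -> J y -> J (y * x)) ->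
  forall a b, S a -> S b -> a * b = 1 -> b * a = 1 -> J (a ^+ #|U|`! - 1).
Proof.
move=> codeP S1 SM SD S0 JM JMr a b Sa Sb ab ba.
have SX x m : S x -> S (x ^+ m).
  by move=> Sx; elim: m => [|m IH]; rewrite ?expr0 ?exprS //; apply: SM.
have [|i [j [ij eqc]]] := @pigeonhole 'I_#|U|.+1 U (fun i => code (a ^+ i)).
  by rewrite card_ord.
wlog ltij : i j ij eqc / (i < j)%N.
  move=> H; case: (ltngtP i j) => [lt|lt|/val_inj e]; first exact: (H i j).
    by apply: (H j i) => //; rewrite eq_sym.
  by rewrite e eqxx in ij.
have Jij := codeP _ _ (SX _ j Sa) (SX _ i Sa) (esym eqc).
have J1 : J (a ^+ (j - i) - 1).
  have -> : a ^+ (j - i) - 1 = b ^+ i * (a ^+ j - a ^+ i).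
    have bai : b ^+ i * a ^+ i = 1 by rewrite -exprMn_comm ?ba ?expr1n // /GRing.comm ab ba.
    by rewrite mulrBr bai -{2}(subnKC (ltnW ltij)) exprD mulrA bai mul1r.
  exact: JM (SX _ _ Sb) Jij.
have /dvdnP[q ->] : (j - i %| #|U|`!)%N.
  by apply: dvdn_fact; have := ltn_ord j; lia.
rewrite mulnC exprM subrX1; apply: JMr => //.
by apply: big_ind => // l _; exact: (SX _ _ (SX _ _ Sa)).
Qed.

Lemma prim_root_exists_closed (F : closedFieldType) n :
  n%:R != 0 :> F -> exists z : F, n.-primitive_root z.
Proof.
move=> nF; have n0 : (0 < n)%N by rewrite lt0n; apply: contraNneq nF => ->.
pose p : {poly F} := 'X^n - 1; have [r Dp] := closed_field_poly_normal p.
rewrite (monicP _) ?monicXnsubC // scale1r in Dp.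
have rn1 : all n.-unity_root r by apply/allP => z; rewrite -root_prod_XsubC -Dp.
have sz_r : (n < (size r).+1)%N by rewrite -(size_prod_XsubC r id) -Dp size_XnsubC.
have [|z _ zP] := hasP (has_prim_root n0 rn1 _ sz_r); last by exists z.
by rewrite -separable_prod_XsubC -Dp separable_Xn_sub_1.
Qed.

Lemma sr_nat (S : C -> Prop) : subring_pred S -> forall n, S n%:R.
Proof.
move=> RS; elim=> [|n IH]; first exact: (sr0 RS).
by rewrite -natr1; apply: (srD RS) => //; apply: (sr1 RS).
Qed.

Section Chevalley.
Variable k : C -> Prop.
Hypothesis kP : number_field k.

Lemma integer_residues Q : (0 < Q)%N -> exists (U : finType) (r : C -> U),
  forall x y, ring_of_integers k x -> ring_of_integers k y -> r x = r y ->
    exists2 w, ring_of_integers k w & x - y = Q%:R * w.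
Proof.
move=> Q0; have [d [e fe eO]] := integral_basis kP.
have /choice[z zP] x : exists z, ring_of_integers k x -> x = zspan e z.
  by case: (pselect (in_span e x)) => [[z ->]|h]; [exists z|exists 0 => /eO].
exists {ffun 'I_d -> 'I_Q.-1.+1}.
exists (fun x => [ffun i => inord (absz (z x 0%R i %% Q%:Z)%Z)]).
move=> x y /zP xE /zP yE /ffunP h.
pose w := \row_i ((z x 0%R i - z y 0%R i) %/ Q%:Z)%Z.
exists (zspan e w); first by apply/eO; exists w.
rewrite xE yE -zspanN -zspanD /zspan mulr_sumr; apply: eq_bigr => i _.
rewrite mulrA !mxE; congr (_ * _); rewrite -[Q%:R]/(Q%:Z%:~R) -intrM mulrC; congr (_%:~R).
have := h i; rewrite !ffunE => /(congr1 (@nat_of_ord _)).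
have Qz : Q%:Z != 0 by rewrite eqz_nat -lt0n.
have lt a : (absz (a %% Q%:Z)%Z < Q.-1.+1)%N.
  by rewrite prednK // -ltz_nat gez0_abs ?modz_ge0 ?ltz_pmod.
rewrite !inordK // => /(congr1 Posz); rewrite !gez0_abs ?modz_ge0 // => hm.
by rewrite divzK // -eqz_mod_dvd; apply/eqP.
Qed.

Lemma unit_power_congruent Q : (0 < Q)%N -> exists2 m, (0 < m)%N &
  forall x, unit_of k x -> exists2 w, aint w & x ^+ m - 1 = Q%:R * w.
Proof.
move=> /integer_residues[U [r rP]]; have OR := OK_subring kP.
exists #|U|`!; first exact: fact_gt0.
move=> x [x0 xO xV].
apply: (@power_congruent_one _ (ring_of_integers k)
  (fun y => exists2 w, aint w & y = Q%:R * w) U r _ _ _ _ _ _ _ x x^-1) => //.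
- move=> a b aO bO ab; have [w /(ring_of_integersE k)[_ aw] ->] := rP a b aO bO ab.
  by exists w.
- exact: sr1 OR.
- by move=> a b; apply: (srM OR).
- by move=> a b; apply: (srD OR).
- exact: sr0 OR.
- move=> a b /(ring_of_integersE k)[_ aa] [w aw ->]; exists (a * w); last by rewrite mulrCA.
  exact: aintM.
- move=> a b /(ring_of_integersE k)[_ aa] [w aw ->]; exists (w * a); last by rewrite mulrA.
  exact: aintM.
- exact: divff.
- exact: mulVf.
Qed.

(** If xi were not 1, the sum of its powers with exponents below W would be 0 and also congruent to
    W modulo W + 1, which would make W / (W + 1) an algebraic integer. *)
Lemma root_of_unity_congruent_one W xi w :
  (0 < W)%N -> xi ^+ W = 1 -> aint xi -> aint w -> xi - 1 = W.+1%:R * w -> xi = 1.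
Proof.
move=> W0 xW axi aw xiE; apply/eqP; rewrite -subr_eq0; apply/negPn/negP => x1.
have : \sum_(i < W) xi ^+ i = 0.
  apply: (mulfI x1); rewrite mulr0 -subrX1 xW subrr //.
have [a aa aE] : exists2 a, aint a & \sum_(i < W) xi ^+ i = W%:R + (xi - 1) * a.
  exists (\sum_(i < W) \sum_(j < i) xi ^+ j).
    by apply: aint_sum => i _; apply: aint_sum => j _; apply: aintX.
  rewrite mulr_sumr -[W in W%:R]card_ord -sumr_const -big_split /=.
  by apply: eq_bigr => i _; rewrite -subrX1 addrC subrK.
rewrite aE xiE => /eqP; rewrite addr_eq0 => /eqP WE.
have : aint (ratr (W%:Q / W.+1%:Q)).
  have -> : ratr (W%:Q / W.+1%:Q) = - (w * a).
    rewrite fmorph_div !rmorph_nat; apply: (mulfI (_ : W.+1%:R != 0 :> C)); first by rewrite pnatr_eq0.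
    by rewrite mulrC divfK ?pnatr_eq0 // WE mulrN mulrA.
  by apply: aintN; apply: aintM.
move=> /aint_rat/intrP[b bE].
have h : W%:Q = b%:~R * W.+1%:Q by rewrite -bE divfK // pnatr_eq0.
move: h; rewrite -[W%:Q]/(W%:Z%:~R) -[W.+1%:Q]/(W.+1%:Z%:~R) -intrM => /intr_inj h.
have : (W.+1%:Z %| W%:Z)%Z by apply/dvdzP; exists b.
by rewrite dvdzE /= => /dvdn_leq; rewrite ltnn => /(_ W0).
Qed.

(* After adjoining a root of unity zeta, one modulus excludes each of the finitely
   many classes of units modulo M1-th powers that are not M1-th powers in k(zeta).
   The factor W in M1 pays for the descent to k, and the factor W.+1 of the modulus
   kills the remaining root of unity. *)
Theorem chevalley M : (0 < M)%N -> exists2 Q, (0 < Q)%N & forall x, unit_of k x ->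
  (exists2 w, aint w & x - 1 = Q%:R * w) -> exists2 z, unit_of k z & x = z ^+ M.
Proof.
move=> M0; have [W W0 WP] := roots_of_unity_bounded kP.
have [m m0 mP] := unit_power_congruent (ltn0Sn W).
(* The factor m makes the M2-th power of every unit congruent to 1 modulo W.+1. *)
pose M2 := (M * m)%N; pose M1 := (W * M2)%N.
have M20 : (0 < M2)%N by rewrite muln_gt0 M0.
have M10 : (0 < M1)%N by rewrite muln_gt0 W0.
have [zeta zP] : exists zeta : C, M1.-primitive_root zeta by apply: prim_root_exists_closed; rewrite pnatr_eq0 -lt0n.
have azeta : algebraic zeta.
  apply: aint_alg; apply: (@aint_root_monic ('X^M1 - 1)); first by apply: monicXnsubC.
    by move=> i; rewrite coefB coefXn coef1; apply: aintB; apply: aint_nat.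
  by rewrite /root !hornerE (prim_expr_order zP) subrr.
have [F FP [kF FE]] := nf_adjoin kP azeta.
have [r [u uU uG]] := units_finitely_generated kP.
pose c (v : {ffun 'I_r -> 'I_M1}) := \prod_i u i ^+ v i.
have Uc v : unit_of k (c v).
  by apply: big_ind => [||i _]; [exact: unit1|exact: unitM|exact: unitX].
have unitF x : unit_of k x -> unit_of F x.
  have OF y : ring_of_integers k y -> ring_of_integers F y by case=> /kF.
  by case=> x0 /OF xO /OF xV.
(* The modulus 1 is a default for classes that are M1-th powers in F. For the others the
   local-global principle provides a modulus at which they fail to be one. *)
have /fin_choice[Qv QvP] v : exists Q, (0 < Q)%N /\
    ((exists2 y, F y & y ^+ M1 = c v) \/
     forall t w, ring_of_integers F t -> ring_of_integers F w -> t ^+ M1 - c v != Q%:R * w).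
  case: (pselect (exists2 y, F y & y ^+ M1 = c v)) => [h|no]; first by exists 1%N; split=> //; left.
  apply: contrapT => nQ; apply: no.
  have kz : F zeta by apply/FE; exists 'X; rewrite ?hornerX //; apply: overX; exact: nf_subring.
  apply: (kummer_power FP zP kz (unitF _ (Uc v)) (ltn0Sn 0)) => Q Q0.
  apply: contrapT => nt; apply: nQ; exists Q; split=> //; right=> t w tO wO.
  apply/negP => /eqP h; apply: nt; exists t => //; exists w => //.
  by rewrite expr1n mul1r.
exists (W.+1 * \prod_v Qv v)%N; first by rewrite muln_gt0 prodn_gt0 // => v; case: (QvP v).
move=> x xU [w aw xw].
have [z xz] := uG x xU.
pose v : {ffun 'I_r -> 'I_M1} := [ffun i => Ordinal (ltn_pmod (absz (z 0%R i %% M1%:Z)%Z) M10)].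
pose e := \prod_i u i ^ (z 0%R i %/ M1%:Z)%Z.
have Ue : unit_of k e.
  apply: big_ind => [||i _]; [exact: unit1|exact: unitM|].
  case: (z 0%R i %/ M1%:Z)%Z => l; first by rewrite -exprnP; exact: unitX.
  by rewrite NegzE -invr_expz -exprnP; apply: unitV; exact: unitX.
have xE : x = c v * e ^+ M1.
  rewrite xz /c /e -prodrXl -big_split; apply: eq_bigr => i _ /=.
  have u0 : u i != 0 by case: (uU i).
  rewrite ffunE /= exprnP [_ ^+ M1]exprnP exprz_exp -expfzDr //; congr (_ ^ _).
  rewrite modn_small ?gez0_abs ?modz_ge0 ?eqz_nat -?lt0n //; last first.
    by rewrite -ltz_nat gez0_abs ?ltz_pmod ?modz_ge0 ?eqz_nat -?lt0n.
  by rewrite addrC -divz_eq.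
have [e0 eO eV] := unitF _ Ue.
have kx := unit_nf xU.
have OR := OK_subring kP; have OF := OK_subring FP.
(* In the second case c v * e ^+ M1, being congruent to 1, would make e^-1 an M1-th root of c v
   modulo Qv v. *)
have [[y Fy yE]|no] := (QvP v).2; last first.
  have wF : ring_of_integers F w.
    apply/(ring_of_integersE F); split=> //; pose q : C := (W.+1 * \prod_v Qv v)%N%:R.
    have -> : w = (x - 1) / q.
      by rewrite xw mulrC mulKf // pnatr_eq0 -lt0n muln_gt0 prodn_gt0 // => v'; case: (QvP v').
    apply: (nfM FP); first by apply: (nfB FP); [exact: kF|exact: nf1].
    by apply: (nfV FP); apply: nf_nat.
  have /negP[] := no e^-1 (- (e^-1 ^+ M1 * (W.+1 * \prod_(v' | v' != v) Qv v')%N%:R * w)) eV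
     (srN OF (srM OF (srM OF (srX OF _ eV) (sr_nat OF _)) wF)).
  apply/eqP; move: xw; rewrite {1}(bigD1 v) //= xE mulnCA natrM => xw.
  have eM : e ^+ M1 != 0 by rewrite expf_neq0.
  rewrite exprVn; move: xw eM; move: (e ^+ M1) (c v) (W.+1 * _)%N%:R (Qv v)%:R => a b q2 q1 xw a0.
  have -> : a^-1 - b = - a^-1 * (b * a - 1) by field.
  by rewrite xw; ring.
have [Y kY yY] := (FE y).1 Fy.
have [c0 cO cV] := Uc v.
have [|t kt tE] := schinzel kP zP (unit_nf (Uc v)) c0 kY _ WP; first by rewrite -yY.
have t0 : t != 0.
  by apply: contraNneq c0 => t0; move/eqP: tE; rewrite t0 expr0n eqn0Ngt M10 eq_sym expf_eq0 W0.
have Ut : unit_of k t.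
  split=> //; apply: (OK_root kP M10) => //; first by rewrite tE; apply: (srX OR).
    exact: (nfV kP).
  by rewrite exprVn tE -exprVn; apply: (srX OR).
(* Since t ^+ M1 = c v ^+ W, the unit c v is t ^+ M2 up to a W-th root of unity. Then x = s ^+ M2 *
   xi below, and both x and s ^+ M2 are congruent to 1 modulo W.+1. *)
pose xi := c v / t ^+ M2.
have xiW : xi ^+ W = 1.
  by rewrite expr_div_n -exprM [(M2 * W)%N]mulnC -/M1 tE divff // expf_neq0.
pose s := t * e ^+ W.
have Us : unit_of k s by apply: unitM => //; exact: unitX.
have xs : x = s ^+ M2 * xi.
  rewrite /s exprMn -exprM -/M1 xE mulrAC [RHS]mulrC mulrC; congr (_ * _).
  by rewrite mulrC divfK // expf_neq0.
have Uxi : unit_of k xi by apply: unitM => //; apply: unitV; apply: unitX.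
have axi b : unit_of k b -> aint b by case=> _ /(ring_of_integersE k)[].
have xi1 : xi = 1.
  have [w' aw' sE] := mP _ (unitX kP M (unitV Us)).
  apply: (@root_of_unity_congruent_one W _ ((\prod_v Qv v)%:R * w + w' * x) W0 xiW (axi _ Uxi)).
    apply: aintD; first by apply: aintM => //; exact: aint_nat.
    by apply: aintM => //; apply: axi.
  have -> : xi = s^-1 ^+ M2 * x.
    by rewrite xs mulrA exprVn mulVf ?mul1r // expf_neq0 //; case: Us.
  have -> : s^-1 ^+ M2 * x - 1 = (x - 1) + (s^-1 ^+ M2 - 1) * x by ring.
  by rewrite /M2 exprM sE xw natrM; ring.
exists (s ^+ m); first exact: unitX.
by rewrite xs xi1 mulr1 -exprM mulnC.
Qed.
End Chevalley.

(** * Profinitely closed subgroups *)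

Section Filtration.
Variables (T : Type) (mul : T -> T -> T) (inv : T -> T) (one : T).
Hypotheses (mulA : associative mul) (mul1 : left_id one mul).
Hypotheses (S : T -> Prop) (N : nat -> T -> Prop).
Hypothesis SV : forall s, S s -> S (inv s) /\ mul s (inv s) = one /\ mul (inv s) s = one.
Hypothesis NM : forall Q s t, S s -> S t -> N Q s -> N Q t -> N Q (mul s t).
Hypothesis NV : forall Q s, S s -> N Q s -> N Q (inv s).
Hypothesis Ndvd : forall Q R s, (0 < R)%N -> N R s -> (Q %| R)%N -> N Q s.
Hypothesis SM : forall s t, S s -> S t -> S (mul s t).
Hypothesis N1 : forall Q, N Q one.
Hypothesis power_near_one : forall Q, (0 < Q)%N ->
  exists2 m, (0 < m)%N & forall s, S s -> N Q (iter m (mul s) one).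

Definition subgroup_of_S (X : T -> Prop) : Prop :=
  [/\ forall s, X s -> S s, X one, forall s t, X s -> X t -> X (mul s t) & forall s, X s -> X (inv s)].

Definition near_subset (X : T -> Prop) (g : T) : Prop :=
  forall Q, (0 < Q)%N -> exists2 h, X h & N Q (mul (inv h) g).

Definition closed_subset (X : T -> Prop) : Prop := forall g, S g -> near_subset X g -> X g.

Definition additive_on (X : T -> Prop) (f : T -> int) : Prop :=
  forall s t, X s -> X t -> f (mul s t) = f s + f t.

(** Here g ranges over S and not only over X: the value of f at a limit point is compared with its
    values on X before the point is known to lie in X. *)
Definition congruence_continuous (X : T -> Prop) (f : T -> int) : Prop :=
  forall g m, S g -> (0 < m)%N -> exists2 Q, (0 < Q)%N &
    forall h, X h -> N Q (mul (inv h) g) -> (m%:Z %| f h - f g)%Z.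

Lemma additive1 X f : subgroup_of_S X -> additive_on X f -> f one = 0.
Proof.
by move=> [_ X1 _ _] fD; apply: (addrI (f one)); rewrite -fD // mul1 addr0.
Qed.

Lemma additiveV X f s : subgroup_of_S X -> additive_on X f -> X s -> f (inv s) = - f s.
Proof.
move=> hX fD Xs; have [XS X1 _ XV] := hX; apply/eqP; rewrite -addr_eq0 -fD //; last exact: XV.
by have [_ [_ ->]] := SV (XS _ Xs); rewrite (additive1 hX fD).
Qed.

Lemma kernel_subgroup X f : subgroup_of_S X -> additive_on X f ->
  subgroup_of_S (fun s => X s /\ f s = 0).
Proof.
move=> hX fD; have [XS X1 XM XV] := hX; split=> [s []||s t [Xs s0] [Xt t0]|s [Xs s0]].
- by move/XS.
- by split=> //; apply: additive1 fD.
- by split; [exact: XM|rewrite fD // s0 t0].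
- by split; [exact: XV|rewrite (additiveV hX) // s0 oppr0].
Qed.

Lemma subgroup_near_one X Q : subgroup_of_S X -> subgroup_of_S (fun s => X s /\ N Q s).
Proof.
move=> [XS X1 XM XV]; split=> [s []||s t [Xs s0] [Xt t0]|s [Xs s0]].
- by move/XS.
- by split.
- by split; [exact: XM|apply: NM => //; exact: XS].
- by split; [exact: XV|apply: NV => //; exact: XS].
Qed.

Lemma additive_multiple X f s (t : int) : subgroup_of_S X -> additive_on X f -> X s ->
  exists2 s', X s' & f s' = t * f s.
Proof.
move=> hX fD Xs; have [XS X1 XM XV] := hX.
have hn m : exists2 s', X s' & f s' = m%:Z * f s.
  elim: m => [|m [s' Xs' E]]; first by exists one; rewrite // (additive1 hX fD) mul0r.
  by exists (mul s s'); [exact: XM|rewrite fD // E -[m.+1]add1n PoszD mulrDl mul1r].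
case: t => m; first exact: hn.
have [s' Xs' E] := hn m.+1; exists (inv s'); first exact: XV.
by rewrite NegzE (additiveV hX) // E mulNr.
Qed.

Lemma additive_iter X f s m : subgroup_of_S X -> additive_on X f -> X s ->
  X (iter m (mul s) one) /\ f (iter m (mul s) one) = m%:Z * f s.
Proof.
move=> hX fD Xs; have [XS X1 XM XV] := hX.
elim: m => [|m [Xi E]] /=; first by rewrite (additive1 hX fD) mul0r.
by split; [exact: XM|rewrite fD // E -[m.+1]add1n PoszD mulrDl mul1r].
Qed.

(* [a] generates the group of values of [f]; an element near [g] is corrected
   into the kernel by a power of [h1] that is itself congruent to one. *)
Theorem closed_of_kernel X f : subgroup_of_S X -> additive_on X f ->
  congruence_continuous X f -> closed_subset (fun s => X s /\ f s = 0) -> closed_subset X.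
Proof.
move=> hX fD fC clK g Sg gX; have [XS X1 XM XV] := hX.
case: (pselect (exists s, X s /\ f s != 0)) => [ex|nex]; last first.
  have f0 s : X s -> f s = 0.
    by move=> Xs; apply/eqP/negPn/negP => fs; apply: nex; exists s.
  by have [] := clK g Sg (fun Q Q0 => let: ex_intro2 h Xh hN := gX Q Q0 in
    ex_intro2 _ _ h (conj Xh (f0 h Xh)) hN).
have [a [a0 [h1 Xh1 h1a] adiv]] : exists a : nat, [/\ (0 < a)%N, exists2 h1, X h1 & f h1 = a%:Z &
    forall h, X h -> (a%:Z %| f h)%Z].
  have exP : exists m, `[< (0 < m)%N /\ exists2 s, X s & f s = m%:Z >].
    have [s [Xs fs]] := ex; exists `|f s|%N; apply/asboolP; split; first by rewrite absz_gt0.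
    have [s' Xs' E] := additive_multiple (sgz (f s)) hX fD Xs.
    by exists s' => //; rewrite E abszEsg.
  case: (ex_minnP exP) => a /asboolP[a0 [h1 Xh1 h1a]] amin.
  exists a; split=> //; first by exists h1.
  move=> h Xh; rewrite (dvdz_eq a%:Z) -subr_eq0; apply/negPn/negP => r0.
  have [h2 Xh2 h2E] := additive_multiple (- (f h %/ a%:Z)%Z) hX fD Xh1.
  have rE : f (mul h h2) = (f h %% a%:Z)%Z.
    by rewrite fD // h2E h1a {1}(divz_eq (f h) a%:Z) mulNr addrAC subrr add0r.
  have az : a%:Z != 0 by rewrite eqz_nat -lt0n.
  have r0' : (f h %% a%:Z)%Z != 0.
    by apply: contraNneq r0 => r0; rewrite {2}(divz_eq (f h) a%:Z) r0 addr0 subrr.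
  suff : (a <= `|(f h %% a%:Z)%Z|)%N.
    by rewrite leqNgt -ltz_nat gez0_abs ?ltz_pmod ?modz_ge0.
  apply: amin; apply/asboolP; split; first by rewrite absz_gt0.
  by exists (mul h h2); [exact: XM|rewrite rE gez0_abs ?modz_ge0].
have aP : a%:Z != 0 by rewrite eqz_nat -lt0n.
(* Values of f on X are multiples of a, and continuity modulo a passes this on to g. *)
have [b bE] : exists b, f g = b * a%:Z.
  have [Q Q0 QP] := fC g a Sg a0; have [h Xh hN] := gX Q Q0.
  apply/dvdzP; rewrite -[f g](subKr (f h)); apply: rpredB; [exact: adiv|exact: QP].
have [h0 Xh0 h0E] := additive_multiple b hX fD Xh1.
have [Sh0 [h0V Vh0]] := SV (XS _ Xh0).
suff /clK : near_subset (fun s => X s /\ f s = 0) (mul (inv h0) g).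
  case=> [|Xg _]; first exact: SM.
  by rewrite -[g]mul1 -h0V -mulA; apply: XM.
move=> Q Q0; have [m m0 mP] := power_near_one Q0.
(* If f h' and f g agree modulo a * m, their difference is a multiple of the value of f at the m-th
   power of h1, which is congruent to 1 modulo Q. The modulus Q * R secures this and the congruence
   of h' with g modulo Q. *)
have [R R0 RP] := fC g (a * m)%N Sg (ltac:(by rewrite muln_gt0 a0)).
have [h' Xh' h'N] := gX (Q * R)%N (ltac:(by rewrite muln_gt0 Q0)).
have QR0 : (0 < Q * R)%N by rewrite muln_gt0 Q0.
have /dvdzP[t tE] := RP h' Xh' (Ndvd QR0 h'N (dvdn_mull _ (dvdnn _))).
have h'Q := Ndvd QR0 h'N (dvdn_mulr _ (dvdnn _)).
have [Xi iE] := additive_iter m hX fD Xh1.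
have [z [Xz zN] zE] := additive_multiple t (subgroup_near_one Q hX)
  (fun s t hs ht => fD s t hs.1 ht.1) (conj Xi (mP _ (XS _ Xh1))).
have Xa := XM _ _ (XV _ Xh0) Xh'; have Xb := XM _ _ Xa (XV _ Xz).
exists (mul (mul (inv h0) h') (inv z)).
  split=> //; rewrite (fD _ _ Xa (XV _ Xz)) (fD _ _ (XV _ Xh0) Xh').
  rewrite (additiveV hX fD Xh0) (additiveV hX fD Xz).
  have -> : f h' = f g + t * (a * m)%:Z by rewrite -tE addrC subrK.
  by rewrite zE iE h1a h0E h1a -bE PoszM; ring.
have Sh' := XS _ Xh'; have [Sh'V [h'V Vh']] := SV Sh'.
have Sz := XS _ Xz; have [SzV [zV Vz]] := SV Sz.
suff -> : mul (inv (mul (mul (inv h0) h') (inv z))) (mul (inv h0) g) = mul z (mul (inv h') g).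
  by apply: NM => //; apply: SM.
have [_ [_ qV]] := SV (XS _ Xb).
have e : mul (mul (mul (inv h0) h') (inv z)) (mul z (mul (inv h') g)) = mul (inv h0) g.
  by rewrite -!mulA (mulA (inv z)) Vz mul1 (mulA h') h'V mul1.
by rewrite -e mulA qV mul1.
Qed.

Lemma closed_ext X Y : (forall s, X s <-> Y s) -> closed_subset X -> closed_subset Y.
Proof.
move=> XY clX g Sg gY; apply/XY; apply: clX => // Q /gY[h /XY Xh hN].
by exists h.
Qed.

Lemma closed_of_kernels (I : eqType) (r : seq I) (F : I -> T -> int) X : subgroup_of_S X ->
  (forall i, additive_on X (F i)) -> (forall i, congruence_continuous X (F i)) ->
  closed_subset (fun s => X s /\ forall i, i \in r -> F i s = 0) -> closed_subset X.
Proof.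
elim: r X => [|i r IH] X hX FD FC cl.
  by apply: closed_ext cl => s; split=> [[]|].
apply: (closed_of_kernel hX (FD i) (FC i)); apply: IH.
- exact: kernel_subgroup.
- by move=> j s t [Xs _] [Xt _]; apply: FD.
- move=> j g m Sg m0; have [Q Q0 QP] := FC j g m Sg m0.
  by exists Q => // h [Xh _]; apply: QP.
apply: closed_ext cl => s; split=> [[Xs F0]|[[Xs i0] F0]].
  by split; [split=> //; apply: F0; exact: mem_head|move=> j jr; apply: F0; rewrite inE jr orbT].
by split=> // j; rewrite inE => /predU1P[->|/F0].
Qed.
End Filtration.

Lemma unitriangular_entry (R : pzRingType) n (A B : 'M[R]_n) (a b : 'I_n) :
  is_trig_mx A -> is_trig_mx B -> A a a = 1 -> B b b = 1 -> (b < a)%N ->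
  (forall c : 'I_n, (b < c < a)%N -> A a c = 0) -> (A *m B) a b = A a b + B a b.
Proof.
move=> /is_trig_mxP hA /is_trig_mxP hB Aa Bb ba mid.
have nab : a != b by apply: contraTneq ba => ->; rewrite ltnn.
rewrite mxE (bigD1 b) //= (bigD1 a) //= big1 => [|c /andP[cb ca]].
  by rewrite Aa Bb mulr1 mul1r addr0.
case: (ltngtP b c) => [bc|cb'|/val_inj e]; last by rewrite e eqxx in cb.
  case: (ltngtP c a) => [ca'|ac|/val_inj e]; last by rewrite e eqxx in ca.
    by rewrite mid ?bc // mul0r.
  by rewrite hA // mul0r.
by rewrite hB // mulr0.
Qed.

(* Any two matrices are congruent modulo Q = 0, since 0^-1 = 0. *)
Definition mx_cong n (Q : nat) (A B : 'M[C]_n) : Prop := mx_in aint (Q%:R^-1 *: (A - B)).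

Lemma aint_subring : subring_pred aint.
Proof. by split; [exact: aint1|exact: aintB|exact: aintM]. Qed.

Lemma invmx_sub (R : comUnitRingType) n (A B : 'M[R]_n) : A \in unitmx -> B \in unitmx ->
  invmx A - invmx B = invmx A *m (B - A) *m invmx B.
Proof. by move=> uA uB; rewrite mulmxBr mulVmx // mulmxBl mul1mx mulmxK. Qed.

Section MatrixCongruence.
Variables (n : nat).
Implicit Types (A B M : 'M[C]_n) (Q : nat).

Lemma mx_inD (S : C -> Prop) A B : subring_pred S -> mx_in S A -> mx_in S B -> mx_in S (A + B).
Proof. by move=> SR hA hB i j; rewrite mxE; apply: (srD SR). Qed.

Lemma mx_cong_refl Q A : mx_cong Q A A.
Proof. by move=> i j; rewrite subrr scaler0 mxE; exact: aint0. Qed.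

Lemma mx_cong_trans Q B A M : mx_cong Q A B -> mx_cong Q B M -> mx_cong Q A M.
Proof.
move=> h1 h2; have := mx_inD aint_subring h1 h2.
by rewrite -scalerDr addrA subrK.
Qed.

Lemma mx_congMl Q M A B : mx_in aint M -> mx_cong Q A B -> mx_cong Q (M *m A) (M *m B).
Proof.
by move=> hM h; rewrite /mx_cong -mulmxBr scalemxAr; apply: (mx_inM aint_subring).
Qed.

Lemma mx_congMr Q M A B : mx_in aint M -> mx_cong Q A B -> mx_cong Q (A *m M) (B *m M).
Proof.
by move=> hM h; rewrite /mx_cong -mulmxBl scalemxAl; apply: (mx_inM aint_subring).
Qed.

Lemma mx_cong_dvd Q R A B : (0 < R)%N -> (Q %| R)%N -> mx_cong R A B -> mx_cong Q A B.
Proof.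
move=> R0 /dvdnP[t tE] h i j; move: R0; rewrite tE muln_gt0 => /andP[t0 Q0].
have := aintM (aint_nat t) (h i j); rewrite !mxE tE mulrA natrM invfM mulrA divff ?mul1r //.
by rewrite pnatr_eq0 -lt0n.
Qed.

Lemma mx_cong_sym Q A B : mx_cong Q A B -> mx_cong Q B A.
Proof. by move=> h i j; have := aintN (h i j); rewrite !mxE -mulrN opprB. Qed.

Lemma mx_cong_inv Q A B : A \in unitmx -> B \in unitmx ->
  mx_in aint (invmx A) -> mx_in aint (invmx B) ->
  mx_cong Q A B -> mx_cong Q (invmx A) (invmx B).
Proof.
move=> uA uB iA iB /mx_cong_sym h; rewrite /mx_cong (invmx_sub uA uB) scalemxAl scalemxAr.
by apply: (mx_inM aint_subring) => //; apply: (mx_inM aint_subring).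
Qed.

Lemma mx_cong_inv1 Q A : A \in unitmx -> mx_in aint (invmx A) ->
  mx_cong Q A 1%:M -> mx_cong Q (invmx A) 1%:M.
Proof.
move=> uA iA; have i1 : mx_in aint (invmx 1%:M : 'M_n) by rewrite invmx1; exact: (mx_in1 aint_subring).
by move/(mx_cong_inv uA (unitmx1 _ _) iA i1); rewrite invmx1.
Qed.
End MatrixCongruence.

Section Coordinates.
Variable k : C -> Prop.
Hypothesis kP : number_field k.

Lemma integer_coordinates : exists d, exists coord : C -> 'I_d -> int,
  [/\ forall x y i, ring_of_integers k x -> ring_of_integers k y -> coord (x + y) i = coord x i + coord y i,
      forall x, ring_of_integers k x -> (forall i, coord x i = 0) -> x = 0 &
      forall x y (Q : nat) i, ring_of_integers k x -> ring_of_integers k y -> (0 < Q)%N ->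
        aint ((x - y) / Q%:R) -> (Q%:Z %| coord x i - coord y i)%Z].
Proof.
have [d [e fe eO]] := integral_basis kP; have OR := OK_subring kP.
have /choice[z zP] x : exists z, ring_of_integers k x -> x = zspan e z.
  by case: (pselect (in_span e x)) => [[z ->]|h]; [exists z|exists 0 => /eO].
have inj := zspan_inj (qfree_zfree fe).
exists d, (fun x i => z x 0 i); split.
- move=> x y i hx hy; suff -> : z (x + y) = z x + z y by rewrite mxE.
  by apply: inj; rewrite zspanD -!zP //; apply: (srD OR).
- move=> x hx h; rewrite (zP x hx) /zspan big1 // => i _.
  by rewrite h mul0r.
- move=> x y Q i hx hy Q0 h.
  have wO : ring_of_integers k ((x - y) / Q%:R).
    have [kx _] := (ring_of_integersE k x).1 hx; have [ky _] := (ring_of_integersE k y).1 hy.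
    apply/(ring_of_integersE k); split=> //; apply: (nfM kP); first exact: (nfB kP).
    by apply: (nfV kP); apply: nf_nat.
  apply/dvdzP; exists (z ((x - y) / Q%:R) 0 i).
  have : z x - z y = Q%:Z *: z ((x - y) / Q%:R).
    apply: inj; rewrite zspanD zspanN zspanZ -!zP //.
    by rewrite mulrC divfK // pnatr_eq0 -lt0n.
  by move/rowP/(_ i); rewrite !mxE mulrC.
Qed.

Lemma divisible_integer_eq0 x : ring_of_integers k x ->
  (forall Q, (0 < Q)%N -> aint (x / Q%:R)) -> x = 0.
Proof.
have [d [coord [cD c0 cC]]] := integer_coordinates; have OR := OK_subring kP.
move=> xO h; apply: c0 => // i.
have c00 : coord 0 i = 0.
  by apply: (addrI (coord 0 i)); rewrite -cD ?addr0 //; exact: sr0 OR.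
(* A modulus larger than the coordinate forces the coordinate to be 0. *)
have := cC x 0 `|coord x i|%N.+1 i xO (sr0 OR) isT; rewrite !subr0 c00 subr0 => /(_ (h `|coord x i|%N.+1 isT)).
move=> /dvdzP[q qE]; apply/eqP; rewrite -absz_eq0; apply/negPn/negP => nz.
have := congr1 absz qE; rewrite abszM absz_nat => E.
by move: nz E; move: (absz _) (absz q) => a [|b]; rewrite ?mul0n ?mulSn; lia.
Qed.
End Coordinates.

Lemma invmx_mul (R : comUnitRingType) n (A B : 'M[R]_n) : A \in unitmx -> B \in unitmx ->
  invmx (A *m B) = invmx B *m invmx A.
Proof.
move=> uA uB; have uAB : A *m B \in unitmx by rewrite unitmx_mul uA.
by apply: (can_inj (mulKmx uAB)); rewrite mulmxV // mulmxA mulmxK // mulmxV.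
Qed.

(* A matrix comes with the exponents of its diagonal entries, after
   triangularization, in a generating family of units: these exponents are the
   integral coordinates of the diagonal part. *)
Section MarkedMatrices.
Variables (k : C -> Prop) (n r : nat).
Hypothesis kP : number_field k.
Notation OK := (ring_of_integers k).
Notation T := ('M[C]_n * 'M[int]_(n, r))%type.

Definition marked_mul (s t : T) : T := (s.1 *m t.1, s.2 + t.2).
Definition marked_inv (s : T) : T := (invmx s.1, - s.2).
Definition marked_one : T := (1%:M, 0).
Definition integral_marked (s : T) : Prop := GLR OK s.1.
Definition marked_near_one (Q : nat) (s : T) : Prop :=
  mx_cong Q s.1 1%:M /\ forall i j, (Q%:Z %| s.2 i j)%Z.

Lemma GLR_aint A : GLR OK A -> [/\ A \in unitmx, mx_in aint (A : 'M_n) & mx_in aint (invmx A)].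
Proof. by move=> [uA [h1 h2]]; split=> // i j; [case/(ring_of_integersE k): (h1 i j)|case/(ring_of_integersE k): (h2 i j)]. Qed.

Lemma GLR_mul A B : GLR OK A -> GLR OK B -> GLR OK (A *m B : 'M_n).
Proof.
move=> [uA [h1 h2]] [uB [h3 h4]]; have OR := OK_subring kP.
split; first by rewrite unitmx_mul uA.
rewrite invmx_mul //; split; exact: mx_inM OR _ _ _ _ _ _ _.
Qed.

Lemma GLR_inv A : GLR OK A -> GLR OK (invmx A : 'M_n).
Proof. by move=> [uA [h1 h2]]; split; rewrite ?unitmx_inv // invmxK. Qed.

Lemma GLR_1 : GLR OK (1%:M : 'M_n).
Proof.
by split; rewrite ?unitmx1 // invmx1; split; exact: mx_in1 (OK_subring kP) _.
Qed.

Lemma marked_mulA : associative marked_mul.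
Proof. by move=> s t v; rewrite /marked_mul /= mulmxA addrA. Qed.
Lemma marked_mul1 : left_id marked_one marked_mul.
Proof. by move=> [A x]; rewrite /marked_mul /= mul1mx add0r. Qed.
Lemma integral_markedV s : integral_marked s ->
  integral_marked (marked_inv s) /\ marked_mul s (marked_inv s) = marked_one /\ marked_mul (marked_inv s) s = marked_one.
Proof.
move=> Ss; split; first exact: GLR_inv.
by case: Ss => us _; rewrite /marked_mul /marked_inv /= mulmxV // mulVmx // subrr addNr.
Qed.

Lemma integral_markedM s t : integral_marked s -> integral_marked t -> integral_marked (marked_mul s t).
Proof. exact: GLR_mul. Qed.

Lemma marked_near_oneM Q s t : integral_marked s -> integral_marked t ->
  marked_near_one Q s -> marked_near_one Q t -> marked_near_one Q (marked_mul s t).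
Proof.
move=> /GLR_aint[_ As _] _ [hs xs] [ht xt]; split=> [|i j] /=; last first.
  by rewrite mxE rpredD.
by have := mx_congMl As ht; rewrite mulmx1 => h; exact: mx_cong_trans h hs.
Qed.

Lemma marked_near_oneV Q s : integral_marked s -> marked_near_one Q s -> marked_near_one Q (marked_inv s).
Proof.
move=> /GLR_aint[us _ As] [hs xs]; split=> [|i j] /=; last by rewrite mxE rpredN.
exact: mx_cong_inv1.
Qed.

Lemma marked_near_one_dvd Q R s : (0 < R)%N -> marked_near_one R s -> (Q %| R)%N -> marked_near_one Q s.
Proof.
move=> R0 [hs xs] QR; split=> [|i j]; first exact: mx_cong_dvd hs.
by apply: dvdz_trans (xs i j); rewrite dvdzE.
Qed.

Lemma marked_near_one1 Q : marked_near_one Q marked_one.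
Proof. by split=> [|i j]; [exact: mx_cong_refl|rewrite mxE dvdz0]. Qed.

Lemma matrix_residues Q : (0 < Q)%N -> exists (U : finType) (code : 'M[C]_n -> U),
  forall A B, mx_in OK A -> mx_in OK B -> code A = code B -> mx_cong Q A B.
Proof.
move=> Q0; have [U [res resP]] := integer_residues kP Q0.
exists {ffun 'I_n * 'I_n -> U}, (fun A => [ffun ij => res (A ij.1 ij.2)]).
move=> A B hA hB /ffunP h i j; have := h (i, j); rewrite !ffunE /= => hij.
have [w /(ring_of_integersE k)[_ aw] E] := resP _ _ (hA i j) (hB i j) hij.
by rewrite !mxE E mulKf // pnatr_eq0 -lt0n.
Qed.

Lemma matrix_power_near_one Q : (0 < Q)%N -> exists2 m, (0 < m)%N &
  forall A : 'M[C]_n, GLR OK A -> mx_cong Q (A ^+ m) 1.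
Proof.
move=> /matrix_residues[U [code codeP]]; have OR := OK_subring kP.
have aO A : mx_in OK A -> mx_in aint A by move=> h i j; case/(ring_of_integersE k): (h i j).
exists #|U|`!; first exact: fact_gt0.
move=> A [uA [h1 h2]].
pose J (B : 'M[C]_n) := mx_in aint (Q%:R^-1 *: B).
suff : J (A ^+ #|U|`! - 1) by [].
apply: (power_congruent_one codeP _ _ _ _ _ _ h1 h2).
- exact: mx_in1 OR _.
- by move=> B M; exact: mx_inM OR _ _ _ _ _.
- by move=> B M; exact: mx_inD.
- exact: mx_in0 OR _ _.
- by move=> B M /aO hB hM; rewrite /J scalemxAr; exact: mx_inM aint_subring _ _ _ _ _ hB hM.
- by move=> B M /aO hB hM; rewrite /J scalemxAl; exact: mx_inM aint_subring _ _ _ _ _ hM hB.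
- exact: mulmxV.
- exact: mulVmx.
Qed.

Lemma marked_power_near_one Q : (0 < Q)%N -> exists2 m, (0 < m)%N &
  forall s, integral_marked s -> marked_near_one Q (iter m (marked_mul s) marked_one).
Proof.
move=> Q0; have [m m0 mP] := matrix_power_near_one Q0.
have itE (s : T) l : iter l (marked_mul s) marked_one = (s.1 ^+ l : 'M[C]_n, s.2 *+ l).
  elim: l => [|l IH] /=; first by rewrite expr0 mulr0n.
  by rewrite IH /marked_mul /= exprS mulrS.
have pQ l (s : T) : integral_marked s -> mx_cong Q s.1 1 -> mx_cong Q (s.1 ^+ l) 1.
  move=> /GLR_aint[_ As _] h; elim: l => [|l IH]; first exact: mx_cong_refl.
  rewrite exprS; have := mx_congMl As IH; rewrite mulmx1 => h'; exact: mx_cong_trans h' h.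
(* m brings the matrix close to 1, and Q makes the exponents divisible by Q. *)
exists (m * Q)%N; first by rewrite muln_gt0 m0.
move=> s Ss; rewrite itE; split=> [|i j] /=.
  rewrite exprM; apply: (pQ Q (s.1 ^+ m, s.2 : 'M[int]_(n, r))); last exact: mP.
  rewrite /integral_marked /=; elim: (m) => [|l IH]; first exact: GLR_1.
  by rewrite exprS; apply: GLR_mul.
by rewrite mulmxnE -mulr_natr natz PoszM mulrA dvdz_mull.
Qed.
End MarkedMatrices.

Definition conjugate (R : comUnitRingType) n (P A : 'M[R]_n) := P *m A *m invmx P.

Section Conjugate.
Variables (R : comUnitRingType) (n : nat) (P : 'M[R]_n).
Hypothesis uP : P \in unitmx.
Implicit Types A B : 'M[R]_n.

Lemma conjugateM A B : conjugate P (A *m B) = conjugate P A *m conjugate P B.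
Proof. by rewrite /conjugate !mulmxA mulmxKV. Qed.

Lemma conjugate1 : conjugate P 1%:M = 1%:M.
Proof. by rewrite /conjugate mulmx1 mulmxV. Qed.

Lemma conjugateB A B : conjugate P (A - B) = conjugate P A - conjugate P B.
Proof. by rewrite /conjugate mulmxBr mulmxBl. Qed.

Lemma conjugateZ a A : conjugate P (a *: A) = a *: conjugate P A.
Proof. by rewrite /conjugate -scalemxAr -scalemxAl. Qed.

Lemma conjugate_eq1 A : conjugate P A = 1%:M -> A = 1%:M.
Proof.
move=> h; have : invmx P *m conjugate P A *m P = A by rewrite /conjugate !mulmxA mulVmx // mul1mx mulmxKV.
by rewrite h mulmx1 mulVmx.
Qed.

Lemma char_poly_conjugate A : char_poly (conjugate P A) = char_poly A.
Proof.
rewrite /char_poly /char_poly_mx /conjugate; set X := 'X%:M.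
have -> : X - map_mx polyC (P *m A *m invmx P) =
    map_mx polyC P *m (X - map_mx polyC A) *m map_mx polyC (invmx P).
  rewrite mulmxBr mulmxBl !map_mxM; congr (_ - _).
  by rewrite /X scalar_mxC -mulmxA -map_mxM mulmxV // map_mx1 mulmx1.
by rewrite !det_mulmx mulrAC -det_mulmx -map_mxM mulmxV // map_mx1 det1 mul1r.
Qed.
End Conjugate.

Lemma scaled_sub_entry (R : comPzRingType) n (c d : R) (A B : 'M[R]_n) a b :
  (c *: (d *: (A - B))) a b = (c * A a b - c * B a b) * d.
Proof. by rewrite !mxE; ring. Qed.

(** * Closedness of triangular groups in the congruence topology *)

Section Closedness.
Variables (k : C -> Prop) (n r : nat) (u : 'I_r -> C).
Hypotheses (kP : number_field k) (uU : forall i, unit_of k (u i)).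
Variables (H : 'M[C]_n -> Prop) (P : 'M[C]_n).
Hypotheses (hH : is_subgroup H) (HO : forall A, H A -> GLR (ring_of_integers k) A).
Hypotheses (uP : P \in unitmx) (kPm : mx_in k P).
Hypothesis HT : forall A, H A -> is_trig_mx (conjugate P A).
Notation OK := (ring_of_integers k).
Notation T := ('M[C]_n * 'M[int]_(n, r))%type.
Notation L := (conjugate P).
Notation Mul := (@marked_mul n r).
Notation Inv := (@marked_inv n r).
Notation One := (marked_one n r).
Notation S := (@integral_marked k n r).
Notation N := (@marked_near_one n r).
Notation subgroup := (subgroup_of_S Mul Inv One S).
Notation closed := (closed_subset Mul Inv S N).
Notation additive := (additive_on Mul).
Notation continuous := (congruence_continuous Mul Inv S N).

Lemma closed_of_marked_kernels (I : finType) (F : I -> T -> int) X : subgroup X ->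
  (forall i, additive X (F i)) -> (forall i, continuous X (F i)) ->
  closed (fun s => X s /\ forall i, F i s = 0) -> closed X.
Proof.
move=> hX FD FC cl.
have cl' : closed (fun s => X s /\ forall i, i \in enum I -> F i s = 0).
  apply: closed_ext cl => s; split=> [[Xs F0]|[Xs F0]]; split=> // i.
  by apply: F0; rewrite mem_enum.
exact: (closed_of_kernels (@marked_mulA n r) (@marked_mul1 n r) (@integral_markedV k n r)
  (@marked_near_oneM k n r) (@marked_near_oneV k n r) (@marked_near_one_dvd n r)
  (@integral_markedM k n r kP) (@marked_near_one1 n r) (@marked_power_near_one k n r kP)
   hX FD FC cl').
Qed.

(** The entries of [P] and of its inverse lie in k only, so conjugation preserves integrality and
    congruences up to a fixed factor. *)
Lemma conjugate_denominator : exists2 D : nat, (0 < D)%N &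
  forall A, mx_in aint A -> mx_in aint (D%:R *: L A).
Proof.
have den (M : 'M[C]_n) : mx_in k M -> exists2 D : nat, (0 < D)%N & mx_in aint (D%:R *: M).
  move=> hM; have /fin_choice[D DP] (ij : 'I_n * 'I_n) :
      exists D, (0 < D)%N /\ aint (D%:R * M ij.1 ij.2).
    by have [D D0 h] := nf_denominator kP (hM ij.1 ij.2); exists D.
  exists (\prod_ij D ij)%N; first by rewrite prodn_gt0 // => ij; case: (DP ij).
  move=> i j; rewrite mxE (bigD1 (i, j)) //= mulnC natrM -mulrA.
  by apply: aintM; [exact: aint_nat|case: (DP (i, j))].
have [D1 D10 h1] := den _ kPm.
have [D2 D20 h2] := den _ (mx_in_inv (nf_subring kP) (nfV kP) kPm).
exists (D1 * D2)%N; first by rewrite muln_gt0 D10.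
move=> A hA; have -> : (D1 * D2)%:R *: L A = (D1%:R *: P) *m A *m (D2%:R *: invmx P).
  by rewrite /conjugate -!scalemxAl -scalemxAr scalerA natrM.
by apply: (mx_inM aint_subring) => //; apply: (mx_inM aint_subring).
Qed.

Lemma GLR_nf A : GLR OK A -> mx_in k (A : 'M_n).
Proof. by move=> [_ [h _]] i j; case/(ring_of_integersE k): (h i j). Qed.

Lemma conjugate_in A : mx_in k A -> mx_in k (L A).
Proof.
move=> hA; have kR := nf_subring kP; apply: (mx_inM kR); first exact: (mx_inM kR).
exact: mx_in_inv kR (nfV kP) _ _ kPm.
Qed.

Definition unit_monomial (x : 'M[int]_(n, r)) (a : 'I_n) : C := \prod_j u j ^ x a j.

Lemma unit_monomial0 a : unit_monomial 0 a = 1.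
Proof. by apply: big1 => j _; rewrite mxE expr0z. Qed.

Lemma unit_monomialD x y a : unit_monomial (x + y) a = unit_monomial x a * unit_monomial y a.
Proof.
rewrite -big_split; apply: eq_bigr => j _ /=; rewrite mxE expfzDr //.
by case: (uU j).
Qed.

Lemma unit_monomialN x a : unit_monomial x a * unit_monomial (- x) a = 1.
Proof. by rewrite -unit_monomialD subrr unit_monomial0. Qed.

(** The units u may satisfy relations, so exponents are not functions of the matrix. On this group
    of matrices with chosen exponents they become additive functions. *)
Definition lifted (s : T) : Prop := H s.1 /\ forall a, L s.1 a a = unit_monomial s.2 a.

(** The first l subdiagonals vanish: level 0 puts no condition below the diagonal, and level n is
    the trivial group. *)
Definition level (l : nat) (s : T) : Prop :=
  [/\ lifted s, s.2 = 0 & forall a b : 'I_n, (b < a)%N -> (a < b + l.+1)%N -> L s.1 a b = 0].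

Lemma trig_conjugate s : lifted s -> is_trig_mx (L s.1).
Proof. by case=> /HT. Qed.

Lemma lifted_subgroup : subgroup lifted.
Proof.
have [_ [H1 [HM HV]]] := hH; split=> [s []||s t [Hs ds] [Ht dt]|s [Hs ds]].
- by move=> /HO.
- by split=> // a /=; rewrite (conjugate1 uP) unit_monomial0 mxE eqxx.
- split=> [|a] /=; first exact: HM.
  by rewrite (conjugateM uP) trig_mul_diag ?HT // ds dt unit_monomialD.
- split=> [|a] /=; first exact: HV.
  have [us _] := HO Hs.
  have := trig_mul_diag a (HT Hs) (HT (HV _ Hs)).
  rewrite -(conjugateM uP) mulmxV // (conjugate1 uP) mxE eqxx ds => h.
  have m0 : unit_monomial s.2 a != 0.
    by apply/eqP => m0; move/eqP: h; rewrite m0 mul0r oner_eq0.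
  by apply: (mulfI m0); rewrite unit_monomialN -h.
Qed.

Lemma level_diag l s a : level l s -> L s.1 a a = 1.
Proof. by case=> -[_ ds] s0 _; rewrite ds s0 unit_monomial0. Qed.

Lemma level_entry l s t (a b : 'I_n) : level l s -> level l t -> (b < a)%N -> (a < b + l.+2)%N ->
  L (s.1 *m t.1) a b = L s.1 a b + L t.1 a b.
Proof.
move=> hs ht ba abl; rewrite (conjugateM uP).
case: (hs) => ls _ vs; case: (ht) => lt _ _.
apply: (unitriangular_entry (trig_conjugate ls) (trig_conjugate lt) (level_diag a hs) (level_diag b ht)) => //.
by move=> c /andP[bc ca]; apply: vs => //; lia.
Qed.

Lemma level_subgroup l : subgroup (level l).
Proof.
have [lS l1 lM lV] := lifted_subgroup; split=> [s []||s t hs ht|s hs].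
- by move=> /lS.
- split=> // a b ba _ /=; rewrite (conjugate1 uP) mxE.
  by case: eqP ba => // ->; rewrite ltnn.
- case: (hs) => ls s0 vs; case: (ht) => lt t0 vt; split=> [||a b ba abl]; first exact: lM.
    by rewrite /= s0 t0 addr0.
  by rewrite (level_entry hs ht) ?vs ?vt ?addr0 //; lia.
case: (hs) => ls s0 vs; split=> [||a b ba abl]; first exact: lV.
  by rewrite /= s0 oppr0.
have [us _] := lS _ ls; have ld := lV _ ls.
have td : is_trig_mx (L (invmx s.1)) := trig_conjugate ld.
have db : L (invmx s.1) b b = 1.
  by case: ld => _ /(_ b) /= ->; rewrite s0 oppr0 unit_monomial0.
have mid (c : 'I_n) : (b < c < a)%N -> L s.1 a c = 0.
  by move=> /andP[bc ca]; apply: vs => //; lia.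
move: (unitriangular_entry (trig_conjugate ls) td (level_diag a hs) db ba mid).
rewrite -(conjugateM uP) mulmxV // (conjugate1 uP) mxE vs // add0r /= => <-.
by case: eqP ba => // ->; rewrite ltnn.
Qed.

Lemma near_cong Q s t : S s -> N Q (Mul (Inv s) t) ->
  mx_cong Q s.1 t.1 /\ forall i j, (Q%:Z %| s.2 i j - t.2 i j)%Z.
Proof.
move=> /GLR_aint[us As _] [h x]; split=> [|i j]; last first.
  by rewrite -rpredN opprB addrC; have := x i j; rewrite !mxE.
have := mx_congMl As h; rewrite [s.1 *m _](mulKVmx us) mulmx1; exact: mx_cong_sym.
Qed.

Lemma level_closed_last : closed (level n).
Proof.
move=> g Sg gX; suff -> : g = One by case: (level_subgroup n).
have [lS _ _ _] := level_subgroup n.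
have trivial s : level n s -> s = One.
  case: s => A x hs; case: (hs) => [ls /= x0 v]; rewrite x0 /marked_one; congr (_, _).
  apply: (conjugate_eq1 uP); apply/matrixP => a b; rewrite [RHS]mxE.
  case: (ltngtP a b) => [ab|ba|/val_inj <-].
  - have /= /is_trig_mxP -> // := trig_conjugate ls.
    by case: eqP ab => // ->; rewrite ltnn.
  - by rewrite v // ?(leq_trans (ltn_ord a)) ?leq_addl //; [case: eqP ba => // ->; rewrite ltnn|lia].
  - by rewrite eqxx (level_diag _ hs).
have near Q : (0 < Q)%N -> mx_cong Q g.1 1%:M /\ forall i j, (Q%:Z %| g.2 i j)%Z.
  move=> Q0; have [h /trivial -> ] := gX Q Q0; rewrite /marked_inv /= invmx1 => -[/= h1 h2].
  split=> [|i j]; first by rewrite mul1mx in h1.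
  by have := h2 i j; rewrite /= oppr0 add0r.
case: g Sg gX near => A x Sg gX near; rewrite /marked_one; congr (_, _).
  apply/matrixP => i j; apply/eqP; rewrite -subr_eq0; apply/eqP.
  have OR := OK_subring kP; have [_ [hA _]] := Sg.
  apply: (divisible_integer_eq0 kP).
    by apply: (srB OR); [exact: hA|apply: (mx_in1 OR)].
  by move=> Q /near[/(_ i j) h _]; move: h; rewrite !mxE mulrC.
apply/matrixP => i j; rewrite mxE.
have [_ /(_ i j) /dvdzP[q qE]] := near (absz (x i j)).+1 isT.
have {}qE : absz (x i j) = (absz q * (absz (x i j)).+1)%N by rewrite {1}qE abszM.
apply/eqP; rewrite -absz_eq0; move: qE; move: (absz _) (absz q) => a [|b]; rewrite ?mul0n ?mulSn; lia.
Qed.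

Lemma level_closed_step l : closed (level l.+1) -> closed (level l).
Proof.
move=> cl; have [D D0 DP] := conjugate_denominator.
have [d [coord [cD c0 cC]]] := integer_coordinates kP.
have lO s a b : S s -> OK (D%:R * L s.1 a b).
  move=> Ss; have [us As _] := GLR_aint Ss; apply/(ring_of_integersE k); split.
    by apply: (nfM kP); [exact: nf_nat|apply: conjugate_in; exact: GLR_nf].
  by have := DP _ As a b; rewrite mxE.
(* Integral coordinates of the entries on subdiagonal l + 1, with the default 0 elsewhere so that
   all positions can serve as indices. D makes the entries integral. *)
pose F (t : 'I_n * 'I_n * 'I_d) (s : T) : int :=
  if (t.1.1 == t.1.2 + l.+1 :> nat)%N then coord (D%:R * L s.1 t.1.1 t.1.2) t.2 else 0.
have [lS _ _ _] := level_subgroup l.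
apply: (@closed_of_marked_kernels _ F) => [||[[a b] i] g m Sg m0|].
- exact: level_subgroup.
- move=> [[a b] i] s t hs ht; rewrite /F /=; case: eqP => // abl.
  rewrite (level_entry hs ht) ?mulrDr ?cD //; try (by apply: lO; exact: lS); lia.
- exists m => // h hl /(near_cong (lS _ hl))[hg _]; rewrite /F /=; case: eqP => [abl|]; last by rewrite subrr dvdz0.
  apply: cC => //; [exact: lO (lS _ hl)|exact: lO|].
  by have := DP _ hg a b; rewrite conjugateZ conjugateB scaled_sub_entry.
apply: closed_ext cl => s; split=> [[ls s0 v]|[hs F0]].
  split; first by split=> // a b ba abl; apply: v => //; lia.
  move=> [[a b] i]; rewrite /F /=; case: eqP => // abl.
  rewrite v ?mulr0; try lia.
  by apply: (addrI (coord 0 i)); rewrite -cD ?addr0 //; exact: sr0 (OK_subring kP).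
case: (hs) => ls s0 v; split=> // a b ba abl.
case: (eqVneq (a : nat) (b + l.+1)%N) => [E|ne]; last by apply: v => //; lia.
have /eqP : D%:R * L s.1 a b = 0.
  apply: c0 => [|i]; first by apply: lO; exact: lS.
  by have := F0 (a, b, i); rewrite /F /= E eqxx.
by rewrite mulf_eq0 pnatr_eq0 eqn0Ngt D0 => /eqP.
Qed.

Lemma level_closed0 : closed (level 0).
Proof.
suff h l : closed (level l) -> closed (level 0) by apply: (h n); exact: level_closed_last.
by elim: l => // l IH /level_closed_step/IH.
Qed.

Lemma lifted_closed : closed lifted.
Proof.
pose F (ij : 'I_n * 'I_r) (s : T) : int := s.2 ij.1 ij.2.
have [lS _ _ _] := lifted_subgroup.
apply: (@closed_of_marked_kernels _ F) => [||[i j] g m Sg m0|].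
- exact: lifted_subgroup.
- by move=> [i j] s t _ _; rewrite /F /= mxE.
- by exists m => // h hl /(near_cong (lS _ hl))[_ /(_ i j)].
apply: closed_ext level_closed0 => s; split=> [[ls s0 _]|[ls F0]].
  by split=> // -[i j]; rewrite /F s0 mxE.
split=> //; first by apply/matrixP => i j; rewrite [RHS]mxE; exact: (F0 (i, j)).
by move=> a b ba; rewrite addn1 ltnS leqNgt ba.
Qed.
End Closedness.

Section ProfinitelyClosed.
Variables (k : C -> Prop) (n : nat) (H : 'M[C]_n -> Prop) (P : 'M[C]_n).
Hypotheses (kP : number_field k).
Hypotheses (hH : is_subgroup H) (HO : forall A, H A -> GLR (ring_of_integers k) A).
Hypotheses (uP : P \in unitmx) (kPm : mx_in k P).
Hypothesis HT : forall A, H A -> is_trig_mx (conjugate P A).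
Notation OK := (ring_of_integers k).
Notation L := (conjugate P).

Definition congruent_to_subgroup (g : 'M[C]_n) : Prop :=
  forall Q, (0 < Q)%N -> exists2 h, H h & mx_cong Q g h.

Lemma congruent_entry D Q g h a b : (forall A, mx_in aint A -> mx_in aint (D%:R *: L A)) ->
  mx_cong Q g h -> aint ((D%:R * L g a b - D%:R * L h a b) / Q%:R).
Proof. by move=> DP /DP/(_ a b); rewrite conjugateZ conjugateB scaled_sub_entry. Qed.

(** Above the diagonal the entries of L g, scaled by D, are divisible by every Q. *)
Lemma congruent_trig g : GLR OK g -> congruent_to_subgroup g -> is_trig_mx (L g).
Proof.
move=> hg gH; have [D D0 DP] := conjugate_denominator kP kPm.
apply/is_trig_mxP => a b ab; have /eqP : D%:R * L g a b = 0.
  apply: (divisible_integer_eq0 kP) => [|Q Q0].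
    apply/(ring_of_integersE k); split.
      by apply: (nfM kP); [exact: nf_nat|apply: (conjugate_in kP kPm); exact: GLR_nf].
    by have [_ ag _] := GLR_aint hg; have := DP _ ag a b; rewrite mxE.
  have [h hh gh] := gH Q Q0; have := congruent_entry a b DP gh.
  by have /is_trig_mxP -> // := HT hh; rewrite mulr0 subr0.
by rewrite mulf_eq0 pnatr_eq0 eqn0Ngt D0 => /eqP.
Qed.

Lemma congruent_inv g : GLR OK g -> congruent_to_subgroup g -> congruent_to_subgroup (invmx g).
Proof.
move=> /GLR_aint[ug _ ag] gH Q Q0; have [_ [_ [_ HV]]] := hH.
have [h hh gh] := gH Q Q0; exists (invmx h); first exact: HV.
by have [uh _ ah] := GLR_aint (HO hh); apply: mx_cong_inv.
Qed.

(** Conjugation by P introduces denominators, so integrality of the diagonal entries is read off the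
    characteristic polynomial, which it preserves; the same holds for the inverse of g. *)
Lemma congruent_diag_unit g a : GLR OK g -> congruent_to_subgroup g -> unit_of k (L g a a).
Proof.
have diagO f : GLR OK f -> congruent_to_subgroup f -> OK (L f a a).
  move=> hf fH; apply/(ring_of_integersE k); split.
    by apply: (conjugate_in kP kPm); exact: GLR_nf.
  have [_ af _] := GLR_aint hf.
  apply: (@aint_root_monic (char_poly f)); [exact: char_poly_monic|exact: char_poly_over aint_subring af|].
  rewrite -(char_poly_conjugate uP) char_poly_trig; last exact: congruent_trig.
  by rewrite /root horner_prod (bigD1 a) //= !hornerE subrr mul0r.
move=> hg gH; have hV := GLR_inv hg; have gV := congruent_inv hg gH.
have E : L g a a * L (invmx g) a a = 1.
  rewrite -trig_mul_diag; try exact: congruent_trig.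
  by rewrite -(conjugateM uP) mulmxV ?(conjugate1 uP) ?mxE ?eqxx //; case: hg.
have g0 : L g a a != 0 by apply: contraNneq (oner_neq0 C) => g0; rewrite -E g0 mul0r.
split=> //; first exact: diagO.
by rewrite -[_^-1]mulr1 -E mulKf //; exact: diagO.
Qed.

(** Exponents x of the diagonal of g are fixed once. For each Q, Chevalley's theorem makes the
    quotients of the diagonal entries of g and of a close h into Q-th powers of units, so h has
    exponents congruent to x modulo Q. Thus (g, x) is a limit of lifted pairs. *)
Theorem triangular_subgroup_closed g : GLR OK g -> congruent_to_subgroup g -> H g.
Proof.
move=> hg gH; have [r [u uU uG]] := units_finitely_generated kP.
have [D D0 DP] := conjugate_denominator kP kPm.
have /fin_choice[z zP] a : exists z : 'rV[int]_r, L g a a = \prod_j u j ^ z 0 j.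
  by apply: uG; exact: congruent_diag_unit.
pose x : 'M[int]_(n, r) := \matrix_(a, j) z a 0 j.
have xE a : L g a a = unit_monomial u x a.
  by rewrite zP; apply: eq_bigr => j _; rewrite mxE.
suff [] : lifted u H P (g, x) by [].
apply: (lifted_closed kP uU hH HO uP kPm HT) => // Q Q0.
have [R R0 RP] := chevalley kP Q0.
(* Q serves the congruence of the matrices, R Chevalley's theorem, and D pays for the conjugation by
   P. *)
have QRD0 : (0 < Q * (R * D))%N by rewrite !muln_gt0 Q0 R0.
have [h hh gh] := gH _ QRD0.
have hO := HO hh.
have hself : congruent_to_subgroup h by move=> Q' _; exists h => //; exact: mx_cong_refl.
have /fin_choice[y yP] a : exists y : 'rV[int]_r, L g a a = L h a a * (\prod_j u j ^ y 0 j) ^+ Q.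
  have gU := congruent_diag_unit a hg gH; have hU := congruent_diag_unit a hO hself.
  have [h0 _ /(ring_of_integersE k)[_ hV]] := hU.
  have [|w wU wE] := RP _ (unitM kP gU (unitV hU)).
    exists ((L g a a / L h a a - 1) / R%:R); last by rewrite [RHS]mulrC divfK // pnatr_eq0 -lt0n.
    have := aintM (aintM hV (aint_nat Q)) (congruent_entry a a DP gh).
    congr aint; rewrite !natrM; field.
    by rewrite h0 !pnatr_eq0 -!lt0n D0 R0.
  by have [y yE] := uG w wU; exists y; rewrite -yE -wE mulrC divfK.
pose t : 'M[int]_(n, r) := \matrix_(a, j) (x a j - y a 0 j * Q%:Z).
have tE : x = t + \matrix_(a, j) (y a 0 j * Q%:Z).
  by apply/matrixP => a j; rewrite !mxE subrK.
exists (h, t).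
  split=> //= a; have := yP a; rewrite xE {1}tE (unit_monomialD uU).
  have -> : unit_monomial u (\matrix_(a, j) (y a 0 j * Q%:Z)) a = (\prod_j u j ^ y a 0 j) ^+ Q.
    by rewrite -prodrXl; apply: eq_bigr => j _; rewrite mxE exprnP exprz_exp.
  move=> /esym/mulIf; apply; rewrite expf_neq0 //; apply/prodf_neq0 => j _.
  by apply: expfz_neq0; case: (uU j).
have [uh ah hV] := GLR_aint hO; split=> [|i j] /=; last first.
  by rewrite !mxE opprB subrK dvdz_mull.
have /(mx_congMl hV) := mx_cong_dvd QRD0 (dvdn_mulr _ (dvdnn Q)) gh.
by rewrite mulVmx.
Qed.
End ProfinitelyClosed.

(** * Separation by congruence subgroups *)

Lemma points_subgroup n k (G : 'M[C]_n -> Prop) : number_field k -> is_subgroup G ->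
  is_subgroup (points (ring_of_integers k) G).
Proof.
move=> kP [_ [G1 [GM GV]]]; split=> [A [_ []] //|]; split; first by split=> //; exact: GLR_1.
split=> [A B [GA OA] [GB OB]|A [GA OA]]; first by split; [exact: GM|exact: GLR_mul].
by split; [exact: GV|exact: GLR_inv].
Qed.

(** K is the product of H with the principal congruence subgroup of level Q in Gamma. Normality of
    the latter makes K a group, and finiteness of the residues modulo Q gives the index. *)
Lemma congruence_separable n k (Gamma H : 'M[C]_n -> Prop) Q g :
  number_field k -> is_subgroup Gamma -> is_subgroup H -> subsetM H Gamma ->
  (forall A, Gamma A -> GLR (ring_of_integers k) A) -> (0 < Q)%N ->
  ~ (exists2 h, H h & mx_cong Q g h) ->
  exists K : 'M[C]_n -> Prop,
    [/\ is_subgroup K, subsetM K Gamma, finite_index Gamma K, subsetM H K & ~ K g].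
Proof.
move=> kP [GU [G1 [GM GV]]] [_ [H1 [HM HV]]] HG GO Q0 ng.
exists (fun A => Gamma A /\ exists2 h, H h & mx_cong Q A h); split.
- split; [by move=> A [/GU]|split; [by split=> //; exists 1%:M => //; exact: mx_cong_refl|split]].
    move=> A B [GA [a Ha Aa]] [GB [b Hb Bb]]; split; first exact: GM.
    have [_ aA _] := GLR_aint (GO _ GA); have [_ ab _] := GLR_aint (GO _ (HG _ Hb)).
    exists (a *m b); first exact: HM.
    exact: mx_cong_trans (mx_congMl aA Bb) (mx_congMr ab Aa).
  move=> A [GA [a Ha Aa]]; split; first exact: GV.
  have [uA _ aA] := GLR_aint (GO _ GA); have [ua _ aa] := GLR_aint (GO _ (HG _ Ha)).
  by exists (invmx a); [exact: HV|exact: mx_cong_inv].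
- by move=> A [].
- have [U [code codeP]] := matrix_residues n kP Q0.
  have /fin_choice[t tP] (c : U) : exists t, Gamma t /\ forall A, Gamma A -> code A = c -> mx_cong Q A t.
    case: (pselect (exists2 t, Gamma t & code t = c)) => [[t Gt tc]|no].
      exists t; split=> // A GA Ac; apply: codeP; last by rewrite Ac tc.
        by case: (GO _ GA) => _ [].
      by case: (GO _ Gt) => _ [].
    by exists 1%:M; split=> // A GA Ac; case: no; exists A.
  exists #|U|, (fun i => t (enum_val i)); split=> [i|A GA]; first by case: (tP (enum_val i)).
  exists (enum_rank (code A)); rewrite enum_rankK.
  have [Gt At] := tP (code A); split; first by apply: GM => //; exact: GV.
  exists 1%:M => //; have [ut _ tV] := GLR_aint (GO _ Gt).
  by have := mx_congMl tV (At A GA erefl); rewrite mulVmx.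
- by move=> A HA; split; [exact: HG|exists A => //; exact: mx_cong_refl].
by case=> _ /ng.
Qed.

Theorem theorem3p1 (n : nat) (k : C -> Prop) (G B : 'M[C]_n -> Prop) :
  number_field k ->
  linear_algebraic_group G -> zariski_connected G -> k_algebraic k G ->
  borel_subgroup G B ->
  forall H : 'M[C]_n -> Prop,
    is_subgroup H -> subsetM H (points (ring_of_integers k) B) ->
    separable_in (points (ring_of_integers k) G) H.
Proof.
move=> kP [hG _] _ _ [[[hB _] BG conB solB] _] H hH HB g [_ gO] nHg.
have HO A : H A -> GLR (ring_of_integers k) A by move=> /HB[].
have HBk A : H A -> B A /\ mx_in k A by move=> /HB[BA OA]; split=> //; exact: GLR_nf.
have [K [KP kK] [P [uP KPm] PT]] := triangular_over_number_field kP hB conB solB HBk.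
(* The triangular basis lives over K, so closedness is applied over the integers of K, which contain
   those of k. *)
have GLRK A : GLR (ring_of_integers k) A -> GLR (ring_of_integers K) (A : 'M_n).
  move=> [uA [h1 h2]]; split=> //; split=> i j.
    by case: (h1 i j) => /kK; split.
  by case: (h2 i j) => /kK; split.
have [Q Q0 nQ] : exists2 Q, (0 < Q)%N & ~ exists2 h, H h & mx_cong Q g h.
  apply: contrapT => no; apply: nHg.
  apply: (triangular_subgroup_closed KP hH (fun A HA => GLRK A (HO A HA)) uP KPm PT (GLRK _ gO)).
  by move=> Q Q0; apply: contrapT => h; apply: no; exists Q.
apply: (congruence_separable kP (points_subgroup kP hG) hH _ _ Q0 nQ) => [A /HB[BA OA]|A []//].
by split=> //; exact: BG.
Qed.
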